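(* Let $(A,\sigma,u,\Lambda)$ be a semiperfect unitary ring, normalized as in the context, and let $(P,[\beta])$ be a (not necessarily unimodular) quadratic space over it. Let $Q,S,V$ be summands of $P$, and let $\psi:(Q,[\beta|_Q])\to(S,[\beta|_S])$ be an isometry. Assume that the following conditions hold, where (2a), (2b), (2c) are required for every $1\le i\le \ell$: (1a) $L_Q(V)=Q^*$ and $L_S(V)=S^*$. (1b) $\psi x-x\in V$ for all $x\in Q$. (1c) $Q\cong Q^*$ and $S\cong S^*$ as right $A$-modules. (2a) If $(A_i,\sigma_i,u_i,\Lambda_i)$ is split-orthogonal, then $Q_i=0$ or $[\beta_i|_{V_i}]\neq [0]$. (2b) If $D_i\cong \mathbb{F}_2$ and $(A_i,\sigma_i,u_i,\Lambda_i)$ is split-orthogonal, then $[\beta_i|_{V_i\cap V_i^\perp}]\neq[0]$. (2c) If $D_i\cong\mathbb{F}_2\times\mathbb{F}_2$, then there is no $z\in V_i\varepsilon_i$ satisfying $h_{\beta_i}(z,z)=\varepsilon_i$ and $[\beta_i|_{z^\perp\cap V_i}]=[0]$. Then there is an isometry $\varphi\in O(P,[\beta])$ such that $\varphi|_Q=\psi$ and $\varphi$ is a product of quasi-reflections of $(P,[\beta])$ taken with respect to elements of $V$. (In particular $\varphi x-x\in V$ for all $x\in P$.)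
   Context: Rings are associative and unital. An anti-structure on a ring $A$ is a pair $(\sigma,u)$ where $\sigma:A\to A$, $a\mapsto a^\sigma$, is an anti-automorphism and $u\in A^\times$ satisfies $u^\sigma u=1$ and $a^{\sigma\sigma}=uau^{-1}$ for all $a$. Put $\Lambda^{\min}=\{a-a^\sigma u: a\in A\}$, $\Lambda^{\max}=\{a\in A: a^\sigma u=-a\}$. A form parameter is an additive group $\Lambda$ with $\Lambda^{\min}\subseteq\Lambda\subseteq\Lambda^{\max}$ and $a^\sigma\Lambda a\subseteq\Lambda$ for all $a\in A$; then $(A,\sigma,u,\Lambda)$ is called a unitary ring. It is called semiperfect if $A$ is semiperfect, i.e. $A$ is semilocal and idempotents lift modulo $\mathrm{Jac}(A)$. Let $\mathcal{P}(A)$ be the category of finitely generated projective right $A$-modules. For $P\in\mathcal{P}(A)$, $P^*=\mathrm{Hom}_A(P,A)$ is a right $A$-module via $(fa)(x)=a^\sigma f(x)$. A sesquilinear form on $P$ is a biadditive $\beta:P\times P\to A$ with $\beta(xa,yb)=a^\sigma\beta(x,y)b$; these form an abelian group $\mathcal{S}_P$. $\Lambda_P\subseteq\mathcal{S}_P$ is the subgroup of all $\gamma$ with $\gamma(x,y)=-\gamma(y,x)^\sigma u$ and $\gamma(x,x)\in\Lambda$ for all $x,y$. A quadratic space is a pair $(P,[\beta])$ with $P\in\mathcal{P}(A)$ and $[\beta]\in\mathcal{S}_P/\Lambda_P$. Set $h_\beta(x,y)=\beta(x,y)+\beta(y,x)^\sigma u$ and $\hat\beta(x)=\beta(x,x)+\Lambda\in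 A/\Lambda$ (both depend only on $[\beta]$). An isometry $(P,[\beta])\to(P',[\beta'])$ is an $A$-module isomorphism $\psi$ with $[\beta'(\psi\cdot,\psi\cdot)]=[\beta]$; $O(P,[\beta])$ is the group of isometries of $(P,[\beta])$ to itself. For a submodule $Q\subseteq P$, $\beta|_Q$ is the restriction of $\beta$ to $Q\times Q$ and $L_Q:P\to Q^*$ is $x\mapsto[y\mapsto h_\beta(x,y)]$. Quasi-reflections: for idempotents $e,f\in A$, $a\in eAf$ is $(e,f)$-invertible if there is a (necessarily unique) $a^\circ\in fAe$ with $aa^\circ=e$, $a^\circ a=f$. For an idempotent $e$, $y\in Pe$, and an $(e^\sigma,e)$-invertible $c\in e^\sigma\hat\beta(y)e=\beta(y,y)+e^\sigma\Lambda e$, the isometry $s_{y,e,c}:P\to P$, $s_{y,e,c}(x)=x-y\,c^\circ h_\beta(y,x)$, is called an $e$-reflection; a quasi-reflection is an $e$-reflection for some idempotent $e$. It is taken with respect to elements of $V$ if $y\in V$. Reduction: a unitary ring is simple if $0$ and $A$ are its only $\sigma$-invariant ideals. Let $\bar A=A/\mathrm{Jac}(A)$. The induced semisimple unitary ring $(\bar A,\bar\sigma,\bar u,\bar\Lambda)$ (with $\bar\Lambda$ the image of $\Lambda$) factors as a product $\prod_{i=1}^\ell (A_i,\sigma_i,u_i,\Lambda_i)$ of simple artinian unitary rings, and $A_i=\mathrm{M}_{n_i}(D_i)$ with $D_i$ a division ring or a product of a division ring and its opposite. Normalization (standing in the paper): each $(A_i,\sigma_i,u_i,\Lambda_i)$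 is in standard form, meaning: (1) $\sigma_i$ is $(d_{jk})\mapsto(d_{kj}^{\tau})$ for some involution $\tau$ of $D_i$; (2) if $D_i\cong E\times E^{\mathrm{op}}$ with $E$ a division ring, $\tau$ is the exchange involution $(a,b^{\mathrm{op}})\mapsto(b,a^{\mathrm{op}})$; (3) $u_i=1$ if $\tau\ne\mathrm{id}_{D_i}$. (This can always be achieved by replacing $(\sigma,u,\Lambda)$ with $(a\mapsto va^\sigma v^{-1},\,v(v^\sigma)^{-1}u,\,v\Lambda)$ and $\beta$ with $v\beta$, for suitable $v\in A^\times$; this does not change isometries or quasi-reflections.) Let $\varepsilon_i=e_{11}\in A_i$ be the standard matrix unit. For $P\in\mathcal{P}(A)$, write $\bar P=P/P\,\mathrm{Jac}(A)=\prod_{i=1}^\ell P_i$ with $P_i$ a right $A_i$-module, let $\pi_i:P\to P_i$ and $\pi_i:A\to A_i$ be the natural maps, and let $\beta_i$ be the sesquilinear form on $P_i$ with $\beta_i(\pi_ix,\pi_iy)=\pi_i(\beta(x,y))$; $(P_i,[\beta_i])$ is a quadratic space over $(A_i,\sigma_i,u_i,\Lambda_i)$. For a summand $Q\subseteq P$, $Q_i=\pi_i(Q)\subseteq P_i$. For $U\subseteq P_i$, $U^\perp=\{x\in P_i: h_{\beta_i}(x,U)=0\}$, and $z^\perp=\{z\}^\perp$. A simple artinian unitary ring $(B,\tau,w,\Gamma)$ is split-orthogonal if $B\cong\mathrm{M}_n(K)$ for the field $K=\mathrm{Cent}(B)$, $\tau|_K=\mathrm{id}_K$, and $\Gamma$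 is a $K$-vector space with $\dim_K\Gamma=\frac12n(n-1)$. *)

(* Defs.v *)
From mathcomp Require Import all_boot all_order all_algebra.
From mathcomp Require Import classical_sets functions.

Set Implicit Arguments.
Unset Strict Implicit.
Unset Printing Implicit Defensive.
Import GRing.Theory.
Local Open Scope classical_set_scope.
Local Open Scope ring_scope.

(* A right A-module is a left module over the converse ring A^c, and           *)
(* [x *r a] is x acted upon by a on the right: x *r (a * b) = (x *r a) *r b.   *)
Definition rscale (A : pzRingType) (P : lmodType A^c) (x : P) (a : A) : P :=
  (a : A^c) *: x.
Notation "x *r a" := (rscale x a) (at level 40, left associativity) : ring_scope.

Definition ring_iso (R S : pzRingType) : Prop :=
  exists f : {rmorphism R -> S}, bijective f.

Definition division_ring (D : pzRingType) : Prop :=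
  (1 : D) <> 0 /\ forall x : D, x <> 0 -> exists y, x * y = 1 /\ y * x = 1.

Definition center (B : pzRingType) : set B :=
  [set z | forall b, z * b = b * z].

Definition right_ideal (A : pzRingType) (I : set A) : Prop :=
  [/\ I 0, forall a b, I a -> I b -> I (a + b)
    & forall a b, I a -> I (a * b)].

Definition two_sided_ideal (A : pzRingType) (I : set A) : Prop :=
  right_ideal I /\ forall a b, I b -> I (a * b).

Definition maximal_right_ideal (A : pzRingType) (I : set A) : Prop :=
  [/\ right_ideal I, I <> setT
    & forall J : set A, right_ideal J -> I `<=` J -> J = I \/ J = setT].

Definition Jac (A : pzRingType) : set A :=
  [set a | forall I : set A, maximal_right_ideal I -> I a].

(* A/Jac(A) is semisimple: each of its right ideals, i.e. each right ideal I   *)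
(* of A containing Jac(A), is a direct summand modulo Jac(A).                  *)
Definition semilocal (A : pzRingType) : Prop :=
  forall I : set A, right_ideal I -> @Jac A `<=` I ->
  exists J : set A, [/\ right_ideal J, @Jac A `<=` J, I `&` J = @Jac A
    & forall a, exists b c, [/\ I b, J c & a = b + c]].

Definition semiperfect (A : pzRingType) : Prop :=
  semilocal A /\
  forall a : A, Jac (a * a - a) -> exists e : A, e * e = e /\ Jac (e - a).

(* As u^sigma * u = 1 and u is a unit, u^-1 is u^sigma. Unitality of sigma and *)
(* its bijectivity follow from the fields.                                     *)
Record unitary_ring (A : pzRingType) := UnitaryRing {
  usigma : A -> A;
  uunit : A;
  upar : set A;
  usigmaD : forall a b, usigma (a + b) = usigma a + usigma b;
  usigmaM : forall a b, usigma (a * b) = usigma b * usigma a;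
  uunitVl : usigma uunit * uunit = 1;
  uunitVr : uunit * usigma uunit = 1;
  usigmaK : forall a, usigma (usigma a) = uunit * a * usigma uunit;
  upar0 : upar 0;
  uparB : forall a b, upar a -> upar b -> upar (a - b);
  upar_min : forall a, upar (a - usigma a * uunit);
  upar_max : forall a, upar a -> usigma a * uunit = - a;
  uparJ : forall a b, upar b -> upar (usigma a * b * a)
}.

Definition simple_unitary (A : pzRingType) (X : unitary_ring A) : Prop :=
  (1 : A) <> 0 /\
  forall I : set A, two_sided_ideal I -> (usigma X) @` I = I ->
    I = [set 0] \/ I = setT.

(* The ring isomorphism th carries Cent(B) onto the scalar matrices, which is  *)
(* how K is identified with Cent(B); U is the image of the form parameter.     *)
Definition split_orthogonal (B : pzRingType) (X : unitary_ring B) : Prop :=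
  exists (K : fieldType) (n : nat) (th : {rmorphism B -> 'M[K]_n.+1}),
  [/\ bijective th,
      forall z, center z -> usigma X z = z
    & exists U : {vspace 'M[K]_n.+1},
        (forall b, upar X b <-> th b \in U) /\ \dim U = (n.+1 * n)./2].

Definition fin_gen (A : pzRingType) (P : lmodType A^c) : Prop :=
  exists (n : nat) (g : 'I_n -> P),
  forall x, exists a : 'I_n -> A, x = \sum_(k < n) g k *r a k.

Definition projective (A : pzRingType) (P : lmodType A^c) : Prop :=
  forall (M N : lmodType A^c) (g : {linear M -> N}) (f : {linear P -> N}),
  (forall y, exists x, g x = y) ->
  exists h : {linear P -> M}, forall x, g (h x) = f x.

Definition submodule (A : pzRingType) (P : lmodType A^c) (Q : set P) : Prop :=
  [/\ Q 0, forall x y, Q x -> Q y -> Q (x + y)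
    & forall x (a : A), Q x -> Q (x *r a)].

Definition summand (A : pzRingType) (P : lmodType A^c) (Q : set P) : Prop :=
  submodule Q /\
  exists Q' : set P, [/\ submodule Q', Q `&` Q' = [set 0]
    & forall x, exists y z, [/\ Q y, Q' z & x = y + z]].

Definition linear_on (A : pzRingType) (P P' : lmodType A^c) (Q : set P)
    (f : P -> P') : Prop :=
  (forall x y, Q x -> Q y -> f (x + y) = f x + f y) /\
  (forall x (a : A), Q x -> f (x *r a) = f x *r a).

(* An element of Q^* is represented by a function on P which is A-linear on Q; *)
(* its values outside Q are irrelevant.                                        *)
Definition in_dual (A : pzRingType) (P : lmodType A^c) (Q : set P)
    (f : P -> A) : Prop :=
  (forall x y, Q x -> Q y -> f (x + y) = f x + f y) /\
  (forall x (a : A), Q x -> f (x *r a) = f x * a).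

Definition dual_eq (A : pzRingType) (P : lmodType A^c) (Q : set P)
    (f g : P -> A) : Prop :=
  forall y, Q y -> f y = g y.

Definition dual_add (A : pzRingType) (P : lmodType A^c) (f g : P -> A) :
  P -> A := fun y => f y + g y.

Definition dual_act (A : pzRingType) (X : unitary_ring A) (P : lmodType A^c)
    (f : P -> A) (a : A) : P -> A :=
  fun y => usigma X a * f y.

Definition iso_dual (A : pzRingType) (X : unitary_ring A) (P : lmodType A^c)
    (Q : set P) : Prop :=
  exists F : P -> (P -> A),
  [/\ forall x, Q x -> in_dual Q (F x),
      forall x x', Q x -> Q x' -> dual_eq Q (F (x + x')) (dual_add (F x) (F x')),
      forall x a, Q x -> dual_eq Q (F (x *r a)) (dual_act X (F x) a),
      forall x x', Q x -> Q x' -> dual_eq Q (F x) (F x') -> x = x'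
    & forall f, in_dual Q f -> exists x, Q x /\ dual_eq Q (F x) f].

(* A quadratic space (P, [beta]) is given by a representative beta of its class. *)
Record sesquilinear (A : pzRingType) (X : unitary_ring A) (P : lmodType A^c) :=
  Sesquilinear {
  sform :> P -> P -> A;
  sformDl : forall x x' y, sform (x + x') y = sform x y + sform x' y;
  sformDr : forall x y y', sform x (y + y') = sform x y + sform x y';
  sformJ : forall x y a b, sform (x *r a) (y *r b) = usigma X a * sform x y * b
}.

(* gamma|_Q belongs to Lambda_Q, i.e. [gamma|_Q] = [0] *)
Definition null_on (A : pzRingType) (X : unitary_ring A) (P : lmodType A^c)
    (Q : set P) (gamma : P -> P -> A) : Prop :=
  (forall x y, Q x -> Q y -> gamma x y = - (usigma X (gamma y x) * uunit X)) /\
  (forall x, Q x -> upar X (gamma x x)).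

(* psi : (Q, [beta|_Q]) -> (Q', [beta'|_Q']); values of psi outside Q are      *)
(* irrelevant.                                                                 *)
Definition quad_isometry (A : pzRingType) (X : unitary_ring A) (P P' : lmodType A^c)
    (beta : sesquilinear X P) (Q : set P)
    (beta' : sesquilinear X P') (Q' : set P') (psi : P -> P') : Prop :=
  [/\ linear_on Q psi, set_bij Q Q' psi
    & null_on X Q (fun x y => beta' (psi x) (psi y) - beta x y)].

Section Forms.
Variables (A : pzRingType) (X : unitary_ring A) (P : lmodType A^c).
Variable beta : sesquilinear X P.

Definition hform (x y : P) : A := beta x y + usigma X (beta y x) * uunit X.

Definition form_orth (U : set P) : set P :=
  [set x | forall y, U y -> hform x y = 0].

(* L_Q(V) = Q^*, where L_Q x = hform x restricted to Q *)
Definition LQ_onto (Q V : set P) : Prop :=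
  (forall v, V v -> in_dual Q (hform v)) /\
  (forall f, in_dual Q f -> exists v, V v /\ dual_eq Q (hform v) f).

(* s is s_{y,e,c} with y in V; c' is the (e^sigma,e)-inverse c° of c *)
Definition quasi_reflection (V : set P) (s : P -> P) : Prop :=
  exists (e : A) (y : P) (c c' : A),
  [/\ e * e = e,
      V y /\ (exists x, y = x *r e),
      exists2 lam, upar X lam & c = beta y y + usigma X e * lam * e,
      [/\ exists a, c = usigma X e * a * e,
          exists a, c' = e * a * usigma X e,
          c * c' = usigma X e & c' * c = e]
    & forall x, s x = x - y *r (c' * hform y x)].

Definition quasi_reflection_product (V : set P) (phi : P -> P) : Prop :=
  exists (m : nat) (s : 'I_m -> P -> P),
  (forall k, quasi_reflection V (s k)) /\
  phi =1 \big[(fun f g : P -> P => f \o g)/id]_(k < m) s k.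

End Forms.

Definition exchange (E : pzRingType) (x : (E * E^c)%type) : (E * E^c)%type :=
  ((x.2 : E), (x.1 : E^c)).

(* The maps red_pi i induce an isomorphism of A/Jac(A) with the product of the *)
(* matrix rings A_i over D_i = red_D i, which are of size n_i = (red_n i).+1,  *)
(* so that e_11 makes sense. The structure of A_i is the one induced from X.   *)
Record reduction (A : pzRingType) (X : unitary_ring A) := Reduction {
  red_len : nat;
  red_D : 'I_red_len -> pzRingType;
  red_n : 'I_red_len -> nat;
  red_ring : forall i, unitary_ring 'M[red_D i]_((red_n i).+1);
  red_pi : forall i, {rmorphism A -> 'M[red_D i]_((red_n i).+1)};
  red_onto : forall b : (forall i, 'M[red_D i]_((red_n i).+1)),
    exists a, forall i, red_pi i a = b i;
  red_ker : forall a, (forall i, red_pi i a = 0) <-> Jac a;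
  red_sigma : forall i a,
    usigma (red_ring i) (red_pi i a) = red_pi i (usigma X a);
  red_unit : forall i, uunit (red_ring i) = red_pi i (uunit X);
  red_par : forall i, upar (red_ring i) = red_pi i @` upar X;
  red_simple : forall i, simple_unitary (red_ring i);
  red_div : forall i, division_ring (red_D i) \/
    exists E : pzRingType, division_ring E /\ ring_iso (red_D i) (E * E^c)%type
}.

Definition red_A (A : pzRingType) (X : unitary_ring A) (R : reduction X)
  (i : 'I_(red_len R)) : pzRingType := 'M[red_D i]_((red_n i).+1).

Definition involution (D : pzRingType) (tau : D -> D) : Prop :=
  [/\ forall a b, tau (a + b) = tau a + tau b,
      forall a b, tau (a * b) = tau b * tau a
    & forall a, tau (tau a) = a].

Definition standard_form (D : pzRingType) (n : nat)
    (X : unitary_ring 'M[D]_n.+1) : Prop :=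
  exists tau : D -> D,
  [/\ involution tau,
      forall M : 'M[D]_n.+1, usigma X M = \matrix_(j, k) tau (M k j),
      forall E : pzRingType, division_ring E -> ring_iso D (E * E^c)%type ->
        exists th : {rmorphism D -> (E * E^c)%type},
          bijective th /\ forall d, th (tau d) = exchange (th d)
    & (exists d, tau d <> d) -> uunit X = 1].

Definition normalized (A : pzRingType) (X : unitary_ring A)
    (R : reduction X) : Prop :=
  forall i, standard_form (red_ring (r := R) i).

Definition modJac (A : pzRingType) (P : lmodType A^c) : set P :=
  [set x | exists (m : nat) (p : 'I_m -> P) (a : 'I_m -> A),
     (forall k, Jac (a k)) /\ x = \sum_(k < m) p k *r a k].

(* The maps mred_pi i induce an isomorphism of P/P Jac(A) with the product of  *)
(* the right A_i-modules P_i = mred_mod i; mred_form i is the form beta_i.     *)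
Record mod_reduction (A : pzRingType) (X : unitary_ring A) (R : reduction X)
    (P : lmodType A^c) (beta : sesquilinear X P) := ModReduction {
  mred_mod : forall i : 'I_(red_len R), lmodType (red_A i)^c;
  mred_pi : forall i, {additive P -> mred_mod i};
  mred_piJ : forall i x a,
    mred_pi i (x *r a) = mred_pi i x *r (red_pi i a : red_A i);
  mred_onto : forall y : (forall i, mred_mod i),
    exists x, forall i, mred_pi i x = y i;
  mred_ker : forall x, (forall i, mred_pi i x = 0) <-> modJac x;
  mred_form : forall i,
    sesquilinear (red_ring i : unitary_ring (red_A i)) (mred_mod i);
  mred_formE : forall i x y,
    mred_form i (mred_pi i x) (mred_pi i y) = red_pi i (beta x y)
}.

Definition red_e11 (A : pzRingType) (X : unitary_ring A) (R : reduction X)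
  (i : 'I_(red_len R)) : red_A i := delta_mx ord0 ord0.

(* Main.v *)
Require Import Defs.
From HB Require Import structures.
From mathcomp Require Import all_boot all_order all_algebra.
From mathcomp Require Import classical_sets functions boolp.

Set Implicit Arguments.
Unset Strict Implicit.
Unset Printing Implicit Defensive.
Import GRing.Theory.
Local Open Scope classical_set_scope.
Local Open Scope ring_scope.

(** Witt's extension theorem is proved by moving one vector at a time.

    Let [x] and [x'] be vectors of [Pe], for an idempotent [e], at which [beta] has the same
    value, and let [y := x - x'] lie in [V]. The element [h y x] belongs to the class of
    [beta y y]; if it is invertible, the quasi-reflection along [y] that it defines maps [x] to [x']
    ([link_direct]). If it is not, one first reflects [x] along another vector [w] of [V].
    When [e] lifts the first matrix unit of a simple component of [A/Jac(A)], the conditions on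
    [w] only concern the residue ring [D], because invertibility lifts from [D]
    ([red_residue]). There are three cases. If the form parameter has nonzero image in a
    division ring [D], every vector defines a reflection, and [w] only has to avoid two proper
    subgroups ([link_nonzero_parameter]). If the image is zero, [D] is a field, the form
    is a quadratic form, and the component is split-orthogonal: [w] is obtained from an
    anisotropic vector ([link_zero_parameter]), and over the field with two elements from an
    anisotropic vector in the radical ([link_two_elements]). If [D = E x E^op], a hermitian
    form is a bilinear pairing over [E]; up to three reflections are needed, and only
    [E = F_2] requires a condition, the existence of a suitable isotropic vector
    ([exch_link_all]).

    To treat a submodule [Q], one chooses [z] in [V] that defines a reflection and [x]
    in [Q] such that [h z x] is invertible. Then [Q] is the direct sum of [xA] and of the
    complement [Q'] of [z] in [Q] ([split_hyperbolic_pair]). By induction [psi] is extended from [Q'] by a product of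
    quasi-reflections [phi1], and it remains to move [phi1 x] to [psi x] by
    reflections along vectors orthogonal to [psi Q'] ([extend_isometry]). These vectors form a
    smaller submodule of [V], and the hypotheses on [V] do not pass to submodules; but
    the smaller submodule contains [phi1 z] and a vector that pairs invertibly with [psi x], and
    little else is used. Thus the
    hypotheses on the split-orthogonal components and on the components over [F_2 x F_2] serve
    to find [z] ([reflecting_vector_division], [reflecting_vector_exchange],
    [isotropic_corner]).

    The isomorphism of [Q] with its dual enters for [D = E x E^op], where a matrix unit
    splits into two halves that duality exchanges: [Q] must contain as many copies of one
    half as of the other, for [x] to exist. This is expressed by a pairing between the two
    halves ([pairs]), which is replaced by a Schur complement when [Q] is replaced by [Q'].
    The induction is on the length of a list of elements of [Q] that detect when [h v]
    vanishes on [Q] modulo the radical ([detects]), and it ends with Nakayama's lemma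
    ([dual_basis_zero]). *)

(** * Linear arithmetic in an abelian group *)

(** Two formal sums agree in every abelian group when their variables have the same
    integer coefficients, which is decided by computation. *)
Inductive zexpr := ZVar of nat | ZAdd of zexpr & zexpr | ZOpp of zexpr | ZNul.

Fixpoint zeval (V : zmodType) (env : seq V) (t : zexpr) : V :=
  match t with
  | ZVar i => nth 0 env i
  | ZAdd t1 t2 => zeval env t1 + zeval env t2
  | ZOpp t1 => - zeval env t1
  | ZNul => 0
  end.

Fixpoint zcoef (t : zexpr) (i : nat) : int :=
  match t with
  | ZVar j => (i == j)%:R
  | ZAdd t1 t2 => zcoef t1 i + zcoef t2 i
  | ZOpp t1 => - zcoef t1 i
  | ZNul => 0
  end.

Lemma zevalE (V : zmodType) (env : seq V) t :
  zeval env t = \sum_(i < size env) env`_i *~ zcoef t i.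
Proof.
elim: t => [j|t1 IH1 t2 IH2|t1 IH1|] /=.
- have [ltj|lej] := ltnP j (size env).
    rewrite (bigD1 (Ordinal ltj)) //= eqxx mulr1z big1 ?addr0 // => i ij.
    by rewrite (_ : (i : nat) == j = false) ?mulr0z //; apply: contraNF ij => /eqP ij; apply/eqP/val_inj.
  rewrite nth_default // big1 // => i _.
  by rewrite (_ : (i : nat) == j = false) ?mulr0z // ltn_eqF // (leq_trans (ltn_ord i)).
- by rewrite IH1 IH2 -big_split; apply: eq_bigr => i _; rewrite mulrzDr.
- by rewrite IH1 -sumrN; apply: eq_bigr => i _; rewrite mulrNz.
- by rewrite big1 // => i _; rewrite mulr0z.
Qed.

Lemma zeval_eq (V : zmodType) (env : seq V) t1 t2 :
  all (fun i => zcoef t1 i == zcoef t2 i) (iota 0 (size env)) ->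
  zeval env t1 = zeval env t2.
Proof.
move=> /allP eq12; rewrite !zevalE; apply: eq_bigr => i _.
by rewrite (eqP (eq12 _ _)) // mem_iota /=.
Qed.

(* Occurrences are compared up to conversion: the implicit structures of two
   copies of the same term need not be syntactically equal. *)
Ltac zmem x env :=
  match env with
  | nil => constr:(false)
  | ?y :: ?env' =>
      match constr:(Set) with
      | _ => let _ := match constr:(Set) with _ => unify x y end in constr:(true)
      | _ => zmem x env'
      end
  end.

Ltac zenv t env :=
  match t with
  | (?a + ?b)%R => let env := zenv a env in zenv b env
  | (- ?a)%R => zenv a env
  | 0%R => env
  | _ => match zmem t env with true => env | false => constr:(t :: env) end
  end.

Ltac zindex t env :=
  match env with
  | ?y :: ?env' =>
      match constr:(Set) with
      | _ => let _ := match constr:(Set) with _ => unify t y end in constr:(0%N)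
      | _ => let i := zindex t env' in constr:(i.+1)
      end
  end.

Ltac zreify t env :=
  match t with
  | (?a + ?b)%R =>
      let a := zreify a env in let b := zreify b env in constr:(ZAdd a b)
  | (- ?a)%R => let a := zreify a env in constr:(ZOpp a)
  | 0%R => constr:(ZNul)
  | _ => let i := zindex t env in constr:(ZVar i)
  end.

Ltac abel :=
  match goal with
  | |- @eq ?T ?a ?b =>
      let env := zenv a (@nil T) in let env := zenv b env in
      let ta := zreify a env in let tb := zreify b env in
      refine (@zeval_eq _ env ta tb _); vm_compute; reflexivity
  end.

(** * Anti-structures *)

Section AntiStructure.
Variables (A : pzRingType) (X : unitary_ring A).
Local Notation s := (usigma X).
Local Notation u := (uunit X).

Lemma sigma0 : s 0 = 0.
Proof. by apply: (addrI (s 0)); rewrite -usigmaD !addr0. Qed.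

Lemma sigmaN a : s (- a) = - s a.
Proof. by apply: (addrI (s a)); rewrite -usigmaD !subrr sigma0. Qed.

Lemma sigmaB a b : s (a - b) = s a - s b.
Proof. by rewrite usigmaD sigmaN. Qed.

(** Conjugating by [u] inverts the square of [s]. *)
Definition sigma_inv (a : A) : A := s (s u * a * u).

Lemma sigma_invK a : s (sigma_inv a) = a.
Proof. by rewrite usigmaK !mulrA uunitVr mul1r -mulrA uunitVr mulr1. Qed.

Lemma sigma1 : s 1 = 1.
Proof.
by rewrite -[RHS](sigma_invK 1) -[in RHS](mulr1 (sigma_inv 1)) usigmaM sigma_invK mulr1.
Qed.

Lemma sigmaKu a : s (s a) * u = u * a.
Proof. by rewrite usigmaK -!mulrA uunitVl mulr1. Qed.

Lemma sigma_idem e : e * e = e -> s e * s e = s e.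
Proof. by move=> ee; rewrite -usigmaM ee. Qed.

Lemma uparN a : upar X a -> upar X (- a).
Proof. by move=> la; rewrite -sub0r; apply: uparB => //; apply: upar0. Qed.

Lemma uparD a b : upar X a -> upar X b -> upar X (a + b).
Proof. by move=> la lb; rewrite -[b]opprK; apply: uparB => //; apply: uparN. Qed.

(** Exchanging the arguments of a hermitian form twists its value; this is an
    involution because [s u * u = 1]. *)
Lemma twistK a : s (s a * u) * u = a.
Proof. by rewrite usigmaM -mulrA sigmaKu mulrA uunitVl mul1r. Qed.

(** [k] is the inverse of [c] as a map from [eA] to [s(e)A]. *)
Definition inverse_at (e c k : A) : Prop :=
  [/\ c = s e * c * e, k = e * k * s e, c * k = s e & k * c = e].

Lemma inverse_at_twist e c k : e * e = e ->
  inverse_at e c k -> inverse_at e (s c * u) (s u * s k).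
Proof.
move=> ee [ce ke ck kc]; split.
- by rewrite {1}ce !usigmaM -!mulrA sigmaKu.
- rewrite {1}ke !usigmaM usigmaK !mulrA uunitVl mul1r; rewrite -!mulrA; congr (_ * _).
- by rewrite -mulrA (mulrA u) uunitVr mul1r -usigmaM kc.
- by rewrite mulrA -(mulrA (s u)) -usigmaM ck -mulrA sigmaKu mulrA uunitVl mul1r.
Qed.

Lemma inverse_atN e c k : inverse_at e c k -> inverse_at e (- c) (- k).
Proof.
by case=> ce ke ck kc; split; rewrite ?mulrN ?mulNr ?opprK // -?ce -?ke.
Qed.

End AntiStructure.

(** * Right modules and submodules *)

Section RightModule.
Variables (A : pzRingType) (P : lmodType A^c).
Implicit Types (x y : P) (a b : A) (Q : set P).

Lemma rscaleA x a b : x *r (a * b) = x *r a *r b.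
Proof. by rewrite /rscale scalerA. Qed.
Lemma rscaler1 x : x *r 1 = x.
Proof. exact: scale1r. Qed.
Lemma rscaler0 x : x *r (0 : A) = 0.
Proof. exact: scale0r. Qed.
Lemma rscale0r a : (0 : P) *r a = 0.
Proof. exact: scaler0. Qed.
Lemma rscaleDl x y a : (x + y) *r a = x *r a + y *r a.
Proof. exact: scalerDr. Qed.
Lemma rscaleDr x a b : x *r (a + b) = x *r a + x *r b.
Proof. exact: scalerDl. Qed.
Lemma rscaleNl x a : (- x) *r a = - (x *r a).
Proof. exact: scalerN. Qed.
Lemma rscaleNr x a : x *r (- a) = - (x *r a).
Proof. exact: scaleNr. Qed.
Lemma rscaleBl x y a : (x - y) *r a = x *r a - y *r a.
Proof. exact: scalerBr. Qed.
Lemma rscaleBr x a b : x *r (a - b) = x *r a - x *r b.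
Proof. exact: scalerBl. Qed.
Lemma rscale_suml (I : Type) (r : seq I) (p : pred I) (F : I -> P) a :
  (\sum_(k <- r | p k) F k) *r a = \sum_(k <- r | p k) F k *r a.
Proof. exact: scaler_sumr. Qed.

Lemma submodule0 Q : submodule Q -> Q 0. Proof. by case. Qed.
Lemma submoduleD Q x y : submodule Q -> Q x -> Q y -> Q (x + y).
Proof. by case=> _ + _; apply. Qed.
Lemma submoduleZ Q x a : submodule Q -> Q x -> Q (x *r a).
Proof. by case=> _ _; apply. Qed.
Lemma submoduleN Q x : submodule Q -> Q x -> Q (- x).
Proof. by move=> sQ Qx; rewrite -[x]rscaler1 -rscaleNr; apply: submoduleZ. Qed.
Lemma submoduleB Q x y : submodule Q -> Q x -> Q y -> Q (x - y).
Proof. by move=> sQ Qx Qy; apply: submoduleD => //; apply: submoduleN. Qed.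
Lemma submodule_sum Q (I : Type) (r : seq I) (p : pred I) (F : I -> P) :
  submodule Q -> (forall k, Q (F k)) -> Q (\sum_(k <- r | p k) F k).
Proof.
move=> sQ QF; apply: big_ind => //; first exact: submodule0.
by move=> x y; apply: submoduleD.
Qed.

End RightModule.

(** * Hermitian forms and quasi-reflections *)

Section Reflections.
Variables (A : pzRingType) (X : unitary_ring A) (P : lmodType A^c).
Variable beta : sesquilinear X P.
Local Notation s := (usigma X).
Local Notation u := (uunit X).
Local Notation h := (hform beta).
Implicit Types (x y : P) (a b : A) (V : set P).

Lemma sform0r x : beta x 0 = 0.
Proof. by apply: (addrI (beta x 0)); rewrite -sformDr !addr0. Qed.
Lemma sform0l x : beta 0 x = 0.
Proof. by apply: (addrI (beta 0 x)); rewrite -sformDl !addr0. Qed.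
Lemma sformNr x y : beta x (- y) = - beta x y.
Proof. by apply: (addrI (beta x y)); rewrite -sformDr !subrr sform0r. Qed.
Lemma sformNl x y : beta (- x) y = - beta x y.
Proof. by apply: (addrI (beta x y)); rewrite -sformDl !subrr sform0l. Qed.
Lemma sformZr x y a : beta x (y *r a) = beta x y * a.
Proof. by rewrite -{1}[x]rscaler1 sformJ sigma1 mul1r. Qed.
Lemma sformZl x y a : beta (x *r a) y = s a * beta x y.
Proof. by rewrite -{1}[y]rscaler1 sformJ mulr1. Qed.

Lemma hformDl x x' y : h (x + x') y = h x y + h x' y.
Proof. by rewrite /hform sformDl sformDr usigmaD mulrDl addrACA. Qed.
Lemma hformDr x y y' : h x (y + y') = h x y + h x y'.
Proof. by rewrite /hform sformDl sformDr usigmaD mulrDl addrACA. Qed.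
Lemma hformZr x y a : h x (y *r a) = h x y * a.
Proof. by rewrite /hform sformZr sformZl usigmaM mulrDl -!mulrA sigmaKu. Qed.
Lemma hformZl x y a : h (x *r a) y = s a * h x y.
Proof. by rewrite /hform sformZr sformZl usigmaM mulrDr !mulrA. Qed.
Lemma hform0r x : h x 0 = 0.
Proof. by rewrite -(rscaler0 x) hformZr mulr0. Qed.
Lemma hform0l x : h 0 x = 0.
Proof. by rewrite -(rscaler0 x) hformZl sigma0 mul0r. Qed.
Lemma hformNr x y : h x (- y) = - h x y.
Proof. by apply: (addrI (h x y)); rewrite -hformDr !subrr hform0r. Qed.
Lemma hformNl x y : h (- x) y = - h x y.
Proof. by apply: (addrI (h x y)); rewrite -hformDl !subrr hform0l. Qed.
Lemma hformBr x y y' : h x (y - y') = h x y - h x y'.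
Proof. by rewrite hformDr hformNr. Qed.
Lemma hformBl x x' y : h (x - x') y = h x y - h x' y.
Proof. by rewrite hformDl hformNl. Qed.
Lemma hform_sumr x (I : Type) (r : seq I) (p : pred I) (F : I -> P) :
  h x (\sum_(k <- r | p k) F k) = \sum_(k <- r | p k) h x (F k).
Proof. exact: (big_morph _ (hformDr x) (hform0r x)). Qed.
Lemma hform_suml x (I : Type) (r : seq I) (p : pred I) (F : I -> P) :
  h (\sum_(k <- r | p k) F k) x = \sum_(k <- r | p k) h (F k) x.
Proof. exact: (big_morph _ (fun y z => hformDl y z x) (hform0l x)). Qed.

Lemma hformC x y : h y x = s (h x y) * u.
Proof. by rewrite /hform usigmaD mulrDl twistK addrC. Qed.


Definition reflection (y : P) (k : A) (x : P) : P := x - y *r (k * h y x).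

Definition isometric (phi : P -> P) : Prop :=
  [/\ forall x y, phi (x + y) = phi x + phi y,
      forall x a, phi (x *r a) = phi x *r a,
      forall x y, h (phi x) (phi y) = h x y
    & forall x, upar X (beta (phi x) (phi x) - beta x x)].

(** The data of an [e]-reflection [s_(y,e,c)], where [k] is the inverse of [c]. *)
Definition reflector (e : A) (y : P) (c k : A) : Prop :=
  [/\ e * e = e, y *r e = y,
      exists2 lam, upar X lam & c = beta y y + s e * lam * e
    & inverse_at X e c k].

Lemma hform_diag e y c k : reflector e y c k -> h y y = c + s c * u.
Proof.
case=> ee ye [lam llam ->] _; rewrite /hform usigmaD mulrDl addrACA.
have /upar_max -> : upar X (s e * lam * e) by apply: uparJ.
by rewrite subrr addr0.
Qed.

Lemma reflector_twist e y c k :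
  reflector e y c k -> reflector e y (s c * u) (s u * s k).
Proof.
case=> ee ye [lam llam cE] ick; split=> //; last exact: inverse_at_twist.
exists (lam - (c - s c * u)); first by apply: uparB => //; apply: upar_min.
have [cc _ _ _] := ick; have [cc' _ _ _] := inverse_at_twist ee ick.
rewrite mulrBr mulrBl mulrBr mulrBl -cc -cc'.
rewrite [in RHS](_ : s e * lam * e = c - beta y y); last by rewrite cE; abel.
by abel.
Qed.

Lemma reflectionD y k x x' :
  reflection y k (x + x') = reflection y k x + reflection y k x'.
Proof. by rewrite /reflection hformDr mulrDr rscaleDr opprD addrACA. Qed.

Lemma reflectionZ y k x a : reflection y k (x *r a) = reflection y k x *r a.
Proof. by rewrite /reflection hformZr rscaleBl mulrA [in RHS]rscaleA // !rscaleA. Qed.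

(** With [c' := s c * u] this shows that the inverse of a quasi-reflection is one along the
    same vector. *)
Lemma reflectionK e y c k c' k' : e * e = e -> y *r e = y ->
  inverse_at X e c k -> inverse_at X e c' k' -> h y y = c + c' ->
  cancel (reflection y k) (reflection y k').
Proof.
move=> ee ye [_ ke ck kc] [_ ke' ck' kc'] hyy x.
have kck : k' * (c + c') * k = k' + k.
  rewrite mulrDr mulrDl kc' -mulrA ck; congr (_ + _).
    by rewrite {1}ke' -!mulrA -usigmaM ee mulrA -ke'.
  by rewrite {1}ke !mulrA ee -ke.
rewrite /reflection hformBr hformZr hyy mulrBr rscaleBr.
have -> : k' * ((c + c') * (k * h y x)) = (k' + k) * h y x.
  by rewrite -kck !mulrA.
by rewrite mulrDl rscaleDr; abel.
Qed.

Lemma reflection_isometric e y c k :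
  reflector e y c k -> isometric (reflection y k).
Proof.
move=> rf; have hyy := hform_diag rf; case: rf => ee ye [lam llam cE] [ce ke ck kc].
have sksk : s k * c * k = s k by rewrite -mulrA ck -usigmaM {1}ke !mulrA ee -ke.
have ek : e * k = k by rewrite {1}ke !mulrA ee -ke.
split; [exact: reflectionD | exact: reflectionZ | |].
- move=> x x'; rewrite /reflection.
  have E : s (k * h y x) * (h y y * (k * h y x')) =
            h x y * (k * h y x') + s (k * h y x) * h y x'.
    rewrite hyy (hformC y x) mulrA mulrDr mulrDl addrC usigmaM; congr (_ + _).
      rewrite -!mulrA; congr (_ * _); rewrite !mulrA -usigmaM ck sigmaKu.
      by rewrite -(mulrA u) ek.
    by rewrite !mulrA -(mulrA (s (h y x))) -(mulrA (s (h y x)) (s k * c)) sksk.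
  by rewrite !(hformBl, hformBr, hformZl, hformZr) E; abel.
- (* The change of the value is [s N * u - N] plus a conjugate of an element of the
     form parameter. *)
  move=> x; set a := h y x; rewrite /reflection -/a.
  rewrite !(sformDl, sformDr, sformNl, sformNr, sformZl, sformZr).
  have -> : beta x y = s a * u - s (beta y x) * u.
    by rewrite -mulrBl -sigmaB /a /hform addrAC subrr add0r twistK.
  set N := s (k * a) * beta y x.
  have -> : (s a * u - s (beta y x) * u) * (k * a) = s a * (u * k) * a - s N * u.
    rewrite /N usigmaM mulrBl -!mulrA; congr (_ - _ * _).
    by rewrite sigmaKu.
  have byy : beta y y = c - s e * lam * e by rewrite cE addrK.
  have -> : s (k * a) * (beta y y * (k * a)) = s a * (s k - s k * lam * k) * a.
    rewrite usigmaM byy -!mulrA; congr (_ * _); rewrite !mulrA; congr (_ * _).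
    rewrite mulrBr mulrBl sksk; congr (_ - _).
    by rewrite !mulrA -usigmaM ek -!mulrA ek.
  have lG : upar X (s a * (s k - u * k - s k * lam * k) * a).
    apply: uparJ; apply: uparB; last exact: uparJ.
    by rewrite -sigmaKu; apply: upar_min.
  have := uparB lG (upar_min X N).
  by rewrite !mulrBr !mulrBl; congr (upar X _); abel.
Qed.
End Reflections.

(** * Products of quasi-reflections *)

Section Products.
Variables (A : pzRingType) (X : unitary_ring A) (P : lmodType A^c).
Variable beta : sesquilinear X P.
Local Notation s := (usigma X).
Local Notation u := (uunit X).
Local Notation h := (hform beta).
Implicit Types (x y : P) (a b : A) (V : set P) (phi : P -> P).

Lemma isometric_id : isometric beta id.
Proof. by split=> // x; rewrite subrr; apply: upar0. Qed.

Lemma isometric_comp phi phi' :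
  isometric beta phi -> isometric beta phi' -> isometric beta (phi \o phi').
Proof.
case=> D1 Z1 H1 Q1 [D2 Z2 H2 Q2]; split=> [x y|x a|x y|x] /=.
- by rewrite D2 D1.
- by rewrite Z2 Z1.
- by rewrite H1 H2.
- by rewrite -(subrK (beta (phi' x) (phi' x)) (beta _ _)) -addrA; apply: uparD.
Qed.

Lemma isometric_quad phi :
  isometric beta phi -> bijective phi -> quad_isometry beta setT beta setT phi.
Proof.
case=> D Z H Q [g fK gK]; split; [by split=> *; rewrite ?D ?Z | | split=> [x y _ _|x _]].
- split=> //; first exact: in2W (can_inj fK).
  by move=> y _; exists (g y).
- have := H x y; rewrite /hform sigmaB mulrBl => E.
  by apply/eqP; rewrite -addr_eq0; apply/eqP; rewrite addrACA E -opprD subrr.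
- exact: Q.
Qed.

Lemma reflector_isometric phi e y c k :
  isometric beta phi -> reflector beta e y c k -> reflector beta e (phi y) c k.
Proof.
case=> D Z H Q [ee ye [lam llam cE] ick].
have fe : phi y *r e = phi y by rewrite -Z ye.
split=> //; exists (lam - (beta (phi y) (phi y) - beta y y)); first exact: uparB.
have dE v : v *r e = v -> s e * beta v v * e = beta v v.
  by move=> ve; rewrite -mulrA -sformZr -sformZl ve.
by rewrite cE !mulrBr !mulrBl !dE //; abel.
Qed.

Lemma quasi_reflectionP V r : quasi_reflection beta V r <->
  exists e y c k, [/\ V y, reflector beta e y c k & r = reflection beta y k].
Proof.
split.
- case=> e [y [c [k [ee [Vy [x yE]] [lam llam cE] [[a ca] [b kb] ck kc] rE]]]].
  have ye : y *r e = y by rewrite yE -rscaleA ee.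
  exists e, y, c, k; split=> //; last exact: funext.
  split=> //; first by exists lam.
  have see := sigma_idem X ee.
  split=> //; first by rewrite ca !mulrA see -!mulrA ee.
  by rewrite kb !mulrA ee -!mulrA see.
- case=> e [y [c [k [Vy [ee ye [lam llam cE] [ca kb ck kc]] ->]]]].
  exists e, y, c, k; split=> //; first by split=> //; exists y.
    by exists lam.
  by split=> //; [exists c | exists k].
Qed.

Lemma qrp_id V : quasi_reflection_product beta V id.
Proof. by exists 0%N, (fun _ => id); split=> [[]//|x]; rewrite big_ord0. Qed.

Lemma qrp_cons V r phi : quasi_reflection beta V r ->
  quasi_reflection_product beta V phi ->
  quasi_reflection_product beta V (r \o phi).
Proof.
move=> qr [m [S [qS phiE]]].
exists m.+1, (fun k => if unlift ord0 k is Some j then S j else r); split.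
  by move=> k; case: unliftP.
move=> x; rewrite big_ord_recl unlift_none /= phiE; congr (r _).
by under eq_bigr do rewrite liftK.
Qed.

Lemma qrp_ind V (Q : (P -> P) -> Prop) : Q id ->
  (forall r phi, quasi_reflection beta V r ->
     quasi_reflection_product beta V phi -> Q phi -> Q (r \o phi)) ->
  forall phi, quasi_reflection_product beta V phi -> Q phi.
Proof.
move=> Qid Qcons phi [m [S [qS phiE]]]; have {phiE phi} -> := funext phiE.
elim: m S qS => [|m IH] S qS; first by rewrite big_ord0.
rewrite big_ord_recl; apply: Qcons => //; last exact: IH.
by exists m, (fun k => S (lift ord0 k)).
Qed.

Lemma qrp_comp V phi phi' : quasi_reflection_product beta V phi ->
  quasi_reflection_product beta V phi' ->
  quasi_reflection_product beta V (phi \o phi').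
Proof.
move=> qphi qphi'; elim/qrp_ind: qphi => // r phi1 qr _ IH.
by rewrite -compA; apply: qrp_cons.
Qed.

Lemma qrp_single V r :
  quasi_reflection beta V r -> quasi_reflection_product beta V r.
Proof. by move=> qr; rewrite -[r]/(r \o id); apply: qrp_cons => //; apply: qrp_id. Qed.

Lemma qrp_sub V V' phi : V `<=` V' ->
  quasi_reflection_product beta V phi -> quasi_reflection_product beta V' phi.
Proof.
move=> sub [m [S [qS phiE]]]; exists m, S; split=> // k.
have /quasi_reflectionP [e [y [c [k' [Vy rf ->]]]]] := qS k.
by apply/quasi_reflectionP; exists e, y, c, k'; split=> //; apply: sub.
Qed.

Lemma qrp_isometric V phi : quasi_reflection_product beta V phi ->
  isometric beta phi.
Proof.
elim/qrp_ind => [|r {}phi /quasi_reflectionP[e [y [c [k [Vy rf ->]]]]] _ IH].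
  exact: isometric_id.
by apply: isometric_comp => //; apply: reflection_isometric rf.
Qed.

Lemma reflector_sum e y c k : reflector beta e y c k -> h y y = s c * u + c.
Proof. by move/hform_diag => ->; rewrite addrC. Qed.

Lemma qrp_bij V phi : quasi_reflection_product beta V phi -> bijective phi.
Proof.
elim/qrp_ind => [|r {}phi /quasi_reflectionP[e [y [c [k [Vy rf ->]]]]] _ IH].
  by exists id.
apply: bij_comp => //.
have [ee ye _ ick] := rf; have [_ _ _ ick'] := reflector_twist rf.
exists (reflection beta y (s u * s k)).
  exact: (reflectionK ee ye ick ick' (hform_diag rf)).
exact: (reflectionK ee ye ick' ick (reflector_sum rf)).
Qed.

Lemma qrp_displace V phi x : submodule V ->
  quasi_reflection_product beta V phi -> V (phi x - x).
Proof.
move=> sV; elim/qrp_ind => [|r {}phi /quasi_reflectionP[e [y [c [k [Vy rf ->]]]]] _ IH].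
  by rewrite subrr; apply: submodule0.
rewrite /= /reflection addrAC; apply: submoduleB => //; exact: submoduleZ.
Qed.

Lemma qrp_fix V phi x : (forall v, V v -> h v x = 0) ->
  quasi_reflection_product beta V phi -> phi x = x.
Proof.
move=> Vx; elim/qrp_ind => [|r {}phi /quasi_reflectionP[e [y [c [k [Vy rf ->]]]]] _ IH] //.
by rewrite /= IH /reflection Vx // mulr0 rscaler0 subr0.
Qed.

Definition qrp_linked V x x' : Prop :=
  exists2 phi, quasi_reflection_product beta V phi & phi x = x'.

(** Because [beta] takes the same value at [x] and [x'], the element [h (x - x') x] lies
    in the class of [beta (x - x') (x - x')]; when it is invertible it defines a
    reflection along the difference, and that reflection maps [x] to [x']. *)
Lemma link_direct V e x x' k : submodule V -> e * e = e ->
  x *r e = x -> x' *r e = x' -> V (x - x') ->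
  upar X (beta x' x' - beta x x) ->
  inverse_at X e (h (x - x') x) k -> qrp_linked V x x'.
Proof.
move=> sV ee xe x'e Vy lx ick; set y := x - x' in Vy ick *.
have ye : y *r e = y by rewrite rscaleBl xe x'e.
have rf : reflector beta e y (h y x) k.
  split=> //; set lam := h y x - beta y y.
  have lE : lam = s e * lam * e.
    by rewrite -mulrA mulrBl mulrBr -hformZr -sformZr -hformZl -sformZl xe ye.
  exists lam; last by rewrite -lE /lam; abel.
  have -> : lam = beta x x' - s (beta x x') * u -
     ((beta x x - s (beta x x) * u) + (beta x' x' - beta x x)).
    rewrite /lam /y hformBl /hform !(sformDl, sformDr, sformNl, sformNr); abel.
  apply: uparB; first exact: upar_min.
  by apply: uparD => //; apply: upar_min.
exists (reflection beta y k).
  by apply: qrp_single; apply/quasi_reflectionP; exists e, y, (h y x), k.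
have [_ _ _ kc] := ick.
by rewrite /reflection kc ye /y opprB addrC subrK.
Qed.

(** The twist of [h (x - x') x] is [- h (x - x') x'], so that either value may
    be tested. *)
Lemma link_direct' V e x x' k : submodule V -> e * e = e ->
  x *r e = x -> x' *r e = x' -> V (x - x') ->
  upar X (beta x' x' - beta x x) -> h x' x' = h x x ->
  inverse_at X e (h (x - x') x') k -> qrp_linked V x x'.
Proof.
move=> sV ee xe x'e Vy lx hx ick.
apply: (link_direct (e := e) (k := - (s u * s k))) => //.
have -> : h (x - x') x = - (s (h (x - x') x') * u).
  by rewrite -hformC !(hformBl, hformBr) hx; abel.
exact/inverse_atN/inverse_at_twist.
Qed.

Lemma upar_hform x x' : upar X (beta x' x' - beta x x) -> h x' x' = h x x.
Proof.
move/upar_max; rewrite sigmaB mulrBl => E; rewrite /hform.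
have -> : s (beta x' x') * u = s (beta x x) * u - (beta x' x' - beta x x).
  by rewrite -E; abel.
by abel.
Qed.

Lemma link_trans V x y z :
  qrp_linked V x y -> qrp_linked V y z -> qrp_linked V x z.
Proof.
by case=> phi qphi <- [phi' qphi' <-]; exists (phi' \o phi) => //; apply: qrp_comp.
Qed.

Lemma link_reflection V e y c k x : V y -> reflector beta e y c k ->
  qrp_linked V x (reflection beta y k x).
Proof.
move=> Vy rf; exists (reflection beta y k) => //; apply: qrp_single.
by apply/quasi_reflectionP; exists e, y, c, k.
Qed.

End Products.

(** * Moving one vector to another over a residue division ring *)

Section Invertible.
Variable D : pzRingType.
Implicit Types d : D.

Definition invertible d := exists d', d * d' = 1 /\ d' * d = 1.

Lemma division_mul0 d d' :
  division_ring D -> d <> 0 -> d * d' = 0 -> d' = 0.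
Proof.
by case=> _ inv /inv[d1 [_ d1d]] dd'; rewrite -[d']mul1r -d1d -mulrA dd' mulr0.
Qed.

Lemma division_mul_neq0 d d' :
  division_ring D -> d <> 0 -> d' <> 0 -> d * d' <> 0.
Proof. by move=> dD d0 d'0 /(division_mul0 dD d0). Qed.

Lemma division_inv d : division_ring D -> d <> 0 -> invertible d.
Proof. by case=> _; apply. Qed.

Lemma invertible_neq0 d : (1 : D) <> 0 -> invertible d -> d <> 0.
Proof. by move=> n01 [d' [dd' _]] d0; apply: n01; rewrite -dd' d0 mul0r. Qed.

End Invertible.

Lemma involution1 (D : pzRingType) (tau : D -> D) : involution tau -> tau 1 = 1.
Proof.
by case=> _ tM tK; rewrite -[RHS]tK -[X in _ = tau X]mulr1 tM tK mulr1.
Qed.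

Lemma involution0 (D : pzRingType) (tau : D -> D) : involution tau -> tau 0 = 0.
Proof. by case=> tD _ _; apply: (addrI (tau 0)); rewrite -tD !addr0. Qed.

Lemma involutionN (D : pzRingType) (tau : D -> D) d :
  involution tau -> tau (- d) = - tau d.
Proof.
move=> iD; have [tD _ _] := iD.
by apply: (addrI (tau d)); rewrite -tD !subrr involution0.
Qed.

Lemma involution_eq0 (D : pzRingType) (tau : D -> D) d :
  involution tau -> tau d = 0 -> d = 0.
Proof. by move=> iD td0; have [_ _ tK] := iD; rewrite -(tK d) td0 involution0. Qed.

(** The map [rho] is the (1,1) entry of the image of [A] in one simple factor
    [A_i] of [A/Jac(A)], and [e] is an idempotent lifting the matrix unit; the last
    field says that the units of [eAe] are detected in the residue ring [D]. *)
Record residue (A : pzRingType) (X : unitary_ring A) (e : A) (D : pzRingType)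
    (tau : D -> D) (rho : A -> D) : Prop := Residue {
  res_idem : e * e = e;
  res_tau : involution tau;
  res_add : forall a b, rho (a + b) = rho a + rho b;
  res_mul : forall a b, rho (a * e * b) = rho a * rho b;
  res_e : rho e = 1;
  res_sigma : forall a, rho (usigma X a) = tau (rho a);
  res_u : forall a, rho (a * uunit X) = rho a * rho (uunit X);
  res_onto : forall d, exists a, rho a = d;
  res_unit : forall c, c = usigma X e * c * e -> invertible (rho c) ->
    exists k, inverse_at X e c k
}.

(** The components of a ring [D] isomorphic to [E x E^op] on which [tau] is the exchange
    involution are [p] and [p \o tau]. *)
Record exchange_proj (D : pzRingType) (tau : D -> D) (E : pzRingType) (p : D -> E) :
    Prop := ExchangeProj {
  exch_add : forall d d', p (d + d') = p d + p d';
  exch_mul : forall d d', p (d * d') = p d * p d';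
  exch_1 : p 1 = 1;
  exch_inj : forall d, p d = 0 -> p (tau d) = 0 -> d = 0;
  exch_onto : forall t t', exists d, p d = t /\ p (tau d) = t'
}.

Section Residue.
Variables (A : pzRingType) (X : unitary_ring A) (P : lmodType A^c).
Variable beta : sesquilinear X P.
Variables (e : A) (D : pzRingType) (tau : D -> D) (rho : A -> D).
Hypothesis res : residue X e tau rho.
Local Notation s := (usigma X).
Local Notation u := (uunit X).
Local Notation h := (hform beta).
Implicit Types (x y v w : P) (a b c k : A).

Let ee := res_idem res.
Let it := res_tau res.

Lemma res_1 : rho 1 = 1.
Proof. by rewrite -[LHS]mul1r -(res_e res) -(res_mul res) ee mulr1 (res_e res). Qed.

Lemma res_0 : rho 0 = 0.
Proof. by apply: (addrI (rho 0)); rewrite -(res_add res) !addr0. Qed.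

Lemma res_N a : rho (- a) = - rho a.
Proof. by apply: (addrI (rho a)); rewrite -(res_add res) !subrr res_0. Qed.

Lemma res_B a b : rho (a - b) = rho a - rho b.
Proof. by rewrite (res_add res) res_N. Qed.

Lemma res_mul_s a b : rho (a * s e * b) = rho a * rho b.
Proof.
rewrite -(sigma_invK X a) -(sigma_invK X b).
move: (sigma_inv X a) (sigma_inv X b) => {}a {}b; rewrite -!usigmaM !(res_sigma res).
by rewrite mulrA (res_mul res); have [_ -> _] := it.
Qed.

Lemma res_mule a : rho (a * e) = rho a.
Proof. by rewrite -[a * e]mulr1 (res_mul res) res_1 mulr1. Qed.

Lemma res_mulse a : rho (s e * a) = rho a.
Proof. by rewrite -[s e]mul1r res_mul_s res_1 mul1r. Qed.

Lemma res_inverse c k : inverse_at X e c k ->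
  rho c * rho k = 1 /\ rho k * rho c = 1.
Proof.
case=> ce ke ck kc; split.
  rewrite -(res_mul res) {1}ce -!mulrA (mulrA e) ee mulrA mulrA -ce ck.
  by rewrite (res_sigma res) (res_e res) involution1.
rewrite -res_mul_s {1}ke -!mulrA (mulrA (s e)) (sigma_idem X ee) mulrA mulrA -ke kc.
exact: (res_e res).
Qed.

Definition hres x y : D := rho (h x y).

Lemma hresDl x x' y : hres (x + x') y = hres x y + hres x' y.
Proof. by rewrite /hres hformDl (res_add res). Qed.
Lemma hresDr x y y' : hres x (y + y') = hres x y + hres x y'.
Proof. by rewrite /hres hformDr (res_add res). Qed.
Lemma hresBl x x' y : hres (x - x') y = hres x y - hres x' y.
Proof. by rewrite /hres hformBl res_B. Qed.
Lemma hresBr x y y' : hres x (y - y') = hres x y - hres x y'.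
Proof. by rewrite /hres hformBr res_B. Qed.
Lemma hresZr x y a : y *r e = y -> hres x (y *r a) = hres x y * rho a.
Proof. by move=> ye; rewrite /hres -{1}ye -rscaleA !hformZr mulrA (res_mul res). Qed.
Lemma hresZl x y a : x *r e = x -> hres (x *r a) y = tau (rho a) * hres x y.
Proof.
by move=> xe; rewrite /hres -{1}xe -rscaleA !hformZl usigmaM res_mul_s (res_sigma res).
Qed.

Lemma hresC x y : hres y x = tau (hres x y) * rho u.
Proof. by rewrite /hres hformC (res_u res) (res_sigma res). Qed.

Lemma hform_corner x y : x *r e = x -> y *r e = y -> h x y = s e * h x y * e.
Proof. by move=> xe ye; rewrite -mulrA -hformZr -hformZl xe ye. Qed.

Lemma hres_unit x y : x *r e = x -> y *r e = y -> invertible (hres x y) ->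
  exists k, inverse_at X e (h x y) k.
Proof. by move=> xe ye; apply: (res_unit res); apply: hform_corner. Qed.

Lemma reflector_of_residue w lam : w *r e = w -> upar X lam ->
  invertible (rho (beta w w) + rho lam) ->
  exists c k, reflector beta e w c k /\ rho c = rho (beta w w) + rho lam.
Proof.
move=> we llam; set c := beta w w + s e * lam * e.
have rc : rho c = rho (beta w w) + rho lam.
  by rewrite (res_add res) res_mule res_mulse.
have cE : c = s e * c * e.
  rewrite /c mulrDr mulrDl -[s e * beta w w]sformZl -sformZr !we.
  by rewrite !mulrA (sigma_idem X ee) -!mulrA ee !mulrA.
rewrite -rc => /(res_unit res cE)[k ick]; exists c, k; split=> //.
by split=> //; exists lam.
Qed.

Section Reflect.
Variables (w : P) (c k : A) (rf : reflector beta e w c k).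
Local Notation r := (reflection beta w k).

Lemma reflection_corner x : x *r e = x -> r x *r e = r x.
Proof. by move=> xe; rewrite -reflectionZ xe. Qed.

Let rho_k x : rho (k * h w x) = rho k * hres w x.
Proof.
case: rf => _ _ _ [_ ke _ _]; rewrite -res_mul_s; congr (rho (_ * _)).
by rewrite {2}ke -mulrA (sigma_idem X ee) -ke.
Qed.

Lemma hres_reflectionr v x :
  hres v (r x) = hres v x - hres v w * rho k * hres w x.
Proof. by case: (rf) => _ we _ _; rewrite /reflection hresBr hresZr // rho_k mulrA. Qed.

Lemma hres_reflectionl v x :
  hres (r x) v = hres x v - tau (rho k * hres w x) * hres w v.
Proof. by case: (rf) => _ we _ _; rewrite /reflection hresBl hresZl // rho_k. Qed.
End Reflect.

Section Link.
Variable V : set P.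
Hypothesis sV : submodule V.

(** What an isometry from [xA] to [x'A] that displaces [x] within [V] says about its
    generators. *)
Definition linkable x x' : Prop :=
  [/\ x *r e = x, x' *r e = x', V (x - x') & upar X (beta x' x' - beta x x)].

Lemma linkable_reflection w c k x x' : V w -> reflector beta e w c k ->
  linkable x x' -> linkable (reflection beta w k x) x'.
Proof.
move=> Vw rf [xe x'e Vy lx].
split=> //; first exact: reflection_corner.
  by rewrite /reflection addrAC; apply: submoduleB => //; apply: submoduleZ.
have [_ _ _ /(_ x) lX] := reflection_isometric rf.
by have := uparB lx lX; congr (upar X _); abel.
Qed.

Lemma link_residue x x' : linkable x x' -> invertible (hres (x - x') x') ->
  qrp_linked beta V x x'.
Proof.
case=> xe x'e Vy lx /hres_unit[]; rewrite ?rscaleBl ?xe ?x'e // => k ick.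
exact: (link_direct' sV ee xe x'e Vy lx (upar_hform lx) ick).
Qed.

Lemma link_two_step w c k x x' : V w -> reflector beta e w c k ->
  linkable x x' ->
  invertible (hres (x - x') x' - tau (rho k * hres w x) * hres w x') ->
  qrp_linked beta V x x'.
Proof.
move=> Vw rf lk inv; apply: link_trans (link_reflection x Vw rf) _.
apply: link_residue; first exact: (linkable_reflection Vw rf lk).
move: inv; rewrite (hresBl x) (hresBl (reflection beta w k x)).
by rewrite (hres_reflectionl rf); congr invertible; abel.
Qed.

(** ** Division rings with a nonzero form parameter *)

Section NonzeroParameter.
Hypothesis dD : division_ring D.

Lemma div_tau_neq0 (d : D) : d <> 0 -> tau d <> 0.
Proof. by move=> d0 td0; apply: d0; apply: involution_eq0 td0. Qed.

(** Every vector [w] of [V] defines a reflection, so that one only has to find [w]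
    off the two proper subgroups orthogonal to [x] and to [x']. *)
Lemma link_nonzero_parameter lam z z' x x' :
  upar X lam -> rho lam <> 0 -> linkable x x' ->
  V z -> z *r e = z -> V z' -> z' *r e = z' ->
  hres z x <> 0 -> hres z' x' <> 0 -> qrp_linked beta V x x'.
Proof.
move=> llam rlam lk Vz ze Vz' z'e zx z'x'.
have [inv|/contrapT yx'] := pselect (hres (x - x') x' <> 0).
  by apply: link_residue => //; apply: division_inv.
have [w [Vw we wx wx']] :
    exists w, [/\ V w, w *r e = w, hres w x <> 0 & hres w x' <> 0].
  have [zx'|/contrapT zx'] := pselect (hres z x' <> 0); first by exists z.
  have [z'x|/contrapT z'x] := pselect (hres z' x <> 0); first by exists z'.
  exists (z + z'); split; first exact: submoduleD.
  - by rewrite rscaleDl ze z'e.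
  - by rewrite hresDl z'x addr0.
  - by rewrite hresDl zx' add0r.
have [c [k [rf rc]]] : exists c k, reflector beta e w c k /\ rho c <> 0.
  have [b0|/contrapT b0] := pselect (rho (beta w w) <> 0).
    have [|c [k [rf rc]]] := reflector_of_residue we (upar0 X).
      by rewrite res_0 addr0; apply: division_inv.
    by exists c, k; rewrite rc res_0 addr0.
  have [|c [k [rf rc]]] := reflector_of_residue we llam.
    by rewrite b0 add0r; apply: division_inv.
  by exists c, k; rewrite rc b0 add0r.
apply: (link_two_step Vw rf lk); rewrite yx' sub0r.
apply: division_inv => // /eqP; rewrite oppr_eq0 => /eqP.
apply: division_mul_neq0 => //; apply: div_tau_neq0.
apply: division_mul_neq0 => //.
have [_ _ _ /res_inverse[_ kc]] := rf => k0.
by case: dD => n01 _; apply: n01; rewrite -kc k0 mul0r.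
Qed.

End NonzeroParameter.
(** ** Fields with zero form parameter *)

Section ZeroParameter.
Hypothesis dD : division_ring D.
Hypothesis rho_upar : forall lam, upar X lam -> rho lam = 0.

Lemma zero_param_twist a : tau (rho a) * rho u = rho a.
Proof.
have := rho_upar (upar_min X a); rewrite res_B (res_u res) (res_sigma res).
by move=> /eqP; rewrite subr_eq0 => /eqP <-.
Qed.

Lemma zero_param_u : rho u = 1.
Proof. by have := zero_param_twist 1; rewrite res_1 involution1 // mul1r. Qed.

Lemma zero_param_tau (d : D) : tau d = d.
Proof.
by have [a <-] := res_onto res d; rewrite -[LHS]mulr1 -zero_param_u zero_param_twist.
Qed.

Lemma zero_param_comm (d d' : D) : d * d' = d' * d.
Proof. by have [_ tM _] := it; rewrite -[LHS]zero_param_tau tM !zero_param_tau. Qed.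

Lemma zero_param_hresC x y : hres y x = hres x y.
Proof. by rewrite hresC zero_param_tau zero_param_u mulr1. Qed.

(** The residue of [beta x x], a quadratic form over the field [D]. *)
Local Notation qres x := (rho (beta x x)).

Lemma qresD x y : qres (x + y) = qres x + qres y + hres x y.
Proof.
rewrite sformDl !sformDr !(res_add res) /hres /hform (res_add res) (res_u res).
by rewrite (res_sigma res) zero_param_tau zero_param_u mulr1; abel.
Qed.

Lemma qres_eq x x' : upar X (beta x' x' - beta x x) -> qres x' = qres x.
Proof. by move/rho_upar; rewrite res_B => /eqP; rewrite subr_eq0 => /eqP. Qed.

Lemma qres_reflector w c k : reflector beta e w c k -> qres w <> 0.
Proof.
case=> _ _ [lam llam cE] ick; have [ck _] := res_inverse ick.
have <- : rho c = qres w by rewrite cE (res_add res) res_mule res_mulse (rho_upar llam) addr0.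
exact: (@invertible_neq0 _ _ (proj1 dD) (ex_intro _ _ (conj ck (proj2 (res_inverse ick))))).
Qed.

(** A vector off both hyperplanes with nonzero value suffices; the vectors [x] and
    [x'] are assumed not to be linked by a single reflection, which makes the
    singular vector [x - x'] orthogonal to both. *)
Lemma link_anisotropic x x' : linkable x x' ->
  (hres (x - x') x = 0 -> hres (x - x') x' = 0 -> qres (x - x') = 0 ->
   exists w, [/\ V w, w *r e = w, hres w x <> 0, hres w x' <> 0 & qres w <> 0]) ->
  qrp_linked beta V x x'.
Proof.
move=> lk exw.
have [yx'|/contrapT yx'] := pselect (hres (x - x') x' <> 0).
  by apply: link_residue => //; apply: division_inv.
have qy : qres (x - x') = 0.
  have [_ _ _ /qres_eq qE] := lk.
  by have := qresD (x - x') x'; rewrite subrK yx' addr0 qE -{1}[qres x]add0r => /addIr.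
have yx : hres (x - x') x = 0.
  rewrite -{2}(subrK x' x) hresDr yx' addr0 /hres /hform (res_add res).
  by rewrite (res_u res) (res_sigma res) qy involution0 // mul0r addr0.
have [w [Vw we wx wx' qw]] := exw yx yx' qy.
have [|c [k [rf rc]]] := reflector_of_residue we (upar0 X).
  by rewrite res_0 addr0; apply: division_inv.
apply: (link_two_step Vw rf lk); rewrite yx' sub0r.
apply: division_inv => // /eqP; rewrite oppr_eq0 => /eqP.
apply: division_mul_neq0 => //; apply: div_tau_neq0 => //.
apply: division_mul_neq0 => //.
have [_ _ _ /res_inverse[_ kc]] := rf => k0.
by case: dD => n01 _; apply: n01; rewrite -kc k0 mul0r.
Qed.

(** With at least three scalars, [w] is found among [z' + zt] and [z' + zt + y],
    [y := x - x']: all but two values of [t] make [h w y] nonzero, and then the values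
    of [w] and [w + y] cannot both vanish. *)
Lemma link_zero_parameter (t0 : D) z z' x x' : t0 <> 0 -> t0 <> 1 -> linkable x x' ->
  V z -> z *r e = z -> V z' -> z' *r e = z' ->
  hres z x <> 0 -> qres z <> 0 -> hres z' x' <> 0 -> qrp_linked beta V x x'.
Proof.
move=> t00 t01 lk Vz ze Vz' z'e zx qz z'x'; apply: link_anisotropic => // yx yx' qy.
have [zx'|/contrapT zx'] := pselect (hres z x' <> 0); first by exists z.
have [xe x'e Vy _] := lk.
have [a' [za' _]] := division_inv dD zx.
pose p2 := hres z' x'; pose d := (- hres z' x + t0 * p2) * a'.
have [a ad] := res_onto res d.
pose w := z' + z *r (a * e).
have rd : rho (a * e) = d by rewrite res_mule.
have Vw : V w by apply: submoduleD => //; apply: submoduleZ.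
have we : w *r e = w by rewrite rscaleDl z'e -rscaleA -mulrA ee.
have dzx : d * hres z x = - hres z' x + t0 * p2.
  by rewrite /d -mulrA [a' * _]zero_param_comm za' mulr1.
have wx : hres w x = t0 * p2.
  by rewrite hresDl hresZl // zero_param_tau rd dzx addrA subrr add0r.
have wx' : hres w x' = p2 by rewrite hresDl hresZl // zx' mulr0 addr0.
have wy : hres w (x - x') <> 0.
  rewrite hresBr wx wx' -{2}[p2]mul1r -mulrBl; apply: division_mul_neq0 => //.
  by move/eqP; rewrite subr_eq0 => /eqP.
have t0p : t0 * p2 <> 0 by apply: division_mul_neq0.
have [qw|/contrapT qw] := pselect (qres w <> 0); first by exists w; rewrite wx wx'.
exists (w + (x - x')); split.
- exact: submoduleD.
- by rewrite rscaleDl we rscaleBl xe x'e.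
- by rewrite hresDl yx addr0 wx.
- by rewrite hresDl yx' addr0 wx'.
- by rewrite qresD qw qy !add0r.
Qed.

(** Over the field with two elements, the vector [w] is supplied by the radical. *)
Lemma link_two_elements w z z' x x' : (forall d : D, d = 0 \/ d = 1) ->
  linkable x x' ->
  V z -> z *r e = z -> V z' -> z' *r e = z' ->
  hres z x <> 0 -> hres z' x' <> 0 ->
  V w -> w *r e = w -> qres w <> 0 ->
  (forall v, V v -> v *r e = v -> hres w v = 0) -> qrp_linked beta V x x'.
Proof.
move=> D2 lk Vz ze Vz' z'e zx z'x' Vw we qw wV; apply: link_anisotropic => // yx yx' qy.
have [xe x'e Vy _] := lk.
have wxx' : hres w x = hres w x'.
  by apply/eqP; rewrite -subr_eq0 -hresBr wV // rscaleBl xe x'e.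
have [wx|/contrapT wx] := pselect (hres w x <> 0).
  by exists w; rewrite -wxx'.
have wx' : hres w x' = 0 by rewrite -wxx'.
have [v [Vv ve vx vx']] :
    exists v, [/\ V v, v *r e = v, hres v x <> 0 & hres v x' <> 0].
  have [zx'|/contrapT zx'] := pselect (hres z x' <> 0); first by exists z.
  have [z'x|/contrapT z'x] := pselect (hres z' x <> 0); first by exists z'.
  exists (z + z'); split; first exact: submoduleD.
  - by rewrite rscaleDl ze z'e.
  - by rewrite hresDl z'x addr0.
  - by rewrite hresDl zx' add0r.
have [qv|/contrapT qv] := pselect (qres v <> 0); first by exists v.
exists (v + w); split; first exact: submoduleD.
- by rewrite rscaleDl ve we.
- by rewrite hresDl wx addr0.
- by rewrite hresDl wx' addr0.
- by rewrite qresD qv (zero_param_hresC w v) wV // add0r addr0.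
Qed.

End ZeroParameter.
(** ** Products of a division ring and its opposite *)

Section Exchange.
Variables (E : pzRingType) (p : D -> E).
Hypothesis dE : division_ring E.
Hypothesis pe : exchange_proj tau p.
Hypothesis rho_u : rho u = 1.
Implicit Types (d : D).

(** A hermitian form over [E x E^op] amounts to the single bilinear pairing
    [pairing x y] with values in [E]; it only depends on the second component of [x] and on the
    first component of [y]. *)
Definition pairing x y : E := p (hres x y).
Local Notation b := pairing.

Lemma exch_0 : p 0 = 0.
Proof. by apply: (addrI (p 0)); rewrite -(exch_add pe) !addr0. Qed.
Lemma exch_N d : p (- d) = - p d.
Proof. by apply: (addrI (p d)); rewrite -(exch_add pe) !subrr exch_0. Qed.

Lemma exch_tau x y : p (tau (hres x y)) = b y x.
Proof. by rewrite /pairing (hresC x y) rho_u mulr1. Qed.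

Lemma exch_invertible d : p d <> 0 -> p (tau d) <> 0 -> invertible d.
Proof.
move=> /(division_inv dE)[i1 [pi1 i1p]] /(division_inv dE)[i2 [pi2 i2p]].
have [tD tM tK] := it; have [d' [pd' ptd']] := exch_onto pe i1 i2.
exists d'; split; apply/eqP; rewrite -subr_eq0; apply/eqP; apply: (exch_inj pe);
  by rewrite ?tD ?tM ?(involutionN _ it) ?(involution1 it) (exch_add pe) exch_N
     (exch_mul pe) ?(exch_1 pe) ?pd' ?ptd' ?pi1 ?pi2 ?i1p ?i2p ?(exch_1 pe) subrr.
Qed.

Lemma exch_invertible_neq0 d : invertible d -> p d <> 0 /\ p (tau d) <> 0.
Proof.
case: dE => n01 _ [d' [dd' d'd]]; have [_ tM _] := it.
split=> d0; apply: n01; rewrite -(exch_1 pe).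
  by rewrite -dd' (exch_mul pe) d0 mul0r.
by rewrite -(involution1 it) -d'd tM (exch_mul pe) d0 mul0r.
Qed.

Lemma pairingDl x x' y : b (x + x') y = b x y + b x' y.
Proof. by rewrite /pairing hresDl (exch_add pe). Qed.
Lemma pairingDr x y y' : b x (y + y') = b x y + b x y'.
Proof. by rewrite /pairing hresDr (exch_add pe). Qed.
Lemma pairingBl x x' y : b (x - x') y = b x y - b x' y.
Proof. by rewrite /pairing hresBl (exch_add pe) exch_N. Qed.
Lemma pairingBr x y y' : b x (y - y') = b x y - b x y'.
Proof. by rewrite /pairing hresBr (exch_add pe) exch_N. Qed.
Lemma pairingZr x y a : y *r e = y -> b x (y *r a) = b x y * p (rho a).
Proof. by move=> ye; rewrite /pairing hresZr // (exch_mul pe). Qed.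
Lemma pairingZl x y a : x *r e = x -> b (x *r a) y = p (tau (rho a)) * b x y.
Proof. by move=> xe; rewrite /pairing hresZl // (exch_mul pe). Qed.

Lemma exch_lift (t t' : E) : exists a, p (rho (a * e)) = t /\ p (tau (rho (a * e))) = t'.
Proof.
have [d [dt dt']] := exch_onto pe t t'; have [a ad] := res_onto res d.
by exists a; rewrite res_mule ad.
Qed.

Lemma corner_scale x a : x *r (a * e) *r e = x *r (a * e).
Proof. by rewrite -rscaleA -mulrA ee. Qed.

(** The components of [Pe] may be chosen independently of one another. *)
Lemma exch_mix (V' : set P) w1 w2 : submodule V' ->
  V' w1 -> w1 *r e = w1 -> V' w2 -> w2 *r e = w2 ->
  exists w, [/\ V' w, w *r e = w, forall v, b v w = b v w1
    & forall v, b w v = b w2 v].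
Proof.
move=> sV' Vw1 w1e Vw2 w2e.
have [a1 [a11 a12]] := exch_lift 1 0; have [a2 [a21 a22]] := exch_lift 0 1.
exists (w1 *r (a1 * e) + w2 *r (a2 * e)); split.
- by apply: submoduleD => //; apply: submoduleZ.
- by rewrite rscaleDl !corner_scale.
- by move=> v; rewrite pairingDr !pairingZr // a11 a21 mulr1 mulr0 addr0.
- by move=> v; rewrite pairingDl !pairingZl // a12 a22 mul1r mul0r add0r.
Qed.

Lemma exch_shiftr w y (t : E) : V w -> w *r e = w -> V y -> y *r e = y ->
  exists w', [/\ V w', w' *r e = w' & forall v, b v w' = b v w + b v y * t].
Proof.
move=> Vw we Vy ye; have [a [at1 _]] := exch_lift t 0.
exists (w + y *r (a * e)); split.
- by apply: submoduleD => //; apply: submoduleZ.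
- by rewrite rscaleDl we corner_scale.
- by move=> v; rewrite pairingDr pairingZr // at1.
Qed.

Lemma exch_shiftl w y (t : E) : V w -> w *r e = w -> V y -> y *r e = y ->
  exists w', [/\ V w', w' *r e = w' & forall v, b w' v = b w v + t * b y v].
Proof.
move=> Vw we Vy ye; have [a [_ at1]] := exch_lift 0 t.
exists (w + y *r (a * e)); split.
- by apply: submoduleD => //; apply: submoduleZ.
- by rewrite rscaleDl we corner_scale.
- by move=> v; rewrite pairingDl pairingZl // at1.
Qed.

(** The class of [beta w w] contains a unit with components [c1] and [c2] as soon as
    these have the right sum, because the form parameter of [E x E^op] is
    [{(t, -t)}]. *)
Lemma exch_reflector w (c1 c2 i1 i2 : E) : w *r e = w ->
  c1 * i1 = 1 -> i1 * c1 = 1 -> c2 * i2 = 1 -> i2 * c2 = 1 -> c1 + c2 = b w w ->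
  exists c k, [/\ reflector beta e w c k, p (rho k) = i1 & p (tau (rho k)) = i2].
Proof.
move=> we ci1 ic1 ci2 ic2 c12; have [n01 _] := dE; have [tD tM tK] := it.
have [a [at1 at2]] := exch_lift (c1 - p (rho (beta w w))) 0.
set lam := a * e - s (a * e) * u.
have llam : upar X lam by apply: upar_min.
have rlam : rho lam = rho (a * e) - tau (rho (a * e)).
  by rewrite res_B (res_u res) (res_sigma res) rho_u mulr1.
have bE : b w w = p (rho (beta w w)) + p (tau (rho (beta w w))).
  rewrite /pairing /hres /hform (res_add res) (res_u res) rho_u mulr1.
  by rewrite (res_sigma res) (exch_add pe).
have pc1 : p (rho (beta w w) + rho lam) = c1.
  by rewrite (exch_add pe) rlam (exch_add pe) exch_N at1 at2 subr0 addrCA subrr addr0.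
have pc2 : p (tau (rho (beta w w) + rho lam)) = c2.
  rewrite tD (exch_add pe) rlam tD (involutionN _ it) tK (exch_add pe) exch_N at1 at2.
  by rewrite -(addKr c1 c2) c12 bE; abel.
have nz (c i : E) : c * i = 1 -> c <> 0 by move=> ci c0; apply: n01; rewrite -ci c0 mul0r.
have [|c [k [rf rc]]] := reflector_of_residue we llam.
  by apply: exch_invertible; rewrite ?pc1 ?pc2; apply: nz; [exact: ci1 | exact: ci2].
exists c, k; have [_ _ _ /res_inverse[ck kc]] := rf.
split=> //.
  have := congr1 p kc; rewrite (exch_mul pe) rc pc1 (exch_1 pe) => E1.
  by rewrite -[LHS]mulr1 -ci1 mulrA E1 mul1r.
have := congr1 (p \o tau) kc; rewrite /= tM (exch_mul pe) rc pc2 involution1 // (exch_1 pe) => E1.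
by rewrite -[RHS]mulr1 -E1 mulrA ic2 mul1r.
Qed.

Definition reflecting_sum w :=
  exists c1 c2 : E, [/\ c1 <> 0, c2 <> 0 & c1 + c2 = b w w].

Lemma reflector_sum_units w c k : reflector beta e w c k -> reflecting_sum w.
Proof.
move=> rf; have [_ _ _ /res_inverse[ck kc]] := rf.
have [p1 p2] : p (rho c) <> 0 /\ p (tau (rho c)) <> 0.
  by apply: exch_invertible_neq0; exists (rho k).
exists (p (rho c)), (p (tau (rho c))); split=> //.
rewrite /pairing /hres (hform_diag rf) (res_add res) (res_u res) rho_u mulr1.
by rewrite (res_sigma res) (exch_add pe).
Qed.

Lemma reflecting_sum0 w : b w w = 0 -> reflecting_sum w.
Proof.
case: dE => n01 _ bw; exists 1, (-1); split=> //; last by rewrite subrr bw.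
by move/eqP; rewrite oppr_eq0 => /eqP.
Qed.

Section Pair.
Variables x x' : P.
Hypothesis lk : linkable x x'.
Local Notation y := (x - x').

Lemma linkable_pairing : b x' x' = b x x.
Proof. by case: lk => _ _ _ /upar_hform; rewrite /pairing /hres => ->. Qed.

Lemma pairing_diffl : b y x' = - b x y.
Proof. by rewrite pairingBl pairingBr linkable_pairing opprB. Qed.

Lemma pairing_diffr : b x' y = - b y x.
Proof. by rewrite pairingBl pairingBr linkable_pairing opprB. Qed.

Lemma exch_link : b y x <> 0 -> b x y <> 0 -> qrp_linked beta V x x'.
Proof.
move=> yx xy; apply: link_residue => //; apply: exch_invertible.
  by rewrite -/(b _ _) pairing_diffl => /eqP; rewrite oppr_eq0 => /eqP.
by rewrite exch_tau pairing_diffr => /eqP; rewrite oppr_eq0 => /eqP.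
Qed.

Lemma exch_reflect w (c1 c2 i1 i2 : E) : V w -> w *r e = w ->
  c1 * i1 = 1 -> i1 * c1 = 1 -> c2 * i2 = 1 -> i2 * c2 = 1 -> c1 + c2 = b w w ->
  exists c k, let X1 := reflection beta w k x in
   [/\ reflector beta e w c k,
    b (X1 - x') X1 = b y x + b x' w * i1 * b w x
    & b X1 (X1 - x') = b x y + b x w * i2 * b w x'].
Proof.
move=> Vw we ci1 ic1 ci2 ic2 c12; have [_ tM _] := it.
have [c [k [rf pk1 pk2]]] := exch_reflector we ci1 ic1 ci2 ic2 c12.
exists c, k => X1; have lkX : linkable X1 x' by apply: linkable_reflection rf lk.
have bX : b X1 X1 = b x' x'.
  by case: lkX => _ _ _ /upar_hform; rewrite /pairing /hres => ->.
have bx'X : b x' X1 = b x' x - b x' w * i1 * b w x.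
  by rewrite /pairing (hres_reflectionr rf) (exch_add pe) exch_N !(exch_mul pe) pk1.
have bXx' : b X1 x' = b x x' - b x w * i2 * b w x'.
  rewrite /pairing (hres_reflectionl rf) (exch_add pe) exch_N !(exch_mul pe).
  by rewrite tM (exch_mul pe) pk2 exch_tau.
split=> //.
  by rewrite (pairingBl X1 x' X1) (pairingBl x x' x) bX bx'X linkable_pairing; abel.
by rewrite (pairingBr X1 X1 x') (pairingBr x x x') bX bXx' linkable_pairing; abel.
Qed.

End Pair.

(** Reflecting along [w] changes the two obstructions to a direct link; the next two
    lemmas treat the case in which exactly one of them vanishes. Then [w] is adjusted by
    multiples of [x - x'], component by component, to make it isotropic and to kill the
    change of the nonzero obstruction. *)
Lemma exch_link_mixed1 z z' x x' : linkable x x' ->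
  V z -> z *r e = z -> V z' -> z' *r e = z' -> b x z <> 0 -> b z' x' <> 0 ->
  b (x - x') x <> 0 -> b x (x - x') = 0 -> qrp_linked beta V x x'.
Proof.
move=> lk Vz ze Vz' z'e xz z'x' yx xy; have [xe x'e Vy _] := lk.
have ye : (x - x') *r e = x - x' by rewrite rscaleBl xe x'e.
have x'y : b x' (x - x') = - b (x - x') x by apply: pairing_diffr.
have yx' : b (x - x') x' = 0 by rewrite pairing_diffl // xy oppr0.
have [g [yg _]] := division_inv dE yx.
have [w1 [Vw1 w1e w1E]] := exch_shiftr (g * b x' z) Vz ze Vy ye.
have xw1 : b x w1 = b x z by rewrite w1E xy mul0r addr0.
have x'w1 : b x' w1 = 0 by rewrite w1E x'y mulNr mulrA yg mul1r subrr.
have [g' [xzg' g'xz]] := division_inv dE xz.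
have [w2 [Vw2 w2e w2E]] := exch_shiftl (- (b z' w1 * g')) Vz' z'e Vy ye.
have w2w1 : b w2 w1 = 0.
  by rewrite w2E (pairingBl x x' w1) x'w1 subr0 xw1 mulNr -mulrA g'xz mulr1 subrr.
have w2x' : b w2 x' = b z' x' by rewrite w2E yx' mulr0 addr0.
have [w [Vw we w1w w2w]] := exch_mix sV Vw1 w1e Vw2 w2e.
have [||||| c [k [rf PX RX]]] := exch_reflect lk (c1 := 1) (c2 := -1) (i1 := 1) (i2 := -1) Vw we;
  rewrite ?mulr1 ?mulrNN ?mulr1 // ?subrr ?w1w ?w2w ?w2w1 //.
apply: link_trans (link_reflection x Vw rf) _; apply: exch_link.
- exact: linkable_reflection rf lk.
- by rewrite PX w1w x'w1 !mul0r addr0.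
- rewrite RX w1w w2w xy xw1 w2x' add0r mulrN1 mulNr => /eqP; rewrite oppr_eq0 => /eqP.
  exact: division_mul_neq0.
Qed.

Lemma exch_link_mixed2 z z' x x' : linkable x x' ->
  V z -> z *r e = z -> V z' -> z' *r e = z' -> b z x <> 0 -> b x' z' <> 0 ->
  b (x - x') x = 0 -> b x (x - x') <> 0 -> qrp_linked beta V x x'.
Proof.
move=> lk Vz ze Vz' z'e zx x'z' yx xy; have [xe x'e Vy _] := lk.
have ye : (x - x') *r e = x - x' by rewrite rscaleBl xe x'e.
have x'y : b x' (x - x') = 0 by rewrite pairing_diffr // yx oppr0.
have yx' : b (x - x') x' = - b x (x - x') by apply: pairing_diffl.
have [g [yg _]] := division_inv dE xy.
have [w1 [Vw1 w1e w1E]] := exch_shiftr (- (g * b x z')) Vz' z'e Vy ye.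
have xw1 : b x w1 = 0 by rewrite w1E mulrN mulrA yg mul1r subrr.
have x'w1 : b x' w1 = b x' z' by rewrite w1E x'y mul0r addr0.
have [g' [_ g'xz]] := division_inv dE x'z'.
have [w2 [Vw2 w2e w2E]] := exch_shiftl (b z w1 * g') Vz ze Vy ye.
have w2w1 : b w2 w1 = 0.
  by rewrite w2E (pairingBl x x' w1) x'w1 xw1 sub0r mulrN -mulrA g'xz mulr1 subrr.
have w2x : b w2 x = b z x by rewrite w2E yx mulr0 addr0.
have [w [Vw we w1w w2w]] := exch_mix sV Vw1 w1e Vw2 w2e.
have [||||| c [k [rf PX RX]]] := exch_reflect lk (c1 := 1) (c2 := -1) (i1 := 1) (i2 := -1) Vw we;
  rewrite ?mulr1 ?mulrNN ?mulr1 // ?subrr ?w1w ?w2w ?w2w1 //.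
apply: link_trans (link_reflection x Vw rf) _; apply: exch_link.
- exact: linkable_reflection rf lk.
- rewrite PX w1w w2w yx x'w1 w2x add0r mulr1.
  exact: division_mul_neq0.
- by rewrite RX w1w w2w xw1 !mul0r addr0.
Qed.

(** When both obstructions vanish, one reflection has to create one of them. *)
Lemma exch_link_good w z z' x x' : linkable x x' ->
  V z -> z *r e = z -> V z' -> z' *r e = z' -> V w -> w *r e = w ->
  b x z <> 0 -> b z x <> 0 -> b x' z' <> 0 -> b z' x' <> 0 ->
  b (x - x') x = 0 -> b x (x - x') = 0 -> reflecting_sum w ->
  (b x w <> 0 /\ b w x' <> 0) \/ (b x' w <> 0 /\ b w x <> 0) ->
  qrp_linked beta V x x'.
Proof.
move=> lk Vz ze Vz' z'e Vw we xz zx x'z' z'x' yx xy [c1 [c2 [c10 c20 c12]]] ww.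
have [i1 [ci1 ic1]] := division_inv dE c10.
have [i2 [ci2 ic2]] := division_inv dE c20.
have [c [k [rf PX RX]]] := exch_reflect lk Vw we ci1 ic1 ci2 ic2 c12.
have lkX : linkable (reflection beta w k x) x' by apply: linkable_reflection rf lk.
apply: link_trans (link_reflection x Vw rf) _.
have [_ _ hX _] := reflection_isometric rf.
set zX := reflection beta w k z.
have VzX : V zX by apply: submoduleB => //; apply: submoduleZ.
have zXe : zX *r e = zX by apply: reflection_corner.
have XzX : b (reflection beta w k x) zX = b x z by rewrite /pairing /hres hX.
have zXX : b zX (reflection beta w k x) = b z x by rewrite /pairing /hres hX.
have nz (c' i' : E) : c' * i' = 1 -> i' <> 0.
  by case: dE => n01 _ ci i0; apply: n01; rewrite -ci i0 mulr0.
have [PX0|/contrapT PX0] := pselect (b (reflection beta w k x - x') (reflection beta w k x) <> 0);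
have [RX0|/contrapT RX0] := pselect (b (reflection beta w k x) (reflection beta w k x - x') <> 0).
- exact: exch_link.
- by apply: (exch_link_mixed1 (z := zX) (z' := z')) => //; rewrite XzX.
- by apply: (exch_link_mixed2 (z := zX) (z' := z')) => //; rewrite zXX.
- exfalso; move: PX0 RX0; rewrite PX RX yx xy !add0r.
  case: ww => [[xw wx']|[x'w wx]].
    by move=> _; do 2!apply: division_mul_neq0 => //; apply: nz ci2.
  by move=> + _; do 2!apply: division_mul_neq0 => //; apply: nz ci1.
Qed.

Lemma exch_link_all z c k z' x x' : linkable x x' ->
  V z -> reflector beta e z c k -> V z' -> z' *r e = z' ->
  invertible (hres z x) -> invertible (hres z' x') -> qrp_linked beta V x x'.
Proof.
move=> lk Vz rf Vz' z'e /exch_invertible_neq0[zx xz] /exch_invertible_neq0[z'x' x'z'].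
rewrite -/(b _ _) in zx z'x'; rewrite exch_tau in xz; rewrite exch_tau in x'z'.
have zg := reflector_sum_units rf; have ze : z *r e = z by case: rf.
have [yx|/contrapT yx] := pselect (b (x - x') x <> 0);
have [xy|/contrapT xy] := pselect (b x (x - x') <> 0).
- exact: exch_link.
- exact: (exch_link_mixed1 lk Vz ze Vz' z'e).
- exact: (exch_link_mixed2 lk Vz ze Vz' z'e).
have good w Vw we := @exch_link_good w z z' x x' lk Vz ze Vz' z'e Vw we xz zx x'z' z'x' yx xy.
have [zx'|/contrapT zx'] := pselect (b z x' <> 0); first by apply: (good z) => //; left.
have [x'z|/contrapT x'z] := pselect (b x' z <> 0); first by apply: (good z) => //; right.
have mix w1 w2 : V w1 -> w1 *r e = w1 -> V w2 -> w2 *r e = w2 -> _ :=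
  fun H1 H2 H3 H4 => @exch_mix V w1 w2 sV H1 H2 H3 H4.
have [[t [t0 t1]]|no_t] := pselect (exists t : E, t <> 0 /\ t <> 1).
  have [w [Vw we w1 w2]] := mix z z' Vz ze Vz' z'e.
  apply: (good w) => //; last by left; rewrite w1 w2.
  have [bw|/contrapT bw] := pselect (b w w <> 0); last exact: reflecting_sum0.
  exists (t * b w w), ((1 - t) * b w w); split.
  - exact: division_mul_neq0.
  - by apply: division_mul_neq0 => // /eqP; rewrite subr_eq0 eq_sym => /eqP.
  - by rewrite -mulrDl addrCA subrr addr0 mul1r.
(* From here on [E] has two elements, so that [z] is isotropic. *)
have E2 (t : E) : t <> 0 -> t = 1.
  by move=> t0; apply: contrapT => t1; apply: no_t; exists t.
have E11 : 1 + 1 = 0 :> E.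
  apply: contrapT => /E2 /eqP; rewrite -subr_eq0 addrK => /eqP.
  by case: dE.
have zz : b z z = 0 by case: zg => c1 [c2 [/E2 -> /E2 -> <-]].
have [zz'|/contrapT zz'] := pselect (b z z' <> 0); last first.
  have [w [Vw we w1 w2]] := mix z' z Vz' z'e Vz ze.
  apply: (good w) => //; first by apply: reflecting_sum0; rewrite w1 w2.
  by right; rewrite w1 w2.
have [w1 [Vw1 w1e xw1 zw1]] : exists w1, [/\ V w1, w1 *r e = w1, b x w1 <> 0 & b z w1 <> 0].
  have [xz'|/contrapT xz'] := pselect (b x z' <> 0); first by exists z'.
  exists (z + z'); split; first exact: submoduleD.
  - by rewrite rscaleDl ze z'e.
  - by rewrite pairingDr xz' addr0.
  - by rewrite pairingDr zz add0r.
have [w2 [Vw2 w2e w2x' w2w1]] :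
    exists w2, [/\ V w2, w2 *r e = w2, b w2 x' <> 0 & b w2 w1 = 0].
  have [z'w1|/contrapT z'w1] := pselect (b z' w1 <> 0); last by exists z'.
  exists (z' + z); split; first exact: submoduleD.
  - by rewrite rscaleDl ze z'e.
  - by rewrite pairingDl zx' addr0.
  - by rewrite pairingDl (E2 _ z'w1) (E2 _ zw1).
have [w [Vw we w1w w2w]] := mix w1 w2 Vw1 w1e Vw2 w2e.
apply: (good w) => //; first by apply: reflecting_sum0; rewrite w1w w2w.
by left; rewrite w1w w2w.
Qed.

End Exchange.
End Link.
End Residue.

(** * The reduction modulo the Jacobson radical *)

(** An element of the radical lies in every maximal right ideal, and [1 - a] would lie
    in one of them if it had no right inverse. *)
Lemma Jac_right_inverse (A : pzRingType) (a : A) :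
  Jac a -> exists b, (1 - a) * b = 1.
Proof.
move=> Ja; apply: contrapT => noinv.
pose I0 : set A := [set t | exists b, t = (1 - a) * b].
have rI0 : right_ideal I0.
  split; first by exists 0; rewrite mulr0.
    by move=> _ _ [b ->] [c ->]; exists (b + c); rewrite mulrDr.
  by move=> _ c [b ->]; exists (b * c); rewrite mulrA.
have I01 : ~ I0 1 by case=> b b1; apply: noinv; exists b.
pose proper (I : set A) := right_ideal (I `|` I0) /\ ~ (I `|` I0) 1.
have [|I [[rI I1] maxI]] := @Zorn_bigcup A proper.
  move=> F Fp totF; split; last first.
    by move=> [[I FI I1]|//]; case: (Fp _ FI) => _; apply; left.
  have sub I t : F I -> (I `|` I0) t -> ((\bigcup_(I' in F) I') `|` I0) t.
    by move=> FI [It|]; [left; exists I | right].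
  have [n0 nD nM] := rI0.
  split; first by right.
    move=> b c [[I FI Ib]|Ib] [[I' FI' Ic]|Ic].
    - have [II'|I'I] := totF _ _ FI FI'.
        by apply: (sub I') => //; case: (Fp _ FI') => [[_ D _] _]; apply: D; left=> //; apply: II'.
      by apply: (sub I) => //; case: (Fp _ FI) => [[_ D _] _]; apply: D; left=> //; apply: I'I.
    - by apply: (sub I) => //; case: (Fp _ FI) => [[_ D _] _]; apply: D; [left | right].
    - by apply: (sub I') => //; case: (Fp _ FI') => [[_ D _] _]; apply: D; [right | left].
    - by right; apply: nD.
  move=> b c [[I FI Ib]|Ib]; last by right; apply: nM.
  by apply: (sub I) => //; case: (Fp _ FI) => [[_ _ M] _]; apply: M; left.
have maxM : maximal_right_ideal (I `|` I0).
  split=> //; first by move=> IT; apply: I1; rewrite IT.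
  move=> J rJ IJ; have [J1|J1] := pselect (J 1).
    right; rewrite predeqE => t; split=> // _; case: rJ => _ _ /(_ 1 t J1).
    by rewrite mul1r.
  left; apply: contrapT => neq; apply: (maxI J).
    split; first by move=> t It; apply: IJ; left.
    by move=> JI; apply: neq; rewrite predeqE => t; split=> [/JI|/IJ]; [left|].
  have -> : proper J = (right_ideal J /\ ~ J 1).
    rewrite /proper (_ : J `|` I0 = J) // predeqE => t; split; last by left.
    by case=> // It; apply: IJ; right.
  by [].
apply: I1; rewrite -(subrK a 1); case: (rI) => _ D _; apply: D.
  by right; exists 1; rewrite mulr1.
exact: Ja.
Qed.

Section Reduction.
Variables (A : pzRingType) (X : unitary_ring A) (R : reduction X).
Local Notation s := (usigma X).
Local Notation u := (uunit X).
Local Notation pi := (@red_pi _ _ R).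
Implicit Types (a b c : A) (i j : 'I_(red_len R)).

Lemma JacP a : Jac a <-> forall i, pi i a = 0.
Proof. exact: iff_sym (red_ker R a). Qed.

Lemma Jac0 : @Jac A 0.
Proof. by apply/JacP => i; rewrite raddf0. Qed.
Lemma JacD a b : Jac a -> Jac b -> Jac (a + b).
Proof. by move=> /JacP Ja /JacP Jb; apply/JacP => i; rewrite raddfD /= Ja Jb addr0. Qed.
Lemma JacN a : Jac a -> Jac (- a).
Proof. by move=> /JacP Ja; apply/JacP => i; rewrite raddfN /= Ja oppr0. Qed.
Lemma JacB a b : Jac a -> Jac b -> Jac (a - b).
Proof. by move=> Ja Jb; apply: JacD => //; apply: JacN. Qed.
Lemma JacMr a b : Jac a -> Jac (a * b).
Proof. by move=> /JacP Ja; apply/JacP => i; rewrite rmorphM Ja mul0r. Qed.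
Lemma JacMl a b : Jac b -> Jac (a * b).
Proof. by move=> /JacP Jb; apply/JacP => i; rewrite rmorphM Jb mulr0. Qed.
Lemma Jac_sum (I : Type) (r : seq I) (F : I -> A) :
  (forall k, Jac (F k)) -> Jac (\sum_(k <- r) F k).
Proof. by move=> JF; apply: big_ind => //; [exact: Jac0 | exact: JacD]. Qed.

Lemma Jac_sigma a : Jac a -> Jac (s a).
Proof. by move=> /JacP Ja; apply/JacP => i; rewrite -red_sigma Ja sigma0. Qed.

Lemma Jac_sigma_inv a : Jac a -> Jac (sigma_inv X a).
Proof. by move=> Ja; apply: Jac_sigma; apply: JacMr; apply: JacMl. Qed.

Lemma Jac_unit a : Jac a -> exists b, (1 - a) * b = 1 /\ b * (1 - a) = 1.
Proof.
move=> Ja; have [b ab] := Jac_right_inverse Ja; exists b; split=> //.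
have bE : b = 1 - (- (a * b)) by rewrite opprK -ab mulrBl mul1r subrK.
have [|c bc] := @Jac_right_inverse _ (- (a * b)); first by apply: JacN; apply: JacMr.
rewrite -bE in bc.
suff <- : c = 1 - a by [].
have := congr1 (fun t => (1 - a) * t) bc; rewrite mulr1 mulrA ab => <-.
by rewrite mul1r.
Qed.

Lemma lift_at i (M : 'M[red_D i]_((red_n (r := R) i).+1)) :
  exists a, pi i a = M /\ forall j, j != i -> pi j a = 0.
Proof.
have [a aE] := red_onto (r := R) (dfwith (fun j => 0) M).
exists a; split=> [|j ji]; rewrite aE ?dfwith_in // dfwith_out //.
by rewrite eq_sym.
Qed.

Definition lifts_corner i e := e * e = e /\
  pi i e = delta_mx ord0 ord0 /\ forall j, j != i -> pi j e = 0.

Lemma lift_corner i : semiperfect A -> exists e, lifts_corner i e.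
Proof.
case=> _ lift; have [a [ai aj]] := lift_at (delta_mx ord0 ord0 : 'M[red_D i]_((red_n i).+1)).
have [|e [ee Je]] := lift a.
  apply/JacP => j; rewrite rmorphB rmorphM.
  have [->|ji] := eqVneq j i; last by rewrite aj // mul0r subr0.
  by rewrite ai -[_ * _]/(_ *m _) mul_delta_mx subrr.
exists e; split=> //; move/JacP: Je => Je.
have E j : pi j e = pi j a by apply/eqP; rewrite -subr_eq0 -rmorphB Je.
by split=> [|j ji]; rewrite E ?ai ?aj.
Qed.

End Reduction.

Section Corner.
Variables (D : pzRingType) (n : nat).
Implicit Types M N : 'M[D]_n.+1.
Local Notation E00 := (delta_mx ord0 ord0 : 'M[D]_n.+1).

Lemma mul_delta_l M i j k l : (delta_mx i j * M : 'M[D]_n.+1) k l = (k == i)%:R * M j l.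
Proof.
rewrite -[_ * M]/(_ *m _) mxE (bigD1 j) //= big1 => [|m mj].
  by rewrite mxE eqxx andbT addr0.
by rewrite mxE (negbTE mj) andbF mul0r.
Qed.

Lemma mul_delta_r M i j k l : (M * delta_mx i j : 'M[D]_n.+1) k l = M k i * (l == j)%:R.
Proof.
rewrite -[M * _]/(_ *m _) mxE (bigD1 i) //= big1 => [|m mj].
  by rewrite mxE eqxx addr0.
by rewrite mxE (negbTE mj) mulr0.
Qed.

Lemma mul_corner M N : (M * E00 * N) ord0 ord0 = M ord0 ord0 * N ord0 ord0.
Proof.
rewrite -[_ * N]/(_ *m _) mxE (bigD1 ord0) //= big1 => [|m m0].
  by rewrite mul_delta_r eqxx mulr1 addr0.
by rewrite mul_delta_r (negbTE m0) mulr0 mul0r.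
Qed.

End Corner.

Section StandardForm.
Variables (D : pzRingType) (n : nat) (X : unitary_ring 'M[D]_n.+1) (tau : D -> D).
Hypothesis it : involution tau.
Hypothesis sE : forall M, usigma X M = \matrix_(j, k) tau (M k j).
Local Notation u := (uunit X).

Lemma standard_unit_central M : u * M = M * u.
Proof.
have ss : usigma X (usigma X M) = M.
  by rewrite !sE; apply/matrixP => j k; rewrite !mxE; case: it.
by rewrite -[in RHS]ss sigmaKu.
Qed.

Lemma standard_unit_row0 j : j != ord0 -> u j ord0 = 0.
Proof.
move=> j0; have := congr1 (fun M : 'M[D]_n.+1 => M j ord0) (standard_unit_central (delta_mx ord0 ord0)).
by rewrite mul_delta_l mul_delta_r eqxx mulr1 (negbTE j0) mul0r.
Qed.

Lemma standard_mul_unit M : (M * u) ord0 ord0 = M ord0 ord0 * u ord0 ord0.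
Proof.
rewrite -[M * u]/(_ *m _) mxE (bigD1 ord0) //= big1 ?addr0 // => j j0.
by rewrite standard_unit_row0 // mulr0.
Qed.

End StandardForm.

Section ResidueOfReduction.
Variables (A : pzRingType) (X : unitary_ring A) (R : reduction X).
Local Notation s := (usigma X).
Local Notation u := (uunit X).
Local Notation pi := (@red_pi _ _ R).
Variables (i : 'I_(red_len R)) (tau : red_D i -> red_D i) (e : A).
Hypothesis it : involution tau.
Hypothesis sE : forall M : 'M[red_D i]_((red_n i).+1),
  usigma (red_ring (r := R) i) M = \matrix_(j, k) tau (M k j).
Hypothesis ei : lifts_corner i e.

Definition red_entry (a : A) : red_D i := (pi i a) ord0 ord0.

Lemma red_sigma_e : pi i (s e) = delta_mx ord0 ord0.
Proof.
case: ei => _ [eE _]; rewrite -red_sigma eE sE; apply/matrixP => j k; rewrite !mxE.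
by rewrite andbC; case: (_ && _); rewrite ?involution1 ?involution0.
Qed.

Lemma red_sigma_e' j : j != i -> pi j (s e) = 0.
Proof. by case: ei => _ [_ ej] ji; rewrite -red_sigma ej // sigma0. Qed.

(** Units of [eAe], or more generally isomorphisms from [eA] to [s(e)A], lift
    because [1 + Jac A] consists of units. *)
Lemma red_residue : residue X e tau red_entry.
Proof.
have [ee [eE ej]] := ei; rewrite /red_entry.
have mulE a b : pi i (a * e * b) ord0 ord0 = pi i a ord0 ord0 * pi i b ord0 ord0.
  by rewrite !rmorphM eE mul_corner.
split=> //.
- by move=> a b; rewrite raddfD mxE.
- by rewrite eE mxE !eqxx.
- by move=> a; rewrite -red_sigma sE mxE.
- by move=> a; rewrite rmorphM -red_unit (standard_mul_unit it sE).
- by move=> d; have [a [aE _]] := lift_at (const_mx d : 'M[red_D i]_((red_n i).+1));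
  exists a; rewrite aE mxE.
move=> c cE [d [cd dc]].
have see := sigma_idem X ee.
have cse : s e * c = c by rewrite cE !mulrA see.
have ce : c * e = c by rewrite cE -!mulrA ee.
have piC : pi i c = pi i c ord0 ord0 *: delta_mx ord0 ord0.
  rewrite {1}cE !rmorphM red_sigma_e eE; apply/matrixP => j k.
  by rewrite mul_delta_r mul_delta_l !mxE ?eqxx /=; case: eqP => _; case: eqP => _;
    rewrite ?mulr1 ?mul1r ?mulr0 ?mul0r.
have [k0 [k0E k0j]] := lift_at (d *: delta_mx ord0 ord0 : 'M[red_D i]_((red_n i).+1)).
pose k1 := e * k0 * s e.
have k1E : pi i k1 = d *: delta_mx ord0 ord0.
  rewrite /k1 !rmorphM red_sigma_e eE k0E; apply/matrixP => j k.
  by rewrite mul_delta_r mul_delta_l !mxE ?eqxx /=; case: eqP => _; case: eqP => _;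
    rewrite ?mulr1 ?mul1r ?mulr0 ?mul0r.
have dd (d1 d2 : red_D i) :
    (d1 *: delta_mx ord0 ord0 : 'M[red_D i]_((red_n i).+1)) * (d2 *: delta_mx ord0 ord0)
     = (d1 * d2) *: delta_mx ord0 ord0.
  apply/matrixP => j k; rewrite -mulmxE !mxE (bigD1 ord0) //= big1.
    by rewrite !mxE !eqxx /= addr0; case: eqP => _; case: eqP => _;
      rewrite ?mulr1 ?mul1r ?mulr0 ?mul0r.
  by move=> m m0; rewrite !mxE (negbTE m0) andbF mulr0 mul0r.
have Jck : Jac (s e - c * k1).
  apply/JacP => j; rewrite rmorphB rmorphM.
  have [->|ji] := eqVneq j i.
    by rewrite red_sigma_e k1E piC dd cd scale1r subrr.
  by rewrite red_sigma_e' // cE !rmorphM (ej j) // !(mulr0, mul0r) subr0.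
have Jkc : Jac (e - k1 * c).
  apply/JacP => j; rewrite rmorphB rmorphM.
  have [->|ji] := eqVneq j i.
    by rewrite eE k1E piC dd dc scale1r subrr.
  by rewrite ej // cE !rmorphM (ej j) // !(mulr0, mul0r) subr0.
have k1s : k1 * s e = k1 by rewrite /k1 -!mulrA see.
have ek1 : e * k1 = k1 by rewrite /k1 !mulrA ee.
clearbody k1.
have [t [jt tj]] := Jac_unit R Jck; have [t' [jt' tj']] := Jac_unit R Jkc.
have ckt : c * (k1 * t * s e) = s e.
  have E : c * k1 = s e * (1 - (s e - c * k1)).
    by rewrite mulrBr mulr1 mulrBr see mulrA cse; abel.
  by rewrite !mulrA E -!mulrA (mulrA (1 - _)) jt mul1r see.
have tkc : (e * t' * k1) * c = e.
  have E : k1 * c = (1 - (e - k1 * c)) * e.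
    by rewrite mulrBl mul1r mulrBl ee -mulrA ce; abel.
  by rewrite -!mulrA E (mulrA t') tj' mul1r ee.
have kk : e * t' * k1 = k1 * t * s e.
  have := congr1 (fun z => z * (k1 * t * s e)) tkc.
  by rewrite -[LHS]mulrA ckt -[LHS]mulrA k1s !mulrA ek1.
exists (k1 * t * s e); split=> //.
  by rewrite !mulrA ek1 -!mulrA see.
by rewrite -kk.
Qed.

End ResidueOfReduction.

(** * Split-orthogonal components *)

Lemma field_of_division (D : pzRingType) : division_ring D ->
  (forall d d' : D, d * d' = d' * d) ->
  exists (K : fieldType) (f : {rmorphism D -> K}), bijective f.
Proof.
move=> [n01 inv] comm.
have /choice[g gE] : forall x : D, exists y, (x <> 0 -> y * x = 1) /\ (x = 0 -> y = 0).
  move=> x; have [x0|x0] := pselect (x = 0); first by exists 0; split=> // /(_ x0).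
  by have [y [_ yx]] := inv x x0; exists y; split.
have n01b : (1 : D) != 0 by apply/eqP.
pose nzD : nzRingType :=
  HB.pack (D : Type) (GRing.PzRing.class D)
    (GRing.PzSemiRing_isNonZero.Build D n01b).
pose cD : comNzRingType := HB.pack (D : Type) (GRing.NzRing.class nzD)
    (GRing.PzRing_hasCommutativeMul.Build D comm).
have gV (x : cD) : x != 0 -> g x * x = 1 by move=> /eqP /(proj1 (gE x)).
have g0 : g (0 : cD) = 0 by apply: (proj2 (gE 0)).
pose K : fieldType := HB.pack (D : Type) (GRing.ComNzRing.class cD)
    (GRing.ComNzRing_isField.Build cD gV g0).
by exists K, (idfun : {rmorphism D -> D}); exists id.
Qed.

Section Alternating.
Variables (K : fieldType) (n : nat).

(** Alternating matrices are parametrized by their entries above the diagonal, which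
    gives their dimension. *)
Definition strict_pair := {p : 'I_n * 'I_n | p.1 < p.2}%N.

Definition strict_entry (v : 'rV[K]_#|{: strict_pair}|) (p : 'I_n * 'I_n) : K :=
  if insub p is Some q then v ord0 (enum_rank (q : strict_pair)) else 0.

Definition alternating_mx (v : 'rV[K]_#|{: strict_pair}|) : 'M[K]_n :=
  \matrix_(j, k) (strict_entry v (j, k) - strict_entry v (k, j)).

Lemma alternating_mx_linear : linear alternating_mx.
Proof.
move=> c v w; apply/matrixP => j k; rewrite !mxE.
have E p : strict_entry (c *: v + w) p = c * strict_entry v p + strict_entry w p.
  by rewrite /strict_entry; case: insub => [q|]; rewrite ?mxE // mulr0 addr0.
by rewrite !E mulrBr; abel.
Qed.

HB.instance Definition _ :=
  GRing.isLinear.Build K _ _ _ alternating_mx alternating_mx_linear.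

Definition alternating_space : {vspace 'M[K]_n} := limg (linfun alternating_mx).

Lemma alternating_mxE v (q : strict_pair) :
  alternating_mx v (val q).1 (val q).2 = v ord0 (enum_rank q).
Proof.
rewrite mxE /strict_entry -surjective_pairing valK insubF ?subr0 //.
by rewrite ltnNge ltnW //; exact: (valP q).
Qed.

Lemma alternating_spaceP (M : 'M[K]_n) : M \in alternating_space <->
  (forall j k, M j k = - M k j) /\ (forall j, M j j = 0).
Proof.
split.
  case/memv_imgP => v _ ->; rewrite lfunE /=; split=> [j k|j]; rewrite !mxE ?opprB //.
  by rewrite subrr.
move=> [Mskew Mdiag].
apply/memv_imgP; exists (\row_i M (val (enum_val i)).1 (val (enum_val i)).2).
  exact: memvf.
rewrite lfunE; apply/matrixP => j k; rewrite mxE /strict_entry /=.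
have [jk|kj|jk] := ltngtP j k.
- by rewrite insubT insubF /= ?mxE ?enum_rankK ?subr0 // ltnNge ltnW.
- by rewrite insubF ?insubT /= ?mxE ?enum_rankK ?sub0r // ltnNge ltnW.
- by rewrite (val_inj jk : j = k) Mdiag subrr.
Qed.

Lemma card_strict_pair : #|{: strict_pair}| = (n * n.-1)./2.
Proof.
rewrite card_sig -bin2 -bin2_sum big_mkord -sum1_card.
rewrite (eq_bigl (fun p : 'I_n * 'I_n => true && (p.1 < p.2)%N)) //.
rewrite -(pair_big_dep xpredT (fun j k : 'I_n => (j < k)%N) (fun _ _ => 1%N)) /=.
rewrite (exchange_big_dep xpredT) //=; apply: eq_bigr => k _.
by rewrite -(big_ord_widen n (fun _ => 1%N)) ?sum1_card ?card_ord // ltnW.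
Qed.

Lemma dim_alternating : \dim alternating_space = (n * n.-1)./2.
Proof.
rewrite limg_dim_eq; first by rewrite dimvf dim_matrix mul1r card_strict_pair.
apply/eqP; rewrite -subv0 capfv; apply/subvP => v.
rewrite memv_ker lfunE /= memv0 => /eqP v0; apply/eqP/rowP => i.
by rewrite -(enum_valK i) -alternating_mxE v0 !mxE.
Qed.

End Alternating.

Section SplitOrthogonal.
Variables (D : pzRingType) (n : nat) (X : unitary_ring 'M[D]_n.+1) (tau : D -> D).
Hypothesis dD : division_ring D.
Hypothesis it : involution tau.
Hypothesis sE : forall M, usigma X M = \matrix_(j, k) tau (M k j).
Hypothesis corner0 : forall M, upar X M -> M ord0 ord0 = 0.
Local Notation u := (uunit X).

Lemma split_twist d : tau d * u ord0 ord0 = d.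
Proof.
have := corner0 (upar_min X (const_mx d)).
by rewrite mxE [X in _ + X]mxE (standard_mul_unit it sE) sE !mxE => /eqP;
  rewrite subr_eq0 => /eqP <-.
Qed.

Lemma split_unit_corner : u ord0 ord0 = 1.
Proof. by have := split_twist 1; rewrite involution1 // mul1r. Qed.

Lemma split_tau d : tau d = d.
Proof. by rewrite -[LHS]mulr1 -split_unit_corner split_twist. Qed.

Lemma split_comm (d d' : D) : d * d' = d' * d.
Proof. by have [_ tM _] := it; rewrite -[LHS]split_tau tM !split_tau. Qed.

Lemma split_sigma M : usigma X M = M^T.
Proof. by rewrite sE; apply/matrixP => j k; rewrite !mxE split_tau. Qed.

Lemma split_unit : u = 1.
Proof.
apply/matrixP => j l.
have := congr1 (fun M : 'M[D]_n.+1 => M ord0 l)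
  (standard_unit_central it sE (delta_mx ord0 j)).
rewrite mul_delta_r mul_delta_l eqxx mul1r split_unit_corner mul1r => <-.
by rewrite -idmxE mxE eq_sym.
Qed.

Lemma upar_alternating M :
  upar X M <-> (forall j k, M j k = - M k j) /\ (forall j, M j j = 0).
Proof.
split.
  move=> lM; split=> [j k|j].
    have /= := congr1 (fun N : 'M[D]_n.+1 => N k j) (upar_max lM).
    by rewrite split_unit mulr1 split_sigma !mxE.
  have := corner0 (uparJ (delta_mx j ord0) lM).
  by rewrite split_sigma trmx_delta mul_delta_r mul_delta_l eqxx mulr1 mul1r.
move=> [Mskew Mdiag].
pose N : 'M[D]_n.+1 := \matrix_(j, k) (if (j < k)%N then M j k else 0).
have <- : N - usigma X N * u = M; last exact: upar_min.
rewrite split_unit mulr1 split_sigma; apply/matrixP => j k; rewrite !mxE.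
have [jk|kj|jk] := ltngtP j k.
- by rewrite subr0.
- by rewrite sub0r [RHS]Mskew.
- by rewrite (val_inj jk : j = k) Mdiag subrr.
Qed.

(** When the corner of the form parameter is zero, the minimal form parameter is so
    too, which makes [tau] the identity, [D] commutative and [u] equal to one; then the
    form parameter consists of the alternating matrices. *)
Lemma split_orthogonal_of_corner : split_orthogonal X.
Proof.
have [K [f bf]] := field_of_division dD split_comm.
exists K, n, (map_mx f); have fI := bij_inj bf.
split.
- have [g fK gK] := bf; exists (map_mx g) => M;
    by apply/matrixP => j k; rewrite !mxE ?fK ?gK.
- move=> z zc; rewrite split_sigma; apply/matrixP => j k; rewrite mxE.
  have [->//|jk] := eqVneq j k.
  have z0 j' k' : j' != k' -> z j' k' = 0.
    move=> jk'; have := congr1 (fun M : 'M[D]_n.+1 => M j' k') (zc (delta_mx k' k')).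
    by rewrite mul_delta_r mul_delta_l eqxx mulr1 (negbTE jk') mul0r.
  by rewrite !z0 // eq_sym.
exists (alternating_space K n.+1); split; last exact: dim_alternating.
move=> M; rewrite upar_alternating; split.
  move=> [Mskew Mdiag]; apply/alternating_spaceP; split=> [j k|j]; rewrite !mxE.
    by rewrite [M j k]Mskew rmorphN.
  by rewrite Mdiag rmorph0.
move/alternating_spaceP => [Mskew Mdiag]; split=> [j k|j]; apply: fI.
  by have := Mskew j k; rewrite !mxE rmorphN.
by have := Mdiag j; rewrite !mxE rmorph0.
Qed.

End SplitOrthogonal.

(** * Totally singular components *)

Section NullCriteria.
Variables (D : pzRingType) (n : nat) (X : unitary_ring 'M[D]_n.+1) (tau : D -> D).
Hypothesis it : involution tau.
Hypothesis sE : forall M, usigma X M = \matrix_(j, k) tau (M k j).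
Variables (W : lmodType ('M[D]_n.+1 : pzRingType)^c) (gamma : sesquilinear X W) (U : set W).
Hypothesis sU : submodule U.

Lemma sform_entry x y j k :
  gamma (x *r delta_mx j ord0) (y *r delta_mx k ord0) ord0 ord0 = gamma x y j k.
Proof.
rewrite sformJ sE mul_delta_r eqxx mulr1.
rewrite -mulmxE mxE (bigD1 j) //= big1 => [|l lj]; rewrite !mxE.
  by rewrite !eqxx involution1 // mul1r addr0.
by rewrite (negbTE lj) involution0 // mul0r.
Qed.

(** Over a field with zero form parameter, a form vanishes on [U] once the diagonal
    entries of its values [gamma x x] do: polarizing yields skew symmetry, and the form
    parameter consists of the alternating matrices. *)
Lemma null_on_diagonal :
  (forall M, upar X M -> M ord0 ord0 = 0) ->
  (forall x j, U x -> gamma x x j j = 0) -> null_on X U gamma.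
Proof.
move=> c0 diag.
have skew x y j k : U x -> U y -> gamma x y j k = - gamma y x k j.
  move=> Ux Uy; set x' := x *r delta_mx j ord0; set y' := y *r delta_mx k ord0.
  have Uxy : U (x' + y') by apply: submoduleD => //; apply: submoduleZ.
  have := diag _ ord0 Uxy; rewrite !(sformDl, sformDr) !mxE !sform_entry !diag //.
  by rewrite add0r addr0 => /eqP; rewrite addr_eq0 => /eqP.
split=> [x y Ux Uy|x Ux].
  rewrite (split_unit it sE c0) mulr1 (split_sigma it sE c0).
  by apply/matrixP => j k; rewrite !mxE skew.
apply/(upar_alternating it sE c0); split=> [j k|j]; [exact: skew | exact: diag].
Qed.

(** Over [E x E^op] every skew element [M] is [d M - s (d M)] for the central idempotent
    [d] of the first factor, so that only the hermitian form matters. *)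
Lemma null_on_exchange (E : pzRingType) (p : D -> E) :
  exchange_proj tau p -> uunit X = 1 ->
  (forall x y, U x -> U y -> hform gamma x y = 0) -> null_on X U gamma.
Proof.
move=> pe u1 h0; have [tD tM tK] := it.
have skew x y : U x -> U y -> gamma x y = - (usigma X (gamma y x) * uunit X).
  by move=> Ux Uy; have /eqP := h0 x y Ux Uy; rewrite addr_eq0 => /eqP.
split=> // x Ux; set M := gamma x x.
have ME j k : tau (M k j) = - M j k.
  have := congr1 (fun N : 'M[D]_n.+1 => N j k) (skew x x Ux Ux).
  by rewrite -/M u1 mulr1 sE !mxE => ->; rewrite opprK.
have [d [d1 d2]] := exch_onto pe 1 0.
have p0 := exch_0 pe.
have dd : d + tau d = 1.
  apply/eqP; rewrite -subr_eq0; apply/eqP; apply: (exch_inj pe).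
    by rewrite !(exch_add pe) (exch_N pe) d1 d2 (exch_1 pe) addr0 subrr.
  rewrite !tD (involutionN _ it) (involution1 it) tK !(exch_add pe) (exch_N pe) d1 d2.
  by rewrite (exch_1 pe) add0r subrr.
have dC t : t * tau d = tau d * t.
  apply/eqP; rewrite -subr_eq0; apply/eqP; apply: (exch_inj pe).
    by rewrite (exch_add pe) (exch_N pe) !(exch_mul pe) d2 mulr0 mul0r subrr.
  rewrite tD (involutionN _ it) !tM tK (exch_add pe) (exch_N pe) !(exch_mul pe) d1.
  by rewrite mulr1 mul1r subrr.
have <- : (d *: M) - usigma X (d *: M) * uunit X = M; last exact: upar_min.
rewrite u1 mulr1 sE; apply/matrixP => j k; rewrite !mxE tM ME mulNr opprK dC -mulrDl.
by rewrite dd mul1r.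
Qed.

End NullCriteria.

(** ** Residue rings with few elements *)

Definition two_elements (E : pzRingType) := forall t : E, t = 0 \/ t = 1.

Lemma two_elements_char (E : pzRingType) : (1 : E) <> 0 -> two_elements E ->
  1 + 1 = 0 :> E.
Proof. by move=> n01 E2; case: (E2 (1 + 1)) => // /eqP; rewrite -subr_eq0 addrK => /eqP. Qed.

Section TwoElements.
Variable E : pzRingType.
Hypotheses (n01 : (1 : E) <> 0) (E2 : two_elements E).

Definition to_F2 (t : E) : 'F_2 := if t == 0 then 0 else 1.

Lemma to_F2_additive : zmod_morphism to_F2.
Proof.
have E11 := two_elements_char n01 E2; have n1 : (1 == 0 :> E) = false by apply/eqP.
have N1 : - 1 = 1 :> E by apply/eqP; rewrite eq_sym -addr_eq0 E11.
move=> x y; rewrite /to_F2.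
case: (E2 x) => ->; case: (E2 y) => ->; rewrite ?subr0 ?sub0r ?N1 ?E11 ?eqxx ?n1;
  by apply/val_inj.
Qed.

Lemma to_F2_multiplicative : monoid_morphism to_F2.
Proof.
have n1 : (1 == 0 :> E) = false by apply/eqP.
split=> [|x y]; rewrite /to_F2 ?n1 //.
by case: (E2 x) => ->; case: (E2 y) => ->; rewrite ?mulr0 ?mul0r ?mulr1 ?eqxx ?n1 ?mulr0 ?mul0r ?mulr1.
Qed.

HB.instance Definition _ := GRing.isZmodMorphism.Build E 'F_2 to_F2 to_F2_additive.
HB.instance Definition _ := GRing.isMonoidMorphism.Build E 'F_2 to_F2 to_F2_multiplicative.

Lemma to_F2_bij : bijective to_F2.
Proof.
have n1 : (1 == 0 :> E) = false by apply/eqP.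
exists (fun b : 'F_2 => if b == 0 then (0 : E) else 1) => [t|b].
  by rewrite /to_F2; case: (E2 t) => ->; rewrite ?eqxx ?n1.
have [->|b0] := eqVneq b 0; first by rewrite /to_F2 eqxx.
rewrite /to_F2 n1; apply/val_inj; case: b b0 => [[|[|m]] lt] //.
Qed.

Lemma ring_iso_F2 : ring_iso E 'F_2.
Proof. by exists to_F2; apply: to_F2_bij. Qed.

End TwoElements.

Section TwoElementsExchange.
Variables (D : pzRingType) (tau : D -> D) (E : pzRingType) (p : D -> E).
Hypotheses (n01 : (1 : E) <> 0) (E2 : two_elements E).
Hypotheses (it : involution tau) (pe : exchange_proj tau p).

Definition to_F2F2 (d : D) : 'F_2 * 'F_2 := (to_F2 (p d), to_F2 (p (tau d))).

Lemma to_F2F2_additive : zmod_morphism to_F2F2.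
Proof.
have [tD _ _] := it.
move=> x y; rewrite /to_F2F2 tD (involutionN _ it) !(exch_add pe) !(exch_N pe).
by rewrite !(to_F2_additive n01 E2).
Qed.

Lemma to_F2F2_multiplicative : monoid_morphism to_F2F2.
Proof.
have [t1 tM] := to_F2_multiplicative n01 E2; have [_ tauM _] := it.
split=> [|x y]; rewrite /to_F2F2.
  by rewrite (involution1 it) (exch_1 pe) t1.
by rewrite tauM !(exch_mul pe) !tM [X in (_, X)]mulrC.
Qed.

HB.instance Definition _ :=
  GRing.isZmodMorphism.Build D ('F_2 * 'F_2)%type to_F2F2 to_F2F2_additive.
HB.instance Definition _ :=
  GRing.isMonoidMorphism.Build D ('F_2 * 'F_2)%type to_F2F2 to_F2F2_multiplicative.

Lemma ring_iso_F2F2 : ring_iso D ('F_2 * 'F_2)%type.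
Proof.
exists to_F2F2; have [g fK gK] := to_F2_bij n01 E2.
have [f fE] : {f : 'F_2 * 'F_2 -> D | forall b, p (f b) = g b.1 /\ p (tau (f b)) = g b.2}.
  have /choice[f fE] : forall b : 'F_2 * 'F_2, exists d, p d = g b.1 /\ p (tau d) = g b.2.
    by move=> b; apply: (exch_onto pe).
  by exists f.
have [tD _ _] := it.
exists f => [d|b]; last first.
  rewrite [RHS]surjective_pairing; congr pair.
    exact: etrans (congr1 _ (proj1 (fE b))) (gK _).
  exact: etrans (congr1 _ (proj2 (fE b))) (gK _).
have [f1 f2] := fE (to_F2F2 d); rewrite /to_F2F2 /= !fK in f1 f2.
apply/eqP; rewrite -subr_eq0; apply/eqP; apply: (exch_inj pe).
  by rewrite (exch_add pe) (exch_N pe) f1 subrr.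
by rewrite tD (involutionN _ it) (exch_add pe) (exch_N pe) f2 subrr.
Qed.

End TwoElementsExchange.

(** ** The two kinds of components *)

Section Components.
Variables (A : pzRingType) (X : unitary_ring A) (R : reduction X).
Hypotheses (hA : semiperfect A) (hR : normalized R).
Local Notation s := (usigma X).
Local Notation u := (uunit X).
Implicit Types i : 'I_(red_len R).

(** All that is used of the [i]-th component: [e] lifts its first matrix unit and [tau]
    is its involution in standard form. *)
Record component i (e : A) (tau : red_D i -> red_D i) : Prop := Component {
  cmp_lifts : lifts_corner i e;
  cmp_tau : involution tau;
  cmp_sigma : forall M, usigma (red_ring i) M = \matrix_(j, k) tau (M k j);
  cmp_kind : division_ring (red_D i) \/
    exists (E : pzRingType) (p : red_D i -> E),
      [/\ division_ring E, exchange_proj tau p & uunit (red_ring i) = 1]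
}.

Lemma component_residue i e (tau : red_D i -> red_D i) :
  component e tau -> residue X e tau (@red_entry _ _ _ i).
Proof. by case=> lc it sE _; apply: red_residue. Qed.

Lemma component_exists i : exists e (tau : red_D i -> red_D i), component e tau.
Proof.
have [e ei] := lift_corner i hA; have [tau [it sE ex u1]] := hR i.
exists e, tau; split=> //.
case: (red_div i) => [dD|[E [dE iso]]]; [by left | right].
have [th [[g thK gK] thE]] := ex E dE iso.
have th1 d d' : (th d).1 = (th d').1 -> (th d).2 = (th d').2 -> d = d'.
  by move=> E1 E2; apply: (can_inj thK); rewrite (surjective_pairing (th d)) E1 E2 -surjective_pairing.
exists E, (fun d => (th d).1); split=> //.
- split=> [d d'|d d'||d|t t'].
  + by rewrite rmorphD.
  + by rewrite rmorphM.
  + by rewrite rmorph1.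
  + by rewrite thE /= => d1 d2; apply: th1; rewrite rmorph0.
  + by exists (g (t, t')); rewrite thE gK.
- apply: u1; exists (g (1, 0)) => /(congr1 th); rewrite thE gK => -[E1 _].
  by case: dE => n01 _; apply: n01.
Qed.

End Components.

Section MoveVector.
Variables (A : pzRingType) (X : unitary_ring A) (R : reduction X).
Variables (P : lmodType A^c) (beta : sesquilinear X P).
Variables (i : 'I_(red_len R)) (e : A) (tau : red_D i -> red_D i).
Hypothesis cmp : component e tau.
Local Notation rho := (@red_entry _ _ _ i).

(** The three cases together. The vectors that have to exist in [V] are, besides the ones
    that are not orthogonal to [x] and [x'], one that defines a reflection and, over a
    field with two elements, an anisotropic one in the radical. *)
Lemma move_vector (V : set P) z c k z' x x' : submodule V ->
  linkable beta e V x x' -> V z -> reflector beta e z c k -> V z' -> z' *r e = z' ->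
  invertible (hres beta rho z x) -> invertible (hres beta rho z' x') ->
  (division_ring (red_D i) -> (forall lam, upar X lam -> rho lam = 0) ->
   two_elements (red_D i) ->
   exists w, [/\ V w, w *r e = w, rho (beta w w) <> 0
     & forall v, V v -> v *r e = v -> hres beta rho w v = 0]) ->
  qrp_linked beta V x x'.
Proof.
move=> sV lk Vz rf Vz' z'e zx z'x' radical.
have res := component_residue cmp; have ze : z *r e = z by case: rf.
case: (cmp_kind cmp) => [dD|[E [p [dE pe u1]]]]; last first.
  have ru : rho (uunit X) = 1.
    by rewrite /red_entry -red_unit u1 -idmxE mxE eqxx.
  exact: (exch_link_all res sV dE pe ru lk Vz rf Vz' z'e zx z'x').
have [n01 _] := dD; have zx0 := invertible_neq0 n01 zx; have z'x'0 := invertible_neq0 n01 z'x'.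
have [lam0|] := pselect (forall lam, upar X lam -> rho lam = 0); last first.
  move/existsNP => [lam /not_implyP[llam rlam]].
  exact: (link_nonzero_parameter res sV dD llam rlam lk Vz ze Vz' z'e).
have [D2|] := pselect (two_elements (red_D i)).
  have [w [Vw we qw wV]] := radical dD lam0 D2.
  exact: (link_two_elements res sV dD lam0 D2 lk Vz ze Vz' z'e zx0 z'x'0 Vw we qw wV).
move/existsNP => [t /not_orP[t0 t1]].
have qz := qres_reflector res dD lam0 rf.
exact: (link_zero_parameter res sV dD lam0 t0 t1 lk Vz ze Vz' z'e zx0 qz z'x'0).
Qed.

End MoveVector.

(** * Selfdual submodules *)

Section Paired.
Variables (A : pzRingType) (X : unitary_ring A) (P : lmodType A^c).
Variable beta : sesquilinear X P.
Variables (e : A) (D : pzRingType) (tau : D -> D) (rho : A -> D).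
Hypothesis res : residue X e tau rho.
Variables (E : pzRingType) (p : D -> E).
Hypothesis dE : division_ring E.
Hypothesis pe : exchange_proj tau p.
Hypothesis rho_u : rho (uunit X) = 1.
Variable V : set P.
Hypothesis sV : submodule V.
Local Notation h := (hform beta).
Local Notation b := (pairing beta rho p).
Implicit Types (Q : set P) (q r x z v : P).

Let ee := res_idem res.
Let it := res_tau res.

Definition corner Q q := Q q /\ q *r e = q.

(** What remains of an isomorphism between [Q] and its dual in a component with residue
    ring [E x E^op]: a pairing between the two components of [Q], whose radicals are
    those of the pairing with [V]. It says that the two components have the same
    dimension, in a form that passes to a complement of a hyperbolic pair. *)
Record pairs Q (G : P -> P -> E) : Prop := Pairs {
  pairs_Dl : forall q q' r, corner Q q -> corner Q q' -> corner Q r ->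
    G (q + q') r = G q r + G q' r;
  pairs_Dr : forall q r r', corner Q q -> corner Q r -> corner Q r' ->
    G q (r + r') = G q r + G q r';
  pairs_Zl : forall q r a, corner Q q -> corner Q r ->
    G (q *r (a * e)) r = p (tau (rho (a * e))) * G q r;
  pairs_Zr : forall q r a, corner Q q -> corner Q r ->
    G q (r *r (a * e)) = G q r * p (rho (a * e));
  pairs_radl : forall q, corner Q q ->
    (forall r, corner Q r -> G q r = 0) <-> (forall v, corner V v -> b q v = 0);
  pairs_radr : forall r, corner Q r ->
    (forall q, corner Q q -> G q r = 0) <-> (forall v, corner V v -> b v r = 0)
}.

Lemma cornerD Q q r : submodule Q -> corner Q q -> corner Q r -> corner Q (q + r).
Proof.
move=> sQ [Qq qe] [Qr re]; split; first exact: submoduleD.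
by rewrite rscaleDl qe re.
Qed.

Lemma cornerZ Q q a : submodule Q -> corner Q q -> corner Q (q *r (a * e)).
Proof.
move=> sQ [Qq qe]; split; first exact: submoduleZ.
by rewrite -rscaleA -mulrA ee.
Qed.

Lemma cornerN Q q : submodule Q -> corner Q q -> corner Q (- q).
Proof. by move=> sQ [Qq qe]; split; [exact: submoduleN | rewrite rscaleNl qe]. Qed.

Lemma cornerB Q q r : submodule Q -> corner Q q -> corner Q r -> corner Q (q - r).
Proof. by move=> sQ cq cr; apply: cornerD => //; apply: cornerN. Qed.

Lemma pairs_Nl Q G q r : submodule Q -> pairs Q G -> corner Q q -> corner Q r ->
  G (- q) r = - G q r.
Proof.
move=> sQ GQ cq cr; apply: (addrI (G q r)); rewrite subrr -(pairs_Dl GQ) //; last exact: cornerN.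
have c0 : corner Q 0 by rewrite -(subrr q); apply: cornerB.
by apply: (addrI (G 0 r)); rewrite subrr -(pairs_Dl GQ) // !addr0.
Qed.

Lemma pairs_Nr Q G q r : submodule Q -> pairs Q G -> corner Q q -> corner Q r ->
  G q (- r) = - G q r.
Proof.
move=> sQ GQ cq cr; apply: (addrI (G q r)); rewrite subrr -(pairs_Dr GQ) //; last exact: cornerN.
have c0 : corner Q 0 by rewrite -(subrr r); apply: cornerB.
by apply: (addrI (G q 0)); rewrite subrr -(pairs_Dr GQ) // !addr0.
Qed.

Lemma pairing0 q v : h v q = 0 -> b q v = 0 /\ b v q = 0.
Proof.
move=> vq; have r0 := res_0 res; have p0 := exch_0 pe.
split; last by rewrite /pairing /hres vq r0.
by rewrite /pairing /hres hformC vq sigma0 mul0r r0.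
Qed.

(** Vectors of [Q] orthogonal to [V] lie in the radicals of the pairing, so that they may
    be discarded. *)
Lemma pairs_transfer Q Q' G : submodule Q -> submodule Q' -> Q' `<=` Q ->
  (forall q, corner Q q -> exists q', corner Q' q' /\
     forall v, corner V v -> b (q - q') v = 0 /\ b v (q - q') = 0) ->
  pairs Q G -> pairs Q' G.
Proof.
move=> sQ sQ' sub cov GQ.
have cs q : corner Q' q -> corner Q q by case=> Qq qe; split=> //; apply: sub.
split.
- by move=> q q' r /cs cq /cs cq' /cs cr; apply: (pairs_Dl GQ).
- by move=> q r r' /cs cq /cs cr /cs cr'; apply: (pairs_Dr GQ).
- by move=> q r a /cs cq /cs cr; apply: (pairs_Zl GQ).
- by move=> q r a /cs cq /cs cr; apply: (pairs_Zr GQ).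
- move=> q cq'; have cq := cs _ cq'; split=> [Gq|bq].
    apply/(pairs_radl GQ cq) => r cr; have [r' [cr' rr']] := cov r cr.
    have crr : corner Q (r - r') by apply: cornerB => //; apply: cs.
    rewrite -(subrK r' r) (pairs_Dr GQ) //; last exact: cs.
    rewrite (Gq r') // addr0; apply: (proj2 (pairs_radr GQ crr)) => // v cv.
    by case: (rr' v cv).
  by move=> r cr; apply: (proj2 (pairs_radl GQ cq) bq); apply: cs.
- move=> r cr'; have cr := cs _ cr'; split=> [Gr|br].
    apply/(pairs_radr GQ cr) => q cq; have [q' [cq' qq']] := cov q cq.
    have cqq : corner Q (q - q') by apply: cornerB => //; apply: cs.
    rewrite -(subrK q' q) (pairs_Dl GQ) //; last exact: cs.
    rewrite (Gr q') // addr0; apply: (proj2 (pairs_radl GQ cqq)) => // v cv.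
    by case: (qq' v cv).
  by move=> q cq; apply: (proj2 (pairs_radr GQ cr) br); apply: cs.
Qed.

(** The restriction of [G] to the complement of [x] may be degenerate; its Schur
    complement with respect to [G x x] is not. *)
Lemma pairs_schur Q G z x k : submodule Q -> pairs Q G ->
  corner V z -> corner Q x -> inverse_at X e (h z x) k ->
  b z x <> 0 -> b x z <> 0 -> G x x <> 0 ->
  exists G', pairs (fun q => Q q /\ h z q = 0) G'.
Proof.
move=> sQ GQ [Vz ze] cx ick zx xz Gxx; have [Qx xe] := cx.
have [g [xg gx]] := division_inv dE Gxx.
set Q' := fun q => _.
have cs q : corner Q' q -> corner Q q by case=> [[Qq _] qe].
pose G' q r := G q r - G q x * g * G x r.
have cproj r : corner Q r -> corner Q' (r - x *r (k * h z r * e)).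
  move=> cr; have [Qr re] := cr.
  have [_ _ ck _] := ick.
  split; last by case: (cornerB sQ cr (cornerZ (k * h z r) sQ cx)).
  split; first by case: (cornerB sQ cr (cornerZ (k * h z r) sQ cx)).
  rewrite hformBr hformZr -(mulrA k) -(hformZr beta z r e) re mulrA ck -hformZl ze.
  by rewrite subrr.
(* A form on [Qe] vanishing on [Q'e] and at [x] vanishes. *)
have split_r q r : corner Q q -> corner Q r ->
    G q r = G q (r - x *r (k * h z r * e)) + G q x * p (rho (k * h z r * e)).
  move=> cq cr; rewrite -(pairs_Zr GQ) // -(pairs_Dr GQ) ?subrK //.
    by apply/cs/cproj.
  exact: cornerZ.
have split_l q r : corner Q q -> corner Q r ->
    G q r = G (q - x *r (k * h z q * e)) r + p (tau (rho (k * h z q * e))) * G x r.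
  move=> cq cr; rewrite -(pairs_Zl GQ) // -(pairs_Dl GQ) ?subrK //.
    by apply/cs/cproj.
  exact: cornerZ.
exists G'; split.
- move=> q q' r /cs cq /cs cq' /cs cr; rewrite /G' !(pairs_Dl GQ) // !mulrDl.
  by abel.
- move=> q r r' /cs cq /cs cr /cs cr'; rewrite /G' !(pairs_Dr GQ) // !mulrDr.
  by abel.
- by move=> q r a /cs cq /cs cr; rewrite /G' !(pairs_Zl GQ) // mulrBr !mulrA.
- by move=> q r a /cs cq /cs cr; rewrite /G' !(pairs_Zr GQ) // mulrBl !mulrA.
- move=> q cq'; have cq := cs _ cq'; have [[_ zq] qe] := cq'; split=> [Gq|bq]; last first.
    have Gq r : corner Q r -> G q r = 0 by apply: (proj2 (pairs_radl GQ cq) bq).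
    by move=> r /cs cr; rewrite /G' !Gq // mul0r mul0r subrr.
  have [a [_ aE]] := exch_lift res pe 0 (G q x * g).
  set t := p (tau _) in aE.
  have cxa : corner Q (x *r (a * e)) by apply: cornerZ.
  have cqx : corner Q (q - x *r (a * e)) by apply: cornerB.
  have GE r : corner Q r -> G (q - x *r (a * e)) r = G' q r.
    move=> cr; rewrite (pairs_Dl GQ) ?(pairs_Nl sQ GQ) ?(pairs_Zl GQ) //; last exact: cornerN.
    by rewrite -/t aE.
  have G0 r : corner Q r -> G (q - x *r (a * e)) r = 0.
    move=> cr; rewrite split_r // GE; last by apply/cs/cproj.
    rewrite Gq; last exact: cproj.
    by rewrite GE // /G' -mulrA gx mulr1 subrr mul0r addr0.
  have b0 := proj1 (pairs_radl GQ cqx) G0.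
  have t0 : t = 0.
    have := b0 z (conj Vz ze).
    rewrite (pairingBl beta res pe) (pairingZl beta res pe) //.
    rewrite (proj1 (pairing0 zq)) sub0r -/t => /eqP; rewrite oppr_eq0 => /eqP tz.
    have [y [zy _]] := division_inv dE xz.
    by rewrite -[t]mulr1 -zy mulrA tz mul0r.
  move=> v cv; have := b0 v cv.
  by rewrite (pairingBl beta res pe) (pairingZl beta res pe) // -/t t0 mul0r subr0.
- move=> r cr'; have cr := cs _ cr'; have [[_ zr] re] := cr'; split=> [Gr|br]; last first.
    have Gr q : corner Q q -> G q r = 0 by apply: (proj2 (pairs_radr GQ cr) br).
    by move=> q /cs cq; rewrite /G' !Gr // mulr0 subrr.
  have [a [aE _]] := exch_lift res pe (g * G x r) 0.
  set t := p _ in aE.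
  have cxa : corner Q (x *r (a * e)) by apply: cornerZ.
  have crx : corner Q (r - x *r (a * e)) by apply: cornerB.
  have GE q : corner Q q -> G q (r - x *r (a * e)) = G' q r.
    move=> cq; rewrite (pairs_Dr GQ) ?(pairs_Nr sQ GQ) ?(pairs_Zr GQ) //; last exact: cornerN.
    by rewrite -/t aE mulrA.
  have G0 q : corner Q q -> G q (r - x *r (a * e)) = 0.
    move=> cq; rewrite split_l // GE; last by apply/cs/cproj.
    rewrite Gr; last exact: cproj.
    by rewrite GE // /G' xg mul1r subrr mulr0 addr0.
  have b0 := proj1 (pairs_radr GQ crx) G0.
  have t0 : t = 0.
    have := b0 z (conj Vz ze).
    rewrite (pairingBr beta res pe) (pairingZr beta res pe) //.
    rewrite (proj2 (pairing0 zr)) sub0r -/t => /eqP; rewrite oppr_eq0 => /eqP.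
    exact: division_mul0.
  move=> v cv; have := b0 v cv.
  by rewrite (pairingBr beta res pe) (pairingZr beta res pe) // -/t t0 mulr0 subr0.
Qed.

End Paired.

(** * Finding a hyperbolic pair *)

(** The residue ring of such a component is [E x E^op], with the exchange involution. *)
Record exch_data (D : pzRingType) (tau : D -> D) n (X : unitary_ring 'M[D]_n.+1) :=
  ExchData {
  xE : pzRingType;
  xp : D -> xE;
  x_div : division_ring xE;
  x_proj : exchange_proj tau xp;
  x_unit : uunit X = 1
}.

Section ComponentVectors.
Variables (A : pzRingType) (X : unitary_ring A) (R : reduction X).
Variables (P : lmodType A^c) (beta : sesquilinear X P) (B : mod_reduction R beta).
Variables (i : 'I_(red_len R)) (e : A) (tau : red_D i -> red_D i).
Hypothesis cmp : component e tau.
Local Notation s := (usigma X).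
Local Notation u := (uunit X).
Local Notation h := (hform beta).
Local Notation pi := (@red_pi _ _ R).
Local Notation rho := (@red_entry _ _ _ i).
Local Notation hr := (hres beta rho).
Implicit Types (v w z x q : P) (Q U V : set P).

Let res := component_residue cmp.
Let lc := cmp_lifts cmp.
Let it := cmp_tau cmp.
Let sE := cmp_sigma cmp.

Lemma mred_hform x y :
  hform (mred_form B i) (mred_pi B i x) (mred_pi B i y) = pi i (h x y).
Proof.
by rewrite /hform !mred_formE rmorphD rmorphM -red_sigma -red_unit.
Qed.

Lemma mred_submodule V : submodule V -> submodule (mred_pi B i @` V).
Proof.
move=> [V0 VD VZ]; split; first by exists 0; rewrite ?raddf0.
  by move=> _ _ [x Vx <-] [y Vy <-]; exists (x + y); rewrite ?raddfD //; apply: VD.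
move=> _ M [x Vx <-]; have [a [aE _]] := lift_at M.
by exists (x *r a); [exact: VZ | rewrite mred_piJ aE].
Qed.

Lemma red_corner_l z x : z *r e = z -> pi i (h z x) = delta_mx ord0 ord0 * pi i (h z x).
Proof. by move=> ze; rewrite -{1}ze hformZl rmorphM (red_sigma_e it sE lc). Qed.

Lemma red_other_l z x j : z *r e = z -> j != i -> pi j (h z x) = 0.
Proof. by move=> ze ji; rewrite -ze hformZl rmorphM (red_sigma_e' lc ji) mul0r. Qed.

Lemma red_corner_r z x : x *r e = x -> pi i (h z x) = pi i (h z x) * delta_mx ord0 ord0.
Proof. by case: lc => _ [eE _] xe; rewrite -{1}xe hformZr rmorphM eE. Qed.

Lemma lift_column j : exists a, pi i a = delta_mx j ord0 /\
  pi i (s a) = delta_mx ord0 j.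
Proof.
have [a [aE _]] := lift_at (delta_mx j ord0 : 'M[red_D i]_((red_n i).+1)).
exists a; split=> //; rewrite -red_sigma aE sE; apply/matrixP => k l; rewrite !mxE.
by rewrite andbC; case: (_ && _); rewrite ?involution1 ?involution0.
Qed.

(** Multiplying by matrix units moves any entry to the corner; this is how conditions on a
    component are expressed on [Pe]. *)
Lemma hres_entry a a' v q j k : pi i (s a) = delta_mx ord0 j ->
  pi i a' = delta_mx k ord0 ->
  hr (v *r (a * e)) (q *r (a' * e)) = pi i (h v q) j k.
Proof.
move=> aE a'E; rewrite /hres hformZl hformZr usigmaM -mulrA (res_mulse res).
rewrite !mulrA (res_mule res) /red_entry !rmorphM aE a'E.
by rewrite -mulrA mul_delta_l mul_delta_r !eqxx mul1r mulr1.
Qed.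

Lemma corner_entry v a : v *r (a * e) *r e = v *r (a * e).
Proof. by rewrite -rscaleA -mulrA (res_idem res). Qed.

Lemma mred_column v a j : pi i a = delta_mx j ord0 ->
  mred_pi B i (v *r (a * e)) = mred_pi B i v *r (delta_mx j ord0 : red_A i).
Proof.
case: lc => _ [eE _] aE; rewrite mred_piJ rmorphM aE eE.
by congr (_ *r _); rewrite -mulmxE mul_delta_mx.
Qed.

Section Values.
Variables (U W : set P) (T : P -> P -> A).
Hypotheses (sU : submodule U) (sW : submodule W).
Hypothesis TZl : forall v w a, U v -> W w -> T (v *r a) w = s a * T v w.
Hypothesis TZr : forall v w a, U v -> W w -> T v (w *r a) = T v w * a.

(** The values at [v] of a sesquilinear pairing only involve the first row of a matrix,
    whose entries are reached by letting matrix units act on [w]. *)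
Lemma Jac_corner_l v : corner e U v ->
  (forall w, corner e W w -> rho (T v w) = 0) -> forall w, W w -> Jac (T v w).
Proof.
move=> [Uv ve] Tv w Ww; have TE : T v w = s e * T v w by rewrite -TZl // ve.
apply/(JacP R) => j; have [->|ji] := eqVneq j i; last first.
  by rewrite TE rmorphM (red_sigma_e' lc ji) mul0r.
rewrite TE rmorphM (red_sigma_e it sE lc); apply/matrixP => k l.
rewrite mul_delta_l [RHS]mxE; have [a [aE _]] := lift_column l.
have cw : corner e W (w *r (a * e)) by split; [exact: submoduleZ | exact: corner_entry w a].
have := Tv _ cw; rewrite TZr // mulrA (res_mule res) /red_entry rmorphM aE.
by rewrite mul_delta_r eqxx mulr1 => ->; rewrite mulr0.
Qed.

Lemma Jac_corner_r w : corner e W w ->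
  (forall v, corner e U v -> rho (T v w) = 0) -> forall v, U v -> Jac (T v w).
Proof.
move=> [Ww we] Tw v Uv; have TE : T v w = T v w * e by rewrite -TZr // we.
have [_ [eE ej]] := lc.
apply/(JacP R) => j; have [->|ji] := eqVneq j i; last first.
  by rewrite TE rmorphM ej // mulr0.
rewrite TE rmorphM eE; apply/matrixP => k l.
rewrite mul_delta_r [RHS]mxE; have [a [_ sa]] := lift_column k.
have cv : corner e U (v *r (a * e)) by split; [exact: submoduleZ | exact: corner_entry v a].
have := Tw _ cv; rewrite TZl // usigmaM -mulrA (res_mulse res) /red_entry rmorphM sa.
by rewrite mul_delta_l eqxx mul1r => ->; rewrite mul0r.
Qed.

Lemma corner_res_l v w a : corner e U v -> W w ->
  rho (T (v *r (a * e)) w) = tau (rho (a * e)) * rho (T v w).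
Proof.
move=> [Uv ve] Ww; rewrite TZl // -{1}ve TZl // mulrA (res_mul_s res).
by rewrite (res_sigma res).
Qed.

Lemma corner_res_r v w a : U v -> corner e W w ->
  rho (T v (w *r (a * e))) = rho (T v w) * rho (a * e).
Proof. by move=> Uv [Ww we]; rewrite TZr // -{1}we TZr // (res_mul res). Qed.

End Values.

Lemma Jac_corner z Q : submodule Q -> z *r e = z ->
  (forall q, corner e Q q -> hr z q = 0) -> forall q, Q q -> Jac (h z q).
Proof.
move=> sQ ze; apply: (@Jac_corner_l setT Q h) => //.
- by move=> v w a _ _; apply: hformZl.
- by move=> v w a _ _; apply: hformZr.
Qed.

Lemma corner_of_nonzero v q V Q : submodule V -> submodule Q ->
  V v -> Q q -> pi i (h v q) <> 0 ->
  exists v' q', [/\ corner e V v', corner e Q q' & hr v' q' <> 0].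
Proof.
move=> sV sQ Vv Qq; have [[j [k jk]]|ex] := pselect (exists j k, pi i (h v q) j k <> 0).
  move=> _; have [a [aE sa]] := lift_column j.
  have [a' [a'E _]] := lift_column k.
  exists (v *r (a * e)), (q *r (a' * e)); rewrite (hres_entry _ _ sa a'E).
  by split=> //; split; rewrite ?corner_entry //; apply: submoduleZ.
case; apply/matrixP => j k; rewrite mxE; apply: contrapT => jk; apply: ex.
by exists j, k.
Qed.

Section Field.
Hypothesis lam0 : forall lam, upar X lam -> rho lam = 0.

Lemma red_par_corner M : upar (red_ring i) M -> M ord0 ord0 = 0.
Proof. by rewrite red_par => -[lam llam <-]; apply: lam0. Qed.

(** Contrapositive of the criterion for null forms, lifted from the component to [P]. *)
Lemma anisotropic_corner (U : set (mred_mod B i)) V : submodule V -> submodule U ->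
  U `<=` mred_pi B i @` V -> ~ null_on (red_ring i) U (mred_form B i) ->
  exists w, [/\ corner e V w, rho (beta w w) <> 0 & U (mred_pi B i w)].
Proof.
move=> sV sU UV nonnull; apply: contrapT => now; apply: nonnull.
apply: (null_on_diagonal it sE sU red_par_corner) => x j Ux.
apply: contrapT => xj; have [v Vv vx] := UV x Ux; apply: now.
have [a [aE sa]] := lift_column j.
exists (v *r (a * e)); have wE := mred_column v aE; split.
- by split; [exact: submoduleZ | exact: corner_entry].
- rewrite /red_entry -(mred_formE B i) wE vx.
  by rewrite (sform_entry it sE).
- by rewrite wE vx; apply: submoduleZ.
Qed.

End Field.

Section ExchangeComponent.
Variables (E : pzRingType) (p : red_D i -> E).
Hypotheses (dE : division_ring E) (pe : exchange_proj tau p).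
Hypothesis u1 : uunit (red_ring i) = 1.
Hypothesis E2 : two_elements E.
Local Notation b := (pairing beta rho p).

Lemma exch_rho_u : rho u = 1.
Proof. by rewrite /red_entry -red_unit u1 -idmxE mxE eqxx. Qed.

(** Over [F_2 x F_2] an isotropic vector meeting both components of [Q] exists unless
    the pairing on [V] has rank one, in which case the complement of an anisotropic
    vector is totally singular. *)
Lemma isotropic_corner V Q z0 q1 q2 : submodule V ->
  (~ exists z : mred_mod B i,
         [/\ exists2 v, (mred_pi B i @` V) v & z = v *r red_e11 i,
             hform (mred_form B i) z z = red_e11 i
           & null_on (red_ring i)
               (form_orth (mred_form B i) [set z] `&` (mred_pi B i @` V)) (mred_form B i)]) ->
  corner e V z0 -> corner e Q q1 -> corner e Q q2 -> b z0 q1 <> 0 -> b q2 z0 <> 0 ->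
  exists z q1' q2', [/\ corner e V z, corner e Q q1', corner e Q q2', b z z = 0
    & b z q1' <> 0 /\ b q2' z <> 0].
Proof.
move=> sV no_rank1 [Vz0 z0e] cq1 cq2 z0q1 q2z0; apply: contrapT => no_z; apply: no_rank1.
have ru := exch_rho_u; have [n01 _] := dE.
have E2' (t : E) : t <> 0 -> t = 1 by case: (E2 t).
(* Otherwise any two components that are not orthogonal to [Q] pair to one. *)
have live w1 w2 r1 r2 : corner e V w1 -> corner e V w2 -> corner e Q r1 -> corner e Q r2 ->
    b r1 w1 <> 0 -> b w2 r2 <> 0 -> b w2 w1 = 1.
  move=> [Vw1 w1e] [Vw2 w2e] cr1 cr2 r1w1 w2r2; apply: E2' => w21; apply: no_z.
  have [w [Vw we ww1 ww2]] := exch_mix beta res pe sV Vw1 w1e Vw2 w2e.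
  by exists w, r2, r1; split=> //; rewrite ?ww1 ?ww2.
have z01 : b z0 z0 = 1 by apply: (live z0 z0 q2 q1).
exists (mred_pi B i z0); split.
- exists (mred_pi B i z0); first by exists z0.
  by case: lc => _ [eE _]; rewrite -{1}z0e mred_piJ eE.
- rewrite mred_hform (red_corner_l _ z0e) (red_corner_r _ z0e); apply/matrixP => j k.
  have H1 : hr z0 z0 = 1.
    apply/eqP; rewrite -subr_eq0; apply/eqP; apply: (exch_inj pe); have [tD _ _] := it.
      by rewrite (exch_add pe) (exch_N pe) (exch_1 pe) [p _]z01 subrr.
    rewrite tD (involutionN _ it) (exch_add pe) (exch_N pe) (involution1 it) (exch_1 pe).
    by rewrite (exch_tau beta res p ru) z01 subrr.
  rewrite mul_delta_l mul_delta_r -[pi i _ _ _]/(hr z0 z0) H1 mxE.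
  by case: (j == _); case: (k == _); rewrite /= ?mulr1 ?mul1r ?mulr0 ?mul0r.
have sU : submodule (form_orth (mred_form B i) [set mred_pi B i z0] `&` (mred_pi B i @` V)).
  have [V0 VD VZ] := mred_submodule sV; split.
  - by split=> // y _; rewrite (hform0l (mred_form B i)).
  - move=> x y [xz Vx] [yz Vy]; split; last exact: VD.
    by move=> t tz; rewrite hformDl xz // yz // addr0.
  - move=> x M [xz Vx]; split; last exact: VZ.
    by move=> t tz; rewrite hformZl xz // mulr0.
apply: (null_on_exchange it sE pe u1) => _x _y [xz [x Vx xE]] [yz [y Vy yE]]; rewrite -{}xE in xz *; rewrite -{}yE in yz *.
rewrite mred_hform; apply/matrixP => j k; rewrite mxE.
have orth v : V v -> hform (mred_form B i) (mred_pi B i v) (mred_pi B i z0) = 0 ->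
    forall a, b (v *r (a * e)) z0 = 0 /\ b z0 (v *r (a * e)) = 0.
  move=> Vv vz a; rewrite mred_hform in vz.
  have hz : hr (v *r (a * e)) z0 = 0.
    by rewrite /hres hformZl /red_entry rmorphM vz mulr0 mxE.
  rewrite -(exch_tau beta res p ru (v *r (a * e)) z0) /pairing hz.
  by rewrite (involution0 it) (exch_0 pe).
have [a [aE sa]] := lift_column j; have [a' [a'E sa']] := lift_column k.
rewrite -(hres_entry x y sa a'E).
set xa := x *r (a * e); set ya := y *r (a' * e).
have cx : corner e V xa by split; [exact: submoduleZ | exact: corner_entry].
have cy : corner e V ya by split; [exact: submoduleZ | exact: corner_entry].
have xo : b xa z0 = 0 /\ b z0 xa = 0 by apply: (orth x Vx); apply: xz.
have yo : b ya z0 = 0 /\ b z0 ya = 0 by apply: (orth y Vy); apply: yz.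
have dead v w : corner e V v -> corner e V w -> b v z0 = 0 /\ b z0 v = 0 ->
    b w z0 = 0 /\ b z0 w = 0 -> b v w = 0.
  move=> cv cw [vz zv] [wz zw].
  have c0 : corner e V z0 by split.
  have vQ r : corner e Q r -> b v r = 0.
    move=> cr; apply: contrapT => vr.
    by have := live z0 v q2 r c0 cv cq2 cr q2z0 vr; rewrite vz => /esym /n01.
  have Qw r : corner e Q r -> b r w = 0.
    move=> cr; apply: contrapT => rw.
    by have := live w z0 r q1 cw c0 cr cq1 rw z0q1; rewrite zw => /esym /n01.
  have := live (z0 + w) (z0 + v) q2 q1.
  rewrite !(pairingDl beta res pe) !(pairingDr beta res pe) z01 zw vz Qw // vQ // !addr0.
  move=> /(_ (cornerD sV c0 cw) (cornerD sV c0 cv) cq2 cq1 q2z0 z0q1).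
  by rewrite add0r -[X in _ = X]addr0 => /addrI.
apply: (exch_inj pe); first exact: dead.
by rewrite (exch_tau beta res p ru); apply: dead.
Qed.

End ExchangeComponent.
End ComponentVectors.

Section HyperbolicPair.
Variables (A : pzRingType) (X : unitary_ring A) (R : reduction X).
Variables (P : lmodType A^c) (beta : sesquilinear X P) (B : mod_reduction R beta).
Variables (e_ : 'I_(red_len R) -> A) (tau_ : forall i, red_D (r := R) i -> red_D i).
Hypothesis cmp_ : forall i, component (e_ i) (@tau_ i).
Variable kind_ : forall i,
  (division_ring (red_D i) + exch_data (@tau_ i) (red_ring i))%type.
Variable V : set P.
Hypothesis sV : submodule V.
Local Notation s := (usigma X).
Local Notation u := (uunit X).
Local Notation h := (hform beta).
Local Notation pi := (@red_pi _ _ R).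
Local Notation rho i := (@red_entry _ _ _ i).
Local Notation hr i := (hres beta (rho i)).
Implicit Types (i j : 'I_(red_len R)) (v w z x q : P) (Q : set P).

Hypothesis h2b : forall i, ring_iso (red_D i) 'F_2 -> split_orthogonal (red_ring i) ->
  ~ null_on (red_ring i)
     ((mred_pi B i @` V) `&` form_orth (mred_form B i) (mred_pi B i @` V)) (mred_form B i).
Hypothesis h2c : forall i, ring_iso (red_D i) ('F_2 * 'F_2)%type ->
  ~ exists z : mred_mod B i,
     [/\ exists2 v, (mred_pi B i @` V) v & z = v *r red_e11 i,
         hform (mred_form B i) z z = red_e11 i
       & null_on (red_ring i)
           (form_orth (mred_form B i) [set z] `&` (mred_pi B i @` V)) (mred_form B i)].

(** The coordinate functions of the generators [q k] are given by vectors of [V]. In this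
    form, the surjectivity of [V] onto the dual of [Q] passes to the complement of a vector
    by an explicit formula. *)
Definition dual_basis Q := exists n (q v : 'I_n -> P),
  [/\ forall k, Q (q k), forall k, V (v k)
    & forall r, Q r -> r = \sum_(k < n) q k *r h (v k) r].

Definition split_nonnull Q := forall i, split_orthogonal (red_ring i) ->
  (forall q, Q q -> mred_pi B i q = 0) \/
  ~ null_on (red_ring i) (mred_pi B i @` V) (mred_form B i).

Definition paired Q := forall i,
  match kind_ i with
  | inl _ => True
  | inr x => exists G, pairs beta (e_ i) (@tau_ i) (rho i) (xp x) V Q G
  end.

(** Lifts of the primitive idempotents of the components. *)
Definition atom (a : A) := exists i d,
  [/\ pi i a = d *: delta_mx ord0 ord0, forall j, j != i -> pi j a = 0
    & match kind_ i with
      | inl _ => d = 1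
      | inr x => (xp x d = 1 /\ xp x (tau_ d) = 0) \/
                 (xp x d = 0 /\ xp x (tau_ d) = 1)
      end].

(** A list of elements of [Q], each of which spans at most a simple module modulo the radical,
    whose values detect when [h v] is zero on [Q] modulo the radical; its length serves
    as the measure of [Q]. *)
Definition detects (L : seq (P * A)) Q :=
  (forall ga, ga \in L ->
     [/\ Q ga.1, atom ga.2 & forall v, V v -> Jac (h v ga.1 * (1 - ga.2))]) /\
  (forall v, V v -> (forall ga, ga \in L -> Jac (h v ga.1)) ->
     forall q, Q q -> Jac (h v q)).

Definition orth_of z Q : set P := fun q => Q q /\ h z q = 0.

(** An anisotropic vector of the radical of [V], needed over the field with two elements. It
    has to be orthogonal to [Q] exactly, and not only modulo the radical of [A], for its
    reflection to fix [Q]. *)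
Definition radical_vector i Q := division_ring (red_D i) ->
  (forall lam, upar X lam -> rho i lam = 0) -> two_elements (red_D i) ->
  exists w, [/\ corner (e_ i) V w, rho i (beta w w) <> 0,
    forall v, V v -> v *r e_ i = v -> hr i w v = 0 & forall q, Q q -> h w q = 0].

Let res_ i := component_residue (cmp_ i).

Lemma orth_submodule z Q : submodule Q -> submodule (orth_of z Q).
Proof.
move=> sQ; split; first by split; [exact: submodule0 | exact: hform0r].
  by move=> x y [Qx zx] [Qy zy]; split; [exact: submoduleD | rewrite hformDr zx zy addr0].
by move=> x a [Qx zx]; split; [exact: submoduleZ | rewrite hformZr zx mul0r].
Qed.

Lemma orth_project i z x k Q q : submodule Q -> Q x -> z *r e_ i = z ->
  inverse_at X (e_ i) (h z x) k -> Q q -> orth_of z Q (q - x *r (k * h z q)).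
Proof.
move=> sQ Qx ze [_ _ ck _] Qq; split.
  by apply: submoduleB => //; apply: submoduleZ.
by rewrite hformBr hformZr mulrA ck -hformZl ze subrr.
Qed.

Lemma dual_basis_orth i z x k Q : submodule Q -> Q x -> z *r e_ i = z ->
  inverse_at X (e_ i) (h z x) k -> dual_basis Q -> dual_basis (orth_of z Q).
Proof.
move=> sQ Qx ze ick [n [q [v [Qq Vv qv]]]].
exists n, (fun l => q l - x *r (k * h z (q l))), v; split=> //.
  by move=> l; apply: orth_project (ick) (Qq l).
move=> r [Qr zr].
rewrite (eq_bigr (fun l => q l *r h (v l) r - x *r (k * (h z (q l) * h (v l) r)))); last first.
  by move=> l _; rewrite rscaleBl -rscaleA mulrA.
rewrite sumrB -qv // -[X in _ - X](_ : x *r (k * h z r) = _).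
  by rewrite zr mulr0 rscaler0 subr0.
rewrite {1}(qv r Qr) hform_sumr mulr_sumr /rscale scaler_suml.
by apply: eq_bigr => l _; rewrite hformZr.
Qed.

(** Subtracting a multiple of [z] makes [v] orthogonal to [x], and hence to the removed
    generator modulo the radical, without changing its values on the complement. *)
Lemma detects_orth i z x k Q L ga0 : submodule Q -> V z -> Q x -> z *r e_ i = z ->
  x *r e_ i = x -> inverse_at X (e_ i) (h z x) k -> detects L Q -> ga0 \in L ->
  (forall v, V v -> h v x = 0 -> Jac (h v ga0.1)) ->
  exists L', (size L' < size L)%N /\ detects L' (orth_of z Q).
Proof.
move=> sQ Vz Qx ze xe ick [LQ det] ga0L x_ga0.
pose pr g := g - x *r (k * h z g).
exists [seq (pr ga.1, ga.2) | ga <- L & ga != ga0]; split.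
  rewrite size_map size_filter -(count_predC (pred1 ga0) L) -add1n leq_add2r.
  by rewrite -has_count; apply/hasP; exists ga0 => //=; rewrite eqxx.
have hpr v g : h v (pr g) = h v g - h v x * k * h z g.
  by rewrite hformBr hformZr !mulrA.
split.
  move=> ga' /mapP[ga]; rewrite mem_filter => /andP[_ /LQ[Qg ag tg]] ->.
  split=> //=; first exact: orth_project ick Qg.
  move=> v Vv; rewrite hpr mulrBl -[X in _ - X]mulrA.
  exact (JacB R (tg v Vv) (JacMl R _ (tg z Vz))).
move=> v Vv vL q [Qq zq].
pose t := sigma_inv X (h v x * k); pose v' := v - z *r t.
have Vv' : V v' by apply: submoduleB => //; apply: submoduleZ.
have hv' y : h v' y = h v y - h v x * k * h z y by rewrite hformBl hformZl sigma_invK.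
have v'x : h v' x = 0.
  have [_ _ _ kc] := ick.
  by rewrite hv' -mulrA kc -hformZr xe subrr.
suff: Jac (h v' q) by rewrite hv' zq mulr0 subr0.
apply: (det v' Vv') => // ga gaL.
have [->|ga0'] := eqVneq ga ga0; first exact: x_ga0.
rewrite hv' -hpr; apply: (vL (pr ga.1, ga.2)).
by apply/mapP; exists ga => //; rewrite mem_filter ga0'.
Qed.

(** When [z] is nonzero on [Q] modulo the radical it is so on the list; as [z] lies in one
    component, the type of the element found is one of that component. *)
Lemma detects_corner i z q Q L : detects L Q -> corner (e_ i) V z -> Q q ->
  hr i z q <> 0 ->
  exists ga d, [/\ ga \in L, pi i ga.2 = d *: delta_mx ord0 ord0,
    match kind_ i with
      | inl _ => d = 1
      | inr x => (xp x d = 1 /\ xp x (tau_ d) = 0) \/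
                 (xp x d = 0 /\ xp x (tau_ d) = 1)
      end,
    forall j, j != i -> pi j ga.2 = 0 &
    hr i z ga.1 = hr i z ga.1 * d /\ hr i z ga.1 <> 0].
Proof.
move=> [LQ det] [Vz ze] Qq zq.
have [ga [gaL gaJ]] : exists ga, ga \in L /\ ~ Jac (h z ga.1).
  apply: contrapT => noga; apply: zq; rewrite /hres /red_entry.
  suff /(JacP R) -> : Jac (h z q) by rewrite mxE.
  by apply: det => // ga gaL; apply: contrapT => gaJ; apply: noga; exists ga.
have Mi : pi i (h z ga.1) <> 0.
  move=> M0; apply: gaJ; apply/(JacP R) => j.
  by have [->|ji] := eqVneq j i; [|exact: (red_other_l beta (cmp_ i))].
have [_ [j [d [aE aj dk]]] tag] := LQ _ gaL.
have ME : pi i (h z ga.1) = pi i (h z ga.1) * pi i ga.2.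
  have /(JacP R)/(_ i) := tag z Vz; rewrite rmorphM rmorphB rmorph1 mulrBr mulr1.
  by move/eqP; rewrite subr_eq0 => /eqP.
have ij : i = j.
  by apply/eqP; apply: contrapT => /negP ij; apply: Mi; rewrite ME aj ?mulr0.
subst j; exists ga, d; split=> //.
have M00 : hr i z ga.1 = hr i z ga.1 * d.
  rewrite /hres /red_entry {1}ME aE -mulmxE mxE (bigD1 ord0) //= big1 => [|l l0].
    by rewrite !mxE !eqxx mulr1 addr0.
  by rewrite !mxE (negbTE l0) !mulr0.
split=> // M0; apply: Mi; rewrite ME (red_corner_l beta (cmp_ i) _ ze) aE.
apply/matrixP => l m; rewrite -mulrA mul_delta_l [RHS]mxE.
rewrite -mulmxE mxE big1 ?mulr0 // => l' _; rewrite !mxE.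
case: (eqVneq l' ord0) => [->|]; last by rewrite ?mulr0.
by rewrite [X in X * _](_ : _ = 0) ?mul0r //.
Qed.

(** A vector orthogonal to [Q] modulo the radical becomes orthogonal to [Q] after a
    correction in [V Jac(A)] that is read off from the dual basis. *)
Lemma lift_radical_vector i Q : submodule Q -> dual_basis Q ->
  forall w, corner (e_ i) V w -> (forall q, corner (e_ i) Q q -> hr i w q = 0) ->
  exists w', [/\ corner (e_ i) V w', rho i (beta w' w') = rho i (beta w w),
    forall v, V v -> hr i w' v = hr i w v & forall q, Q q -> h w' q = 0].
Proof.
move=> sQ [n [q [v [Qq Vv qv]]]] w [Vw we] wQ.
have JwQ := Jac_corner (cmp_ i) sQ we wQ.
pose d := \sum_(k < n) v k *r sigma_inv X (h w (q k)).
have Vd : V d by apply: submodule_sum => // k; apply: submoduleZ.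
have [bJl bJr] : (forall y, Jac (beta d y)) /\ (forall y, Jac (beta y d)).
  rewrite /d; elim/big_ind: _ => [|x y [xl xr] [yl yr]|k _]; split=> y'.
  - by rewrite sform0l; apply: (@Jac0 _ _ R).
  - by rewrite sform0r; apply: (@Jac0 _ _ R).
  - by rewrite sformDl; apply: (@JacD _ _ R).
  - by rewrite sformDr; apply: (@JacD _ _ R).
  - by rewrite sformZl sigma_invK; apply: (@JacMr _ _ R); apply: JwQ.
  - by rewrite sformZr; apply: (@JacMl _ _ R); apply: (@Jac_sigma_inv _ _ R); apply: JwQ.
have rJ a : Jac a -> rho i a = 0 by move/(JacP R) => Ja; rewrite /red_entry Ja mxE.
have hwd q' : Q q' -> h (w - d) q' = 0.
  move=> Qq'; rewrite hformBl {1}(qv q' Qq') hform_sumr hform_suml -sumrB big1 // => k _.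
  by rewrite hformZr hformZl sigma_invK subrr.
exists ((w - d) *r e_ i); split.
- split; first by apply: submoduleZ => //; apply: submoduleB.
  by rewrite -rscaleA (res_idem (res_ i)).
- rewrite sformZl sformZr (res_mulse (res_ i)) (res_mule (res_ i)).
  rewrite !(sformDl, sformDr, sformNl, sformNr) !(res_add (res_ i)) !(res_N (res_ i)).
  by rewrite (rJ (beta w d)) // (rJ (beta d w)) // (rJ (beta d d)) // !oppr0 !addr0.
- move=> x Vx; rewrite /hres hformZl (res_mulse (res_ i)) hformBl (res_B (res_ i)).
  rewrite (rJ (h d x)) ?subr0 // /hform; apply: (@JacD _ _ R) => //.
  by apply: (@JacMr _ _ R); apply: (@Jac_sigma _ _ R).
- by move=> q' Qq'; rewrite hformZl hwd // mulr0.
Qed.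

(** The vector [z] is found before its partner in [Q]: it has to define a reflection, and
    it will lie in the part of [V] that is left for the complement of that partner. Over a
    field with zero form parameter, a given vector that is not orthogonal to [Q] is
    combined with an anisotropic one. *)
Lemma reflecting_vector_division i Q z0 q0 : division_ring (red_D i) ->
  submodule Q -> dual_basis Q -> split_nonnull Q ->
  corner (e_ i) V z0 -> corner (e_ i) Q q0 -> hr i z0 q0 <> 0 ->
  exists z c k q, [/\ V z, reflector beta (e_ i) z c k, corner (e_ i) Q q,
    hr i z q <> 0 & radical_vector i (orth_of z Q)].
Proof.
move=> dD sQ dbQ nonnull cz0 cq0 zq; have [n01 _] := dD; have res := res_ i.
have [Vz0 z0e] := cz0.
have reflect w lam : corner (e_ i) V w -> upar X lam ->
    rho i (beta w w) + rho i lam <> 0 -> exists c k, reflector beta (e_ i) w c k.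
  move=> [_ we] llam /(division_inv dD)/(reflector_of_residue res we llam).
  by case=> c [k [rf _]]; exists c, k.
have reflect0 w : corner (e_ i) V w -> rho i (beta w w) <> 0 ->
    exists c k, reflector beta (e_ i) w c k.
  by move=> cw qw; apply: (reflect w 0 cw (upar0 X)); rewrite (res_0 res) addr0.
have [lam0|] := pselect (forall lam, upar X lam -> rho i lam = 0); last first.
  move=> nlam; have [lam llam rlam] : exists2 lam, upar X lam & rho i lam <> 0.
    by move/existsNP: nlam => [lam /not_implyP[]]; exists lam.
  have [c [k rf]] : exists c k, reflector beta (e_ i) z0 c k.
    have [qz|/contrapT qz] := pselect (rho i (beta z0 z0) <> 0); first exact: reflect0.
    by apply: (reflect z0 lam) => //; rewrite qz add0r.
  by exists z0, c, k, q0; split=> // _ lam0; case: nlam.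
have tauE := zero_param_tau res lam0.
have so : split_orthogonal (red_ring i).
  exact: (split_orthogonal_of_corner dD (cmp_tau (cmp_ i)) (cmp_sigma (cmp_ i)) (red_par_corner lam0)).
have {nonnull} nonnull : ~ null_on (red_ring i) (mred_pi B i @` V) (mred_form B i).
  case: (nonnull i so) => // Q0; exfalso; apply: zq; case: cq0 => Qq0 _.
  by rewrite /hres /red_entry -(mred_hform B) (Q0 _ Qq0) hform0r mxE.
have qD x y := qresD beta res lam0 x y.
have [D2|] := pselect (two_elements (red_D i)); last first.
  move=> nD2; have [t [t0 t1]] : exists t : red_D i, t <> 0 /\ t <> 1.
    by move/existsNP: nD2 => [t /not_orP[]]; exists t.
  have [|w1 [cw1 qw1 _]] := anisotropic_corner (cmp_ i) lam0 sV (mred_submodule B i sV) _ nonnull.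
    by [].
  suff [z [cz qz zq0]] : exists z, [/\ corner (e_ i) V z, rho i (beta z z) <> 0 & hr i z q0 <> 0].
    have [c [k rf]] := reflect0 z cz qz; case: cz => Vz _.
    by exists z, c, k, q0; split=> // _ _ D2; case: nD2.
  have [qz|/contrapT qz] := pselect (rho i (beta z0 z0) <> 0); first by exists z0.
  have [wq|/contrapT wq] := pselect (hr i w1 q0 <> 0); first by exists w1.
  (* On the line through [z0] and [w1] the quadratic form has a second zero at most. *)
  have [Vw1 w1e] := cw1.
  have line d : exists w, [/\ corner (e_ i) V w, hr i w q0 = hr i z0 q0
      & rho i (beta w w) = (hr i z0 w1 + d * rho i (beta w1 w1)) * d].
    have [a ad] := res_onto res d; exists (z0 + w1 *r (a * e_ i)); split.
    - by apply: (cornerD sV) => //; apply: (cornerZ res).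
    - by rewrite (hresDl beta res) (hresZl beta res) // wq mulr0 addr0.
    - rewrite qD qz add0r sformJ usigmaM -!mulrA (res_mulse res) !mulrA (res_mule res).
      have w1b : beta w1 w1 * a = beta w1 w1 * e_ i * a by rewrite -(sformZr beta w1 w1 (e_ i)) w1e.
      have sw1b : s a * (beta w1 w1 * a) = s a * s (e_ i) * (beta w1 w1 * a).
        by rewrite -[RHS]mulrA (mulrA (s (e_ i))) -sformZl w1e.
      rewrite -mulrA sw1b (res_mul_s res) w1b (res_mul res) (res_sigma res) ad tauE.
      rewrite (hresZr beta res) // (res_mule res) ad mulrDl addrC.
      by rewrite -mulrA.
  have [w [cw wq0 qw]] := line 1.
  have [qw0|/contrapT qw0] := pselect (rho i (beta w w) <> 0).
    by exists w; rewrite wq0.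
  have [w' [cw' wq0' qw']] := line t; exists w'; rewrite wq0' qw'; split=> //.
  apply: division_mul_neq0 => //; move: qw0; rewrite qw mul1r mulr1.
  move=> /eqP; rewrite addr_eq0 => /eqP ->; rewrite addrC -{2}[rho i _]mul1r -mulrBl.
  by apply: division_mul_neq0 => // /eqP; rewrite subr_eq0 => /eqP.
(* The field with two elements: the radical of [V] supplies an anisotropic vector. *)
have E2 (t : red_D i) : t <> 0 -> t = 1 by case: (D2 t).
have nn := h2b (ring_iso_F2 n01 D2) so.
have sU : submodule ((mred_pi B i @` V) `&` form_orth (mred_form B i) (mred_pi B i @` V)).
  have [V0 VD VZ] := mred_submodule B i sV; split.
  - by split=> // y _; rewrite (hform0l (mred_form B i)).
  - move=> x y [Vx xz] [Vy yz]; split; first exact: VD.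
    by move=> t tz; rewrite hformDl xz // yz // addr0.
  - move=> x M [Vx xz]; split; first exact: VZ.
    by move=> t tz; rewrite hformZl xz // mulr0.
have [|w [cw qw [_ wV]]] := anisotropic_corner (cmp_ i) lam0 sV sU _ nn; first by move=> x [].
have {}wV : forall v, V v -> hr i w v = 0.
  move=> v Vv; rewrite /hres /red_entry -(mred_hform B).
  by rewrite (wV (mred_pi B i v)) ?mxE //; exists v.
have [[q [cq wq]]|wQ] := pselect (exists q, corner (e_ i) Q q /\ hr i w q <> 0).
  have [c [k rf]] := reflect0 w cw qw; have [Vw _] := cw.
  exists w, c, k, q; split=> // _ _ _; exists w; split=> //.
    by move=> v Vv _; apply: wV.
  by move=> r [].
have {}wQ : forall q, corner (e_ i) Q q -> hr i w q = 0.
  by move=> q cq; apply: contrapT => wq; apply: wQ; exists q.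
have [w' [cw' qw' w'V w'Q]] := lift_radical_vector sQ dbQ cw wQ.
have rad z : radical_vector i (orth_of z Q).
  move=> _ _ _; exists w'; split=> //; first by rewrite qw'.
    by move=> v Vv _; rewrite w'V // wV.
  by move=> q [Qq _]; apply: w'Q.
have [qz|/contrapT qz] := pselect (rho i (beta z0 z0) <> 0).
  by have [c [k rf]] := reflect0 z0 cz0 qz; exists z0, c, k, q0.
have [||c [k rf]] := reflect0 (z0 + w); first exact: cornerD.
  by rewrite qD qz add0r (zero_param_hresC beta res lam0 w z0) wV // addr0.
exists (z0 + w), c, k, q0; split=> //; first by case: (cornerD sV cz0 cw).
by rewrite (hresDl beta res) (wQ q0 cq0) addr0.
Qed.


(** A vector over [E x E^op] that is nonzero in one component need not be so in the other;
    the selfduality of [Q] provides the missing half. *)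
Lemma reflecting_vector_exchange i (dt : exch_data (@tau_ i) (red_ring i)) Q G v1 r1 :
  submodule Q -> pairs beta (e_ i) (@tau_ i) (rho i) (xp dt) V Q G ->
  corner (e_ i) V v1 -> corner (e_ i) Q r1 -> hr i v1 r1 <> 0 ->
  exists z c k q1 q2, [/\ V z, reflector beta (e_ i) z c k,
    corner (e_ i) Q q1, corner (e_ i) Q q2
    & pairing beta (rho i) (xp dt) z q1 <> 0 /\ pairing beta (rho i) (xp dt) q2 z <> 0].
Proof.
move=> sQ GQ cv1 cr1 vr1; have res := res_ i.
case: dt G GQ => E p dE pe u1 G /= GQ.
have ru := exch_rho_u u1; have it := res_tau res.
set b := pairing _ _ _.
have btau x y : p (tau_ (hr i x y)) = b y x by apply: (exch_tau beta res p ru).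
have [z0 [q1 [q2 [cz0 cq1 cq2 [zq1 q2z]]]]] : exists z0 q1 q2,
    [/\ corner (e_ i) V z0, corner (e_ i) Q q1, corner (e_ i) Q q2
      & b z0 q1 <> 0 /\ b q2 z0 <> 0].
  have [Vv1 v1e] := cv1.
  have [vr|/contrapT vr] := pselect (b v1 r1 <> 0).
    have [q0 [cq0 Gq0]] : exists q0, corner (e_ i) Q q0 /\ G q0 r1 <> 0.
      apply: contrapT => noq; apply: vr; apply: (proj1 (pairs_radr GQ cr1)) => // q cq.
      by apply: contrapT => Gq; apply: noq; exists q.
    have [v' [[Vv' v'e] bv']] : exists v', corner (e_ i) V v' /\ b q0 v' <> 0.
      apply: contrapT => nov; apply: Gq0; apply: (proj2 (pairs_radl GQ cq0)) => // v cv.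
      by apply: contrapT => bv; apply: nov; exists v.
    have [z [Vz ze z1 z2]] := exch_mix beta res pe sV Vv' v'e Vv1 v1e.
    by exists z, r1, q0; split=> //; rewrite /b z1 z2.
  have rv : b r1 v1 <> 0.
    move=> rv; apply: vr1; apply: (exch_inj pe) => //.
    by rewrite btau.
  have [q0 [cq0 Gq0]] : exists q0, corner (e_ i) Q q0 /\ G r1 q0 <> 0.
    apply: contrapT => noq; apply: rv; apply: (proj1 (pairs_radl GQ cr1)) => // q cq.
    by apply: contrapT => Gq; apply: noq; exists q.
  have [v' [[Vv' v'e] bv']] : exists v', corner (e_ i) V v' /\ b v' q0 <> 0.
    apply: contrapT => nov; apply: Gq0; apply: (proj2 (pairs_radr GQ cq0)) => // v cv.
    by apply: contrapT => bv; apply: nov; exists v.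
  have [z [Vz ze z1 z2]] := exch_mix beta res pe sV Vv1 v1e Vv' v'e.
  by exists z, q0, r1; split=> //; rewrite /b z1 z2.
have [n01 _] := dE.
have [E2|nE2] := pselect (two_elements E).
  have iso := ring_iso_F2F2 n01 E2 it pe.
  have [z [q1' [q2' [[Vz ze] cq1' cq2' zz nz]]]] :=
    isotropic_corner (cmp_ i) dE pe u1 E2 sV (h2c iso) cz0 cq1 cq2 zq1 q2z.
  have N1 : -1 * -1 = 1 :> E by rewrite mulrNN mulr1.
  have zz' : 1 + -1 = b z z by rewrite subrr /b zz.
  have [c [k [rf _ _]]] := exch_reflector res dE pe ru ze (mulr1 1) (mulr1 1) N1 N1 zz'.
  by exists z, c, k, q1', q2'.
have [t [t0 t1]] : exists t : E, t <> 0 /\ t <> 1.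
  by move/existsNP: nE2 => [t /not_orP[]]; exists t.
have [c1 [c2 [c10 c20 c12]]] : exists c1 c2 : E, [/\ c1 <> 0, c2 <> 0 & c1 + c2 = b z0 z0].
  have [bz|/contrapT bz] := pselect (b z0 z0 <> 0); last exact: (reflecting_sum0 dE).
  exists (t * b z0 z0), ((1 - t) * b z0 z0); split.
  - exact: division_mul_neq0.
  - by apply: division_mul_neq0 => // /eqP; rewrite subr_eq0 eq_sym => /eqP.
  - by rewrite -mulrDl addrCA subrr addr0 mul1r.
have [i1 [ci1 ic1]] := division_inv dE c10.
have [i2 [ci2 ic2]] := division_inv dE c20.
have [Vz0 z0e] := cz0.
have [c [k [rf _ _]]] := exch_reflector res dE pe ru z0e ci1 ic1 ci2 ic2 c12.
by exists z0, c, k, q1, q2.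
Qed.

(** Vectors of different components are orthogonal modulo the radical, hence the
    projection along [x] does not affect the other components. *)
Lemma paired_other i j z x k Q : j != i -> submodule Q -> Q x -> z *r e_ i = z ->
  inverse_at X (e_ i) (h z x) k ->
  match kind_ j with
  | inl _ => True
  | inr dt => exists G, pairs beta (e_ j) (@tau_ j) (rho j) (xp dt) V Q G
  end ->
  match kind_ j with
  | inl _ => True
  | inr dt => exists G, pairs beta (e_ j) (@tau_ j) (rho j) (xp dt) V (orth_of z Q) G
  end.
Proof.
move=> ji sQ Qx ze ick; case: (kind_ j) => // -[E p dE pe u1] /= [G GQ]; exists G; have ru := exch_rho_u u1.
apply: (pairs_transfer sQ _ _ _ GQ); [exact: orth_submodule | by move=> q [] |].
move=> q [Qq qe]; exists (q - x *r (k * h z q)); split.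
  split; first exact: orth_project ick Qq.
  by rewrite rscaleBl -rscaleA -mulrA -hformZr qe.
move=> v _; rewrite opprB addrC subrK.
have hzero y : hr j y (x *r (k * h z q)) = 0.
  rewrite /hres /red_entry hformZr !rmorphM -{1}ze hformZl rmorphM.
  by rewrite (red_sigma_e' (cmp_lifts (cmp_ i)) ji) mul0r !mulr0 mxE.
have p0 := exch_0 pe.
rewrite -(exch_tau beta (res_ j) p ru v) /pairing !hzero.
by rewrite (involution0 (res_tau (res_ j))) p0.
Qed.

(** One step of the induction: [Q] is the sum of [xA] and of the complement of [z], and
    the complement satisfies the same hypotheses with a shorter list. *)
Lemma split_hyperbolic_pair Q L : submodule Q -> dual_basis Q -> split_nonnull Q -> paired Q ->
  detects L Q -> ~ (forall v q, V v -> Q q -> Jac (h v q)) ->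
  exists i z c k x kx,
    [/\ V z /\ reflector beta (e_ i) z c k, corner (e_ i) Q x,
        inverse_at X (e_ i) (h z x) kx,
        radical_vector i (orth_of z Q) /\ paired (orth_of z Q)
      & exists L', (size L' < size L)%N /\ detects L' (orth_of z Q)].
Proof.
move=> sQ dbQ nnQ pQ dL nJ.
have [i [v1 [r1 [cv1 cr1 vr1]]]] :
    exists i v1 r1, [/\ corner (e_ i) V v1, corner (e_ i) Q r1 & hr i v1 r1 <> 0].
  apply: contrapT => no; apply: nJ => v q Vv Qq; apply/(JacP R) => i.
  apply: contrapT => hi; apply: no; exists i.
  by have [v' [q' H]] := corner_of_nonzero (cmp_ i) sV sQ Vv Qq hi; exists v', q'.
have res := res_ i; have ee := res_idem res.
have tagL : forall ga, ga \in L ->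
    Q ga.1 /\ forall v, V v -> Jac (h v ga.1 * (1 - ga.2)).
  by move=> ga gaL; have [/(_ ga gaL)[Qg _ tg] _] := dL.
(* An element of the list that [x] spans modulo the radical can be dropped. *)
have finish z c k x kx ga : V z -> reflector beta (e_ i) z c k -> corner (e_ i) Q x ->
    inverse_at X (e_ i) (h z x) kx -> radical_vector i (orth_of z Q) ->
    match kind_ i with
    | inl _ => True
    | inr dt => exists G, pairs beta (e_ i) (@tau_ i) (rho i) (xp dt) V (orth_of z Q) G
    end ->
    ga \in L -> (forall v, V v -> h v x = 0 -> Jac (h v ga.1 * ga.2)) ->
    exists i z c k x kx,
    [/\ V z /\ reflector beta (e_ i) z c k, corner (e_ i) Q x,
        inverse_at X (e_ i) (h z x) kx,
        radical_vector i (orth_of z Q) /\ paired (orth_of z Q)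
      & exists L', (size L' < size L)%N /\ detects L' (orth_of z Q)].
  move=> Vz rf cx ick rad pi_ gaL spans; exists i, z, c, k, x, kx.
  have ze : z *r e_ i = z by case: rf.
  have [Qx xe] := cx; split=> //.
    split=> // j; have [->//|ji] := eqVneq j i.
    exact: (paired_other ji sQ Qx ze ick (pQ j)).
  apply: (detects_orth sQ Vz Qx ze xe ick dL gaL) => v Vv vx.
  rewrite -[h v ga.1]mulr1 -(subrK ga.2 1) mulrDr.
  by have [_ tg] := tagL _ gaL; exact (JacD R (tg v Vv) (spans v Vv vx)).
case Ek : (kind_ i) => [dD|dt].
  have [z [c [k [q [Vz rf cq zq rad]]]]] := reflecting_vector_division dD sQ dbQ nnQ cv1 cr1 vr1.
  have ze : z *r e_ i = z by case: rf.
  have [ga [d [gaL aE dE aj [_ gz]]]] := detects_corner dL (conj Vz ze) (proj1 cq) zq.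
  rewrite Ek in dE; have [Qg tg] := tagL _ gaL.
  pose x := ga.1 *r e_ i.
  have cx : corner (e_ i) Q x by split; [exact: submoduleZ | rewrite -rscaleA ee].
  have zx : hr i z x <> 0 by rewrite /hres hformZr (res_mule res).
  have [kx ick] := hres_unit res ze (proj2 cx) (division_inv dD zx).
  apply: (finish z c k x kx ga) => //; first by rewrite Ek.
  move=> v Vv vx; have -> : h v ga.1 * ga.2 = h v ga.1 * (ga.2 - e_ i * ga.2).
    by rewrite mulrBr mulrA -(hformZr beta v ga.1 (e_ i)) vx mul0r subr0.
  suff Ja : Jac (ga.2 - e_ i * ga.2) by exact (JacMl R _ Ja).
  apply/(JacP R) => j; rewrite rmorphB rmorphM.
  have [->|ji] := eqVneq j i; last by rewrite aj // mulr0 subr0.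
  have [_ [eE _]] := cmp_lifts (cmp_ i).
  by rewrite aE eE dE scale1r -mulmxE mul_delta_mx subrr.
have := pQ i; rewrite Ek => -[G GQ].
have [z [c [k [q1 [q2 [Vz rf cq1 cq2 [zq1 q2z]]]]]]] := reflecting_vector_exchange sQ GQ cv1 cr1 vr1.
have ze : z *r e_ i = z by case: rf.
have dE := x_div dt; have pe := x_proj dt.
have ru := exch_rho_u (x_unit dt); have it := res_tau res.
set p := xp dt in GQ zq1 q2z pe; set b := pairing _ _ _ in zq1 q2z.
have btau x y : p (tau_ (hr i x y)) = b y x by apply: (exch_tau beta res p ru).
have [n01 _] := dE.
have c0 : corner (e_ i) V 0 by split; [exact: submodule0 | rewrite rscale0r].
(* The part [z1] of [z] pairing with first components only selects an element of the list
   of the right type. *)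
have [z1 [Vz1 z1e z1r z1l]] := exch_mix beta res pe sV (proj1 c0) (proj2 c0) Vz ze.
have {}z1l : forall v, b z1 v = b z v by [].
have {}z1r : forall v, b v z1 = b v 0 by [].
have b0 y : b y 0 = 0 by rewrite /b /pairing /hres hform0r (res_0 res) (exch_0 pe).
have z1q : hr i z1 q1 <> 0.
  by move=> z1q; apply: zq1; rewrite -z1l /b /pairing z1q (exch_0 pe).
have [ga [d [gaL aE dK aj [gd gz]]]] := detects_corner dL (conj Vz1 z1e) (proj1 cq1) z1q.
rewrite Ek -/p in dK; have [Qg tg] := tagL _ gaL.
have bg : b z1 ga.1 <> 0.
  move=> bg; apply: gz; apply: (exch_inj pe) => //.
  by rewrite btau z1r b0.
have {}dK : p d = 1 /\ p (tau_ d) = 0.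
  case: dK => // -[pd _]; case: bg.
  by rewrite /b /pairing gd (exch_mul pe) pd mulr0.
pose x1 := ga.1 *r e_ i.
have cx1 : corner (e_ i) Q x1 by split; [exact: submoduleZ | rewrite -rscaleA ee].
have zx1 : b z x1 <> 0.
  by rewrite -z1l /b /pairing /hres hformZr (res_mule res).
(* The second half of [x] is chosen so that [G x x] does not vanish. *)
have [q0 [cq0 Gq0]] : exists q0, corner (e_ i) Q q0 /\ G q0 x1 <> 0.
  apply: contrapT => noq; apply: zx1; apply: (proj1 (pairs_radr GQ cx1)) => // q cq.
  by apply: contrapT => Gq; apply: noq; exists q.
have [x2 [cx2 Gx2 x2z]] : exists x2, [/\ corner (e_ i) Q x2, G x2 x1 <> 0 & b x2 z <> 0].
  have [Gq2|/contrapT Gq2] := pselect (G q2 x1 <> 0); first by exists q2.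
  have [bq0|/contrapT bq0] := pselect (b q0 z <> 0); first by exists q0.
  exists (q0 + q2); split; first exact: cornerD.
    by rewrite (pairs_Dl GQ) // Gq2 addr0.
  by rewrite /b (pairingDl beta res pe) -/b bq0 add0r.
have [a1 [a11 a12]] := exch_lift res pe 1 0; have [a2 [a21 a22]] := exch_lift res pe 0 1.
pose x := x1 *r (a1 * e_ i) + x2 *r (a2 * e_ i).
have ca1 : corner (e_ i) Q (x1 *r (a1 * e_ i)) by apply: (cornerZ res).
have ca2 : corner (e_ i) Q (x2 *r (a2 * e_ i)) by apply: (cornerZ res).
have cx : corner (e_ i) Q x by apply: cornerD.
have [Qx xe] := cx; have [_ x1e] := cx1; have [_ x2e] := cx2.
have zx : b z x <> 0.
  rewrite /b (pairingDr beta res pe) (pairingZr beta res pe _ _ x1e) (pairingZr beta res pe _ _ x2e) a11 a21.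
  by rewrite mulr1 mulr0 addr0.
have xz : b x z <> 0.
  rewrite /b (pairingDl beta res pe) (pairingZl beta res pe _ _ x1e) (pairingZl beta res pe _ _ x2e) a12 a22.
  by rewrite mul1r mul0r add0r.
have Gxx : G x x <> 0.
  rewrite (pairs_Dl GQ) // !(pairs_Zl GQ) // -/p a12 a22 mul0r mul1r add0r.
  by rewrite (pairs_Dr GQ) // !(pairs_Zr GQ) // -/p a11 a21 mulr1 mulr0 addr0.
have zxu : invertible (hr i z x).
  by apply: (exch_invertible res dE pe) => //; rewrite btau.
have [kx ick] := hres_unit res ze xe zxu.
apply: (finish z c k x kx ga) => //.
- move=> dD lam0 _; exfalso; have tE := zero_param_tau res lam0.
  by have [d1 d2] := dK; apply: n01; rewrite -d1 -d2 tE.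
- by rewrite Ek; apply: (pairs_schur res dE pe sQ GQ (conj Vz ze) cx ick zx xz Gxx).
move=> v Vv vx.
have [_ [eE ej]] := cmp_lifts (cmp_ i).
have entry a : pi i (e_ i * a * e_ i * ga.2) = (rho i (a * e_ i) * d) *: delta_mx ord0 ord0.
  have NE : d *: delta_mx ord0 ord0 =
      (d *: delta_mx ord0 ord0) * delta_mx ord0 ord0 :> 'M[red_D i]_((red_n i).+1).
    by rewrite -mulmxE -scalemxAl mul_delta_mx.
  rewrite (res_mule res) !rmorphM eE aE NE; apply/matrixP => l m.
  rewrite mulrA mul_delta_r -!mulrA mul_delta_l (mulrA (pi i a)) mul_corner !mxE !eqxx mulr1.
  by case: (l == _); case: (m == _); rewrite /= ?mulr1 ?mul1r ?mulr0 ?mul0r.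
have Ja1 : Jac (ga.2 - e_ i * a1 * e_ i * ga.2).
  apply/(JacP R) => j; rewrite rmorphB; have [->|ji] := eqVneq j i; last first.
    by rewrite aj // !rmorphM ej // !mul0r subr0.
  rewrite entry aE (_ : rho i (a1 * e_ i) * d = d) ?subrr //.
  have [tD tM _] := it; apply/eqP; rewrite -subr_eq0; apply/eqP; apply: (exch_inj pe).
    by rewrite (exch_add pe) (exch_N pe) (exch_mul pe) a11 mul1r subrr.
  rewrite tD (involutionN _ it) tM (exch_add pe) (exch_N pe) (exch_mul pe).
  by rewrite (proj2 dK) mul0r subrr.
have Ja2 : Jac (e_ i * a2 * e_ i * ga.2).
  apply/(JacP R) => j; have [->|ji] := eqVneq j i; last first.
    by rewrite !rmorphM ej // !mul0r.
  rewrite entry (_ : rho i (a2 * e_ i) * d = 0) ?scale0r //.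
  have [tD tM _] := it; apply: (exch_inj pe).
    by rewrite (exch_mul pe) a21 mul0r.
  by rewrite tM (exch_mul pe) (proj2 dK) mul0r.
have E : h v ga.1 * (ga.2 - e_ i * a1 * e_ i * ga.2) - h v x2 * (e_ i * a2 * e_ i * ga.2)
    = h v ga.1 * ga.2.
  have x1E : h v x1 = h v ga.1 * e_ i by rewrite -hformZr.
  have x2E : h v x2 = h v x2 * e_ i by rewrite -hformZr x2e.
  have H : (h v ga.1 * e_ i * (a1 * e_ i) + h v x2 * e_ i * (a2 * e_ i)) * ga.2 = 0.
    by rewrite -x1E -x2E -!hformZr -hformDr -/x vx mul0r.
  move: H; rewrite [LHS](mulrDl _ _ ga.2) => H.
  by rewrite mulrBr -[RHS]subr0 -H !mulrA; abel.
rewrite -E; exact (JacB R (JacMl R _ Ja1) (JacMl R _ Ja2)).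
Qed.


(** ** The induction *)

(** Nakayama's lemma: each generator is a combination of the others, because one minus an
    element of the radical is a unit. *)
Lemma nakayama n (q : 'I_n -> P) :
  (forall k, exists a : 'I_n -> A, (forall l, Jac (a l)) /\ q k = \sum_l q l *r a l) ->
  forall k, q k = 0.
Proof.
elim: n q => [|n IH] q qJ; first by case.
have [a [Ja q0E]] := qJ ord0.
have [t [_ ta]] := Jac_unit R (Ja ord0).
have [t' [at' _]] := Jac_unit R (Ja ord0).
pose q' l := q (lift ord0 l).
have q0 : q ord0 = \sum_l q' l *r (a (lift ord0 l) * t').
  have : q ord0 *r (1 - a ord0) = \sum_l q' l *r a (lift ord0 l).
    by rewrite rscaleBr rscaler1 {1}q0E big_ord_recl addrC addKr.
  move/(congr1 (fun y => y *r t')); rewrite -rscaleA at' rscaler1 => ->.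
  by rewrite rscale_suml; apply: eq_bigr => l _; rewrite rscaleA.
have q'0 : forall l, q' l = 0.
  apply: IH => l; have [c [Jc qE]] := qJ (lift ord0 l).
  exists (fun m => a (lift ord0 m) * t' * c ord0 + c (lift ord0 m)); split.
    by move=> m; exact (JacD R (JacMr R _ (JacMr R _ (Ja _))) (Jc _)).
  rewrite /q' qE big_ord_recl q0 rscale_suml -big_split; apply: eq_bigr => m _.
  by rewrite rscaleDr !rscaleA.
move=> k; have [l ->|->] := unliftP ord0 k; first exact: q'0.
by rewrite q0 big1 // => l _; rewrite q'0 rscale0r.
Qed.

Lemma dual_basis_zero Q : dual_basis Q -> (forall v q, V v -> Q q -> Jac (h v q)) ->
  forall q, Q q -> q = 0.
Proof.
move=> [n [q [v [Qq Vv qv]]]] J r Qr.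
have q0 : forall k, q k = 0.
  apply: nakayama => k; exists (fun l => h (v l) (q k)); split; last exact: qv.
  by move=> l; exact (J _ _ (Vv l) (Qq k)).
by rewrite (qv r Qr) big1 // => k _; rewrite q0 rscale0r.
Qed.

(** Let [phi1] extend the restriction of [psi] to the complement of [z] in [Q], and let [V']
    be the part of [V] orthogonal to the image of that complement. Reflections along
    vectors of [V'] fix this image, and [V'] contains both [phi1 z], which defines a
    reflection because [z] does, and a vector that pairs with [psi x] as [z] does with
    [x]; so they can move [phi1 x] to [psi x]. *)
Lemma extend_isometry n Q L (psi : P -> P) : (size L < n)%N -> submodule Q ->
  linear_on Q psi ->
  (forall q r, Q q -> Q r -> h (psi q) (psi r) = h q r) ->
  (forall q, Q q -> upar X (beta (psi q) (psi q) - beta q q)) ->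
  (forall q, Q q -> V (psi q - q)) ->
  (forall v, V v -> exists v', V v' /\ forall q, Q q -> h v' (psi q) = h v q) ->
  dual_basis Q -> split_nonnull Q -> paired Q -> detects L Q ->
  exists2 phi, quasi_reflection_product beta V phi & forall q, Q q -> phi q = psi q.
Proof.
elim: n Q L => // n IH Q L; rewrite ltnS => szL sQ [psiD psiZ] psiH psiU psiV psiT dbQ nnQ pQ dL.
have [J|nJ] := pselect (forall v q, V v -> Q q -> Jac (h v q)).
  exists id; first exact: qrp_id.
  have Q0 := dual_basis_zero dbQ J; have q00 := submodule0 sQ.
  move=> q Qq; rewrite (Q0 q Qq); apply: (addrI (psi 0)).
  by rewrite addr0 -psiD // addr0.
have [i [z [c [k [x [kx [[Vz rf] [Qx xe] ick [rad pQ'] [L' [szL' dL']]]]]]]]] :=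
  split_hyperbolic_pair sQ dbQ nnQ pQ dL nJ.
have ze : z *r e_ i = z by case: rf.
have res := res_ i.
set Q' := orth_of z Q in rad pQ' dL'.
have sub q : Q' q -> Q q by case.
have sQ' : submodule Q' by apply: orth_submodule.
have [phi1 qphi1 phi1E] :
    exists2 phi, quasi_reflection_product beta V phi & forall q, Q' q -> phi q = psi q.
  apply: (IH Q' L') => //.
  - exact: leq_trans szL' szL.
  - by split=> [q r /sub Qq /sub Qr|q a /sub Qq]; [exact: psiD | exact: psiZ].
  - by move=> q r /sub Qq /sub Qr; apply: psiH.
  - by move=> q /sub; apply: psiU.
  - by move=> q /sub; apply: psiV.
  - by move=> v /psiT[v' [Vv' v'E]]; exists v'; split=> // q /sub; apply: v'E.
  - exact: dual_basis_orth ick dbQ.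
  - by move=> j /nnQ[Q0|]; [left=> q /sub; apply: Q0 | right].
have iso := qrp_isometric qphi1; have [phiD phiZ phiH phiU] := iso.
have phiV v : V v -> V (phi1 v).
  by move=> Vv; rewrite -(subrK v (phi1 v)); apply: submoduleD => //; apply: qrp_displace qphi1.
pose V' : set P := fun v => V v /\ forall q, Q' q -> h v (psi q) = 0.
have sV' : submodule V'.
  split.
  - by split; [exact: submodule0 | move=> q _; rewrite hform0l].
  - move=> v w [Vv v0] [Vw w0]; split; first exact: submoduleD.
    by move=> q Qq; rewrite hformDl v0 // w0 // addr0.
  - move=> v a [Vv v0]; split; first exact: submoduleZ.
    by move=> q Qq; rewrite hformZl v0 // mulr0.
have phiV' v : V v -> (forall q, Q' q -> h v q = 0) -> V' (phi1 v).
  move=> Vv v0; split; first exact: phiV.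
  by move=> q Qq; rewrite -phi1E // phiH v0.
have lk : linkable beta (e_ i) V' (phi1 x) (psi x).
  split; first by rewrite -phiZ xe.
  - by rewrite -psiZ // xe.
  - split.
      rewrite (_ : _ - _ = (phi1 x - x) - (psi x - x)); last by abel.
      by apply: submoduleB => //; [exact: qrp_displace qphi1 | exact: psiV].
    move=> q Q'q; rewrite hformBl psiH //; last exact: sub.
    by rewrite -phi1E // phiH subrr.
  - by have := uparB (psiU x Qx) (phiU x); congr (upar X _); abel.
have zx : invertible (rho i (h z x)).
  by have := res_inverse res ick; exists (rho i kx).
have [z' [Vz' z'E]] := psiT z Vz.
have [phi2 qphi2 phi2E] : qrp_linked beta V' (phi1 x) (psi x).
  apply: (@move_vector _ _ _ _ _ i (e_ i) _ (cmp_ i) V' (phi1 z) c k (z' *r e_ i)) => //.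
  - by apply: phiV' => // q [].
  - exact: reflector_isometric rf.
  - split; first exact: submoduleZ.
    move=> q [Qq zq]; by rewrite hformZl z'E // zq mulr0.
  - by rewrite -rscaleA (res_idem res).
  - by rewrite /hres phiH.
  - by rewrite /hres hformZl z'E // -hformZl ze.
  move=> dD lam0 D2; have [w [[Vw we] qw wV wQ]] := rad dD lam0 D2.
  exists (phi1 w); split.
  - exact: phiV'.
  - by rewrite -phiZ we.
  - by have := lam0 _ (phiU w); rewrite (res_B res) => /eqP; rewrite subr_eq0 => /eqP ->.
  - have [psi1 phiK psiK] := qrp_bij qphi1.
    move=> v [Vv _] ve; rewrite -(psiK v) /hres phiH; apply: wV.
      have := submoduleB sV Vv (qrp_displace (psi1 v) sV qphi1).
      by rewrite psiK opprB addrC subrK.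
    by apply: (can_inj phiK); rewrite phiZ psiK.
exists (phi2 \o phi1).
  by apply: qrp_comp => //; apply: qrp_sub qphi2 => v [].
have [phi2D phi2Z _ _] := qrp_isometric qphi2.
move=> q Qq /=; pose q' := q - x *r (kx * h z q).
have Q'q' : Q' q' by apply: orth_project ick Qq.
have Qxa : Q (x *r (kx * h z q)) by apply: submoduleZ.
rewrite -(subrK (x *r (kx * h z q)) q) -/q' phiD phi2D psiD //; last exact: sub.
rewrite phiZ phi2Z phi2E psiZ // phi1E //; congr (_ + _).
by apply: (qrp_fix _ qphi2) => v [_ v0]; apply: v0.
Qed.

End HyperbolicPair.

(** * The initial data *)

Section Initial.
Variables (A : pzRingType) (X : unitary_ring A) (R : reduction X).
Variables (P : lmodType A^c) (beta : sesquilinear X P).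
Variables (e_ : 'I_(red_len R) -> A) (tau_ : forall i, red_D (r := R) i -> red_D i).
Hypothesis cmp_ : forall i, component (e_ i) (@tau_ i).
Variable kind_ : forall i,
  (division_ring (red_D i) + exch_data (@tau_ i) (red_ring i))%type.
Variables Q V : set P.
Hypotheses (sQ : submodule Q) (sV : submodule V).
Local Notation s := (usigma X).
Local Notation h := (hform beta).
Local Notation pi := (@red_pi _ _ R).
Local Notation rho i := (@red_entry _ _ _ i).
Implicit Types (i j : 'I_(red_len R)) (v w z x q r : P).

(** ** A list of typed generators *)

Definition typed_list (L : seq (P * A)) := forall ga, ga \in L ->
  [/\ Q ga.1, atom kind_ ga.2 & forall v, V v -> Jac (h v ga.1 * (1 - ga.2))].

Lemma merge_lists (T : finType) (C : T -> P -> Prop) :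
  (forall t, exists L, typed_list L /\
     forall v, V v -> (forall ga, ga \in L -> Jac (h v ga.1)) -> C t v) ->
  exists L, typed_list L /\
     forall v, V v -> (forall ga, ga \in L -> Jac (h v ga.1)) -> forall t, C t v.
Proof.
move=> /choice[f fP]; exists (flatten [seq f t | t <- enum T]); split.
  by move=> ga /flatten_mapP[t _ gat]; case: (fP t) => + _; apply.
move=> v Vv vL t; case: (fP t) => _; apply=> // ga gat; apply: vL.
by apply/flatten_mapP; exists t => //; rewrite mem_enum.
Qed.

Lemma atoms_exist i : exists ds : seq (red_D i),
  (forall d, d \in ds -> d * d = d /\
     match kind_ i with
     | inl _ => d = 1
     | inr x => (xp x d = 1 /\ xp x (tau_ d) = 0) \/ (xp x d = 0 /\ xp x (tau_ d) = 1)
     end) /\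
  forall m : red_D i, (forall d, d \in ds -> m * d = 0) -> m = 0.
Proof.
case: (kind_ i) => [dD|[E p dE pe u1]] /=.
  exists [:: 1]; split=> [d|m]; first by rewrite inE => /eqP ->; rewrite mulr1.
  by move=> /(_ 1); rewrite inE eqxx mulr1; apply.
have [tD tM tK] := cmp_tau (cmp_ i).
have [d1 [d11 d12]] := exch_onto pe 1 0; have [d2 [d21 d22]] := exch_onto pe 0 1.
have eqD (d d' : red_D i) : p d = p d' -> p (tau_ d) = p (tau_ d') -> d = d'.
  move=> E1 E2; apply/eqP; rewrite -subr_eq0; apply/eqP; apply: (exch_inj pe).
    by rewrite (exch_add pe) (exch_N pe) E1 subrr.
  by rewrite tD (involutionN _ (cmp_tau (cmp_ i))) (exch_add pe) (exch_N pe) E2 subrr.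
exists [:: d1; d2]; split=> [d|m md].
  rewrite !inE => /orP[/eqP ->|/eqP ->].
    split; last by left.
    by apply: eqD; rewrite ?tM (exch_mul pe) ?d11 ?d12 ?mulr1 ?mulr0.
  split; last by right.
  by apply: eqD; rewrite ?tM (exch_mul pe) ?d21 ?d22 ?mulr1 ?mulr0.
apply: (exch_inj pe).
  have := congr1 p (md d1 (mem_head _ _)); rewrite (exch_mul pe) d11 mulr1 => ->.
  exact: exch_0 pe.
have md2 : m * d2 = 0 by apply: md; rewrite !inE eqxx orbT.
have := congr1 (p \o @tau_ i) md2; rewrite /= tM (exch_mul pe) d22 mul1r => ->.
by rewrite (involution0 (cmp_tau (cmp_ i))); apply: exch_0 pe.
Qed.

(** The entries of the column [l] of [h v q] are recovered from the first columns of the [h v g],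
    where [g] runs over the multiples of [q] by lifts of [d E_(l,1)] for the primitive
    idempotents [d] of the residue ring. *)
Lemma column_list i (l : 'I_(red_n i).+1) q : Q q -> exists L, typed_list L /\
  forall v, V v -> (forall ga, ga \in L -> Jac (h v ga.1)) ->
    forall k, pi i (h v q) k l = 0.
Proof.
move=> Qq; have [ds [dsP ds0]] := atoms_exist i.
have /choice[lf lfP] : forall M : 'M[red_D i]_((red_n i).+1), exists a,
    pi i a = M /\ forall j, j != i -> pi j a = 0 by move=> M; apply: lift_at.
have lfi M : pi i (lf M) = M by case: (lfP M).
have lfj M j : j != i -> pi j (lf M) = 0 by case: (lfP M) => _; apply.
pose g (d : red_D i) := (q *r lf (d *: delta_mx l ord0), lf (d *: delta_mx ord0 ord0)).
have hg v d k : pi i (h v (g d).1) k ord0 = pi i (h v q) k l * d.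
  rewrite hformZr rmorphM lfi -mulmxE mxE (bigD1 l) //= big1 => [|m ml].
    by rewrite !mxE !eqxx mulr1 addr0.
  by rewrite !mxE (negbTE ml) !mulr0.
exists [seq g d | d <- ds]; split.
  move=> ga /mapP[d dds ->]; have [dd dk] := dsP d dds; split=> /=.
  - exact: submoduleZ.
  - exists i, d; split=> //; exact: lfj.
  - move=> v Vv; apply/(JacP R) => j; rewrite hformZr !rmorphM rmorphB rmorph1.
    have [->|ji] := eqVneq j i; last by rewrite lfj // mulr0 mul0r.
    rewrite !lfi -mulrA mulrBr mulr1 (_ : _ * (d *: delta_mx ord0 ord0) = d *: delta_mx l ord0).
      by rewrite subrr mulr0.
    apply/matrixP => k m; rewrite -mulmxE !mxE (bigD1 ord0) //= big1 => [|m' m0].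
      rewrite !mxE !eqxx andbT /= addr0.
      by case: (k == l); case: (m == _); rewrite /= ?mulr1 ?mulr0 ?mul0r ?dd.
    by rewrite !mxE (negbTE m0) andbF mulr0 mul0r.
move=> v Vv vL k; apply: ds0 => d dds; rewrite -hg.
have /(JacP R)/(_ i) -> := vL _ (map_f g dds).
by rewrite mxE.
Qed.

Lemma detects_exists : dual_basis beta V Q -> exists L, detects beta kind_ V L Q.
Proof.
move=> [n [q [v' [Qq Vv' qv]]]].
suff [L [gL LC]] : exists L, typed_list L /\
    forall v, V v -> (forall ga, ga \in L -> Jac (h v ga.1)) ->
      forall k, Jac (h v (q k)).
  exists L; split=> // v Vv vL r Qr; rewrite (qv r Qr) hform_sumr.
  apply: (@Jac_sum _ _ R) => k; rewrite hformZr.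
  exact (JacMr R _ (LC v Vv vL k)).
apply: merge_lists => k.
have [L [gL LC]] : exists L, typed_list L /\
    forall v, V v -> (forall ga, ga \in L -> Jac (h v ga.1)) ->
      forall i, pi i (h v (q k)) = 0.
  apply: merge_lists => i.
  have [L [gL LC]] : exists L, typed_list L /\
      forall v, V v -> (forall ga, ga \in L -> Jac (h v ga.1)) ->
        forall l k', pi i (h v (q k)) k' l = 0.
    by apply: merge_lists => l; apply: column_list.
  exists L; split=> // v Vv vL; apply/matrixP => k' l.
  by rewrite (LC v Vv vL l k') mxE.
by exists L; split=> // v Vv vL; apply/(JacP R); apply: LC.
Qed.

(** ** Selfduality *)

Lemma dual_form v : V v -> in_dual Q (h v).
Proof. by split=> *; [exact: hformDr | exact: hformZr]. Qed.

Lemma in_dual_sum (f : P -> A) n (y : 'I_n -> P) : in_dual Q f -> (forall k, Q (y k)) ->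
  f (\sum_k y k) = \sum_k f (y k).
Proof.
move=> [fD fZ] Qy; have f0 : f 0 = 0.
  by rewrite -(rscaler0 0) fZ ?mulr0 //; apply: submodule0.
elim: n y Qy => [|n IH] y Qy; first by rewrite !big_ord0.
rewrite !big_ord_recl fD //; last exact: submodule_sum.
by rewrite IH.
Qed.

(** The pairing is the residue of the isomorphism [F], viewed as a unimodular sesquilinear form
    on [Q]: bijectivity of [F] identifies both its radicals with the part of [Q] in
    [Q Jac(A)], which is also what [V] does not see. *)
Lemma paired_exists : dual_basis beta V Q ->
  (forall f, in_dual Q f -> exists v, V v /\ dual_eq Q (h v) f) ->
  iso_dual X Q -> paired beta e_ kind_ V Q.
Proof.
move=> [n [q_ [v_ [Qq_ Vv_ qv]]]] onto [F [Fdual FD FZ Finj Fsurj]] i.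
case: (kind_ i) => // -[E p dE pe u1] /=.
have res := component_residue (cmp_ i); have it := cmp_tau (cmp_ i).
have ru := exch_rho_u u1.
have F_Zl v w a : Q v -> Q w -> F (v *r a) w = s a * F v w.
  by move=> Qv Qw; have := FZ v a Qv w Qw.
have F_Zr v w a : Q v -> Q w -> F v (w *r a) = F v w * a.
  by move=> Qv Qw; have [_ Z] := Fdual v Qv; apply: Z.
have F_Dl v v' w : Q v -> Q v' -> Q w -> F (v + v') w = F v w + F v' w.
  by move=> Qv Qv' Qw; apply: FD.
have F_Dr v w w' : Q v -> Q w -> Q w' -> F v (w + w') = F v w + F v w'.
  by move=> Qv Qw Qw'; have [D _] := Fdual v Qv; apply: D.
have F_suml m (y : 'I_m -> P) w : (forall k, Q (y k)) -> Q w ->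
    F (\sum_k y k) w = \sum_k F (y k) w.
  move=> Qy Qw; have F0 : F 0 w = 0.
    by rewrite -(rscaler0 0) F_Zl ?sigma0 ?mul0r //; apply: submodule0.
  elim: m y Qy => [|m IH] y Qy; first by rewrite !big_ord0.
  rewrite !big_ord_recl F_Dl //; last exact: submodule_sum.
  by rewrite IH.
have hZl v w a : V v -> Q w -> h (v *r a) w = s a * h v w by move=> *; apply: hformZl.
have hZr v w a : V v -> Q w -> h v (w *r a) = h v w * a by move=> *; apply: hformZr.
(* Vectors of [Q Jac] are recognized by [F], from both sides, and by [h]. *)
have FJ_h y : Q y -> (forall r, Q r -> Jac (F y r)) -> forall v, V v -> Jac (h v y).
  move=> Qy Fy v Vv.
  have /choice[y_ y_P] : forall k, exists y', Q y' /\ dual_eq Q (F y') (h (v_ k)).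
    by move=> k; apply: Fsurj; apply: dual_form.
  pose c k := F y (q_ k).
  have yE : y = \sum_k y_ k *r sigma_inv X (c k).
    apply: Finj => //.
      by apply: submodule_sum => // k; apply: submoduleZ => //; case: (y_P k).
    move=> r Qr; rewrite F_suml //; last by move=> k; apply: submoduleZ => //; case: (y_P k).
    rewrite {1}(qv r Qr) (in_dual_sum (Fdual y Qy)); last by move=> k; apply: submoduleZ.
    apply: eq_bigr => k _; have [Qyk ykE] := y_P k.
    by rewrite F_Zr // F_Zl // sigma_invK ykE.
  rewrite yE hform_sumr; apply: (@Jac_sum _ _ R) => k; rewrite hformZr.
  exact (JacMl R _ (Jac_sigma_inv R (Fy _ (Qq_ k)))).
have h_FJ y : Q y -> (forall v, V v -> Jac (h v y)) ->
    forall r, Q r -> Jac (F y r) /\ Jac (F r y).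
  move=> Qy hy r Qr; split.
    rewrite {1}(qv y Qy) F_suml //; last by move=> k; apply: submoduleZ.
    apply: (@Jac_sum _ _ R) => k; rewrite F_Zl //.
    exact (JacMr R _ (Jac_sigma R (hy _ (Vv_ k)))).
  rewrite {1}(qv y Qy) (in_dual_sum (Fdual r Qr)); last by move=> k; apply: submoduleZ.
  apply: (@Jac_sum _ _ R) => k; rewrite F_Zr //.
  exact (JacMl R _ (hy _ (Vv_ k))).
have JF_h y : Q y -> (forall r, Q r -> Jac (F r y)) -> forall v, V v -> Jac (h v y).
  move=> Qy Fy v Vv; have [y' [Qy' y'E]] := Fsurj _ (dual_form Vv).
  by rewrite -y'E //; exact (Fy _ Qy').
have rJ a : Jac a -> rho i a = 0 by move/(JacP R) => Ja; rewrite /red_entry Ja mxE.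
have [tD tM tK] := it; have p0 := exch_0 pe.
have eq0 (d : red_D i) : p d = 0 -> p (tau_ d) = 0 -> d = 0 by apply: (exch_inj pe).
have btau x y : p (tau_ (hres beta (rho i) x y)) = pairing beta (rho i) p y x.
  exact: (exch_tau beta res p ru).
have [a1 [a11 a12]] := exch_lift res pe 1 0; have [a2 [a21 a22]] := exch_lift res pe 0 1.
set d1 := rho i (a1 * e_ i) in a11 a12; set d2 := rho i (a2 * e_ i) in a21 a22.
exists (fun q r => p (rho i (F q r))); split.
- by move=> q q' r [Qq _] [Qq' _] [Qr _]; rewrite F_Dl // (res_add res) (exch_add pe).
- by move=> q r r' [Qq _] [Qr _] [Qr' _]; rewrite F_Dr // (res_add res) (exch_add pe).
- move=> q r a cq [Qr _].
  by rewrite (corner_res_l (cmp_ i) F_Zl a cq Qr) (exch_mul pe).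
- move=> q r a [Qq _] cr.
  by rewrite (corner_res_r (cmp_ i) F_Zr a Qq cr) (exch_mul pe).
- move=> q cq; have [Qq qe] := cq; set y := q *r (a2 * e_ i).
  have cy : corner (e_ i) Q y by apply: (cornerZ res).
  have [Qy ye] := cy; split=> [Fq v [Vv ve]|bq r [Qr re]].
    have FyJ : forall r, Q r -> Jac (F y r).
      apply: (Jac_corner_l (cmp_ i) sQ F_Zl F_Zr cy) => r cr; have [Qr _] := cr.
      rewrite (corner_res_l (cmp_ i) F_Zl a2 cq Qr) -/d2; apply: eq0.
        by rewrite (exch_mul pe) Fq // mulr0.
      by rewrite tM tK (exch_mul pe) a21 mulr0.
    have /rJ := FJ_h y Qy FyJ v Vv.
    rewrite (corner_res_r (cmp_ i) hZr a2 Vv cq) -/d2 => /(congr1 (p \o @tau_ i)) /=.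
    by rewrite tM (exch_mul pe) a22 mul1r (involution0 it) p0 -btau.
  have hyJ : forall v, V v -> Jac (h v y).
    apply: (Jac_corner_r (cmp_ i) sV hZl hZr cy) => v cv; have [Vv _] := cv.
    rewrite (corner_res_r (cmp_ i) hZr a2 Vv cq) -/d2; apply: eq0.
      by rewrite (exch_mul pe) a21 mulr0.
    by rewrite tM (exch_mul pe) -/(hres beta (rho i) v q) btau bq // mulr0.
  have [/rJ] := h_FJ y Qy hyJ r Qr.
  rewrite (corner_res_l (cmp_ i) F_Zl a2 cq Qr) -/d2 => /(congr1 p).
  by rewrite (exch_mul pe) a22 mul1r p0.
- move=> r cr; have [Qr re] := cr; set y := r *r (a1 * e_ i).
  have cy : corner (e_ i) Q y by apply: (cornerZ res).
  have [Qy ye] := cy; split=> [Fr v [Vv ve]|br q [Qq qe]].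
    have FyJ : forall q, Q q -> Jac (F q y).
      apply: (Jac_corner_r (cmp_ i) sQ F_Zl F_Zr cy) => q cq; have [Qq _] := cq.
      rewrite (corner_res_r (cmp_ i) F_Zr a1 Qq cr) -/d1; apply: eq0.
        by rewrite (exch_mul pe) Fr // mul0r.
      by rewrite tM (exch_mul pe) a12 mul0r.
    have /rJ := JF_h y Qy FyJ v Vv.
    rewrite (corner_res_r (cmp_ i) hZr a1 Vv cr) -/d1 => /(congr1 p).
    by rewrite (exch_mul pe) a11 mulr1 p0.
  have hyJ : forall v, V v -> Jac (h v y).
    apply: (Jac_corner_r (cmp_ i) sV hZl hZr cy) => v cv; have [Vv _] := cv.
    rewrite (corner_res_r (cmp_ i) hZr a1 Vv cr) -/d1; apply: eq0.
      by rewrite (exch_mul pe) -/(hres beta (rho i) v r) -/(pairing beta (rho i) p v r) br // mul0r.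
    by rewrite tM (exch_mul pe) a12 mul0r.
  have [_ /rJ] := h_FJ y Qy hyJ q Qq.
  rewrite (corner_res_r (cmp_ i) F_Zr a1 Qq cr) -/d1 => /(congr1 p).
  by rewrite (exch_mul pe) a11 mulr1 p0.
Qed.

End Initial.

(** ** Dual bases of projective modules *)

Section Projective.
Variables (A : pzRingType) (P : lmodType A^c).

Definition generated_map n (g : 'I_n -> P) (x : 'rV[A^c]_n) : P :=
  \sum_k x ord0 k *: g k.

Lemma generated_map_linear n (g : 'I_n -> P) : linear (generated_map g).
Proof.
move=> a x y; rewrite /generated_map scaler_sumr -big_split; apply: eq_bigr => k _.
by rewrite !mxE scalerDl scalerA.
Qed.

HB.instance Definition _ n (g : 'I_n -> P) :=
  GRing.isLinear.Build A^c 'rV[A^c]_n P _ (generated_map g) (generated_map_linear g).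

(** The coordinates of a section of the map from a free module onto [P]. *)
Lemma projective_dual_basis : fin_gen P -> projective P ->
  exists n (g : 'I_n -> P) (f : 'I_n -> P -> A),
    (forall Q k, in_dual Q (f k)) /\ forall x, x = \sum_k g k *r f k x.
Proof.
move=> [n [g gen]] proj.
have [|h hE] := proj _ _ (generated_map g) idfun.
  move=> y; have [a ->] := gen y; exists (\row_k (a k : A^c)).
  by apply: eq_bigr => k _; rewrite mxE.
exists n, g, (fun k x => h x ord0 k); split=> [Q k|x]; last exact: esym (hE x).
split=> [x y _ _|x a _]; first by rewrite linearD mxE.
by rewrite /rscale linearZ mxE.
Qed.

Lemma summand_projection (Q : set P) : summand Q -> exists pr : P -> P,
  [/\ forall x, Q (pr x), forall x, Q x -> pr x = x,
      forall x y, pr (x + y) = pr x + pr y & forall x (a : A), pr (x *r a) = pr x *r a].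
Proof.
move=> [sQ [Q' [sQ' QQ' dec]]].
have /choice[pr prP] : forall x, exists y, Q y /\ Q' (x - y).
  by move=> x; have [y [z [Qy Q'z ->]]] := dec x; exists y; split=> //; rewrite addrC addKr.
have uniq x y : Q y -> Q' (x - y) -> pr x = y.
  move=> Qy Q'xy; have [Qp Q'p] := prP x; apply/eqP; rewrite -subr_eq0; apply/eqP.
  have : (Q `&` Q') (pr x - y).
    split; first exact: submoduleB.
    by rewrite (_ : _ - _ = (x - y) - (x - pr x)); [exact: submoduleB | abel].
  by rewrite QQ'.
exists pr; split=> [x|x Qx|x y|x a]; first by case: (prP x).
- by apply: uniq => //; rewrite subrr; apply: submodule0.
- have [Qx Q'x] := prP x; have [Qy Q'y] := prP y; apply: uniq; first exact: submoduleD.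
  by rewrite (_ : _ - _ = (x - pr x) + (y - pr y)); [exact: submoduleD | abel].
- have [Qx Q'x] := prP x; apply: uniq; first exact: submoduleZ.
  by rewrite -rscaleBl; apply: submoduleZ.
Qed.

End Projective.

Lemma dual_basis_exists (A : pzRingType) (X : unitary_ring A) (P : lmodType A^c)
    (beta : sesquilinear X P) (Q V : set P) : fin_gen P -> projective P -> summand Q ->
  LQ_onto beta Q V -> dual_basis beta V Q.
Proof.
move=> fgP projP sQ [_ onto].
have [n [g [f [fdual gf]]]] := projective_dual_basis fgP projP.
have [pr [Qpr prQ prD prZ]] := summand_projection sQ.
have /choice[v vP] : forall k, exists v, V v /\ dual_eq Q (hform beta v) (f k).
  by move=> k; apply: onto.
exists n, (fun k => pr (g k)), v; split=> [//|k|r Qr]; first by case: (vP k).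
have pr0 : pr 0 = 0 by apply: (addrI (pr 0)); rewrite -prD !addr0.
rewrite -[LHS](prQ r Qr) {1}(gf r) (big_morph pr prD pr0); apply: eq_bigr => k _.
by rewrite prZ; have [_ ->] := vP k.
Qed.

Lemma component_kind (A : pzRingType) (X : unitary_ring A) (R : reduction X) i e
    (tau : red_D (r := R) i -> red_D i) : component e tau ->
  inhabited (division_ring (red_D i) + exch_data tau (red_ring i)).
Proof.
by move=> cmp; case: (cmp_kind cmp) => [dD|[E [p [dE pe u1]]]]; split;
  [left | right; exists E p].
Qed.

Lemma null_on_hform (A : pzRingType) (X : unitary_ring A) (P : lmodType A^c)
    (beta : sesquilinear X P) (Q : set P) (psi : P -> P) :
  null_on X Q (fun x y => beta (psi x) (psi y) - beta x y) ->
  forall q r, Q q -> Q r -> hform beta (psi q) (psi r) = hform beta q r.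
Proof.
move=> [skew _] q r Qq Qr; have := skew q r Qq Qr.
rewrite sigmaB mulrBl opprB => /eqP; rewrite subr_eq => /eqP E.
by rewrite /hform E; abel.
Qed.

(** The functional [h v] on [Q] is carried to [S] by [psi], and [V] maps onto the dual of
    [S]. *)
Lemma transport_dual (A : pzRingType) (X : unitary_ring A) (P : lmodType A^c)
    (beta : sesquilinear X P) (Q S V : set P) (psi : P -> P) :
  submodule Q -> linear_on Q psi -> set_bij Q S psi -> LQ_onto beta S V ->
  forall v, exists v', V v' /\ forall q, Q q -> hform beta v' (psi q) = hform beta v q.
Proof.
move=> sQ [psiD psiZ] [psiQ psiI psiS] [_ onto] v.
have /choice[g gP] : forall y, exists q, S y -> Q q /\ psi q = y.
  move=> y; have [Sy|nSy] := pselect (S y); last by exists 0.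
  by have [q Qq <-] := psiS y Sy; exists q.
have gpsi q : Q q -> g (psi q) = q.
  move=> Qq; have [Qg gE] := gP _ (psiQ q Qq).
  by apply: psiI => //; rewrite inE.
have [|v' [Vv' v'E]] := onto (fun y => hform beta v (g y)).
  split=> [x y Sx Sy|x a Sx].
    have [Qx <-] := gP _ Sx; have [Qy <-] := gP _ Sy.
    by rewrite -psiD // !gpsi // ?hformDr //; apply: submoduleD.
  have [Qx <-] := gP _ Sx.
  by rewrite -psiZ // !gpsi // ?hformZr //; apply: submoduleZ.
exists v'; split=> // q Qq.
by rewrite v'E ?gpsi //; apply: psiQ.
Qed.

Theorem theorem4p5 (A : pzRingType) (X : unitary_ring A)
  (hA : semiperfect A)
  (R : reduction X) (hR : normalized R)
  (P : lmodType A^c) (hPfg : fin_gen P) (hPproj : projective P)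
  (beta : sesquilinear X P)
  (B : mod_reduction R beta)
  (Q S V : set P) (hQ : summand Q) (hS : summand S) (hV : summand V)
  (psi : P -> P) (hpsi : quad_isometry beta Q beta S psi)
  (h1a : LQ_onto beta Q V /\ LQ_onto beta S V)
  (h1b : forall x, Q x -> V (psi x - x))
  (h1c : iso_dual X Q /\ iso_dual X S)
  (h2a : forall i : 'I_(red_len R), split_orthogonal (red_ring i) ->
     mred_pi B i @` Q = [set 0] \/
     ~ null_on (red_ring i) (mred_pi B i @` V) (mred_form B i))
  (h2b : forall i : 'I_(red_len R), ring_iso (red_D i) 'F_2 ->
     split_orthogonal (red_ring i) ->
     ~ null_on (red_ring i)
         ((mred_pi B i @` V) `&` form_orth (mred_form B i) (mred_pi B i @` V)) (mred_form B i))
  (h2c : forall i : 'I_(red_len R), ring_iso (red_D i) ('F_2 * 'F_2)%type ->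
     ~ exists z : mred_mod B i,
         [/\ exists2 v, (mred_pi B i @` V) v & z = v *r red_e11 i,
             hform (mred_form B i) z z = red_e11 i
           & null_on (red_ring i)
               (form_orth (mred_form B i) [set z] `&` (mred_pi B i @` V)) (mred_form B i)]) :
  exists phi : P -> P,
    [/\ quad_isometry beta setT beta setT phi,
        forall x, Q x -> phi x = psi x,
        quasi_reflection_product beta V phi
      & forall x, V (phi x - x)].
Proof.
have cmpE := @component_exists _ _ R hA hR.
pose e_ i := sval (cid (cmpE i)).
pose tau_ i := sval (cid (svalP (cid (cmpE i)))).
have cmp_ i : component (e_ i) (tau_ i) := svalP (cid (svalP (cid (cmpE i)))).
have kind_ i : (division_ring (red_D i) + exch_data (tau_ i) (red_ring i))%type.
  have [k _] : {k : (division_ring (red_D i) + exch_data (tau_ i) (red_ring i))%type | True}.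
    by apply: cid; case: (component_kind (cmp_ i)) => k; exists k.
  exact: k.
have [sQ _] := hQ; have [sV _] := hV; have [h1Q h1S] := h1a.
have [psiL psiB psiN] := hpsi.
have dbQ := dual_basis_exists hPfg hPproj hQ h1Q.
have pQ : paired beta e_ kind_ V Q.
  by apply: (paired_exists cmp_ kind_ sQ sV dbQ); [case: h1Q | case: h1c].
have [L dL] := detects_exists cmp_ kind_ sQ dbQ.
have nnQ : split_nonnull B V Q.
  move=> i so; case: (h2a i so) => [Q0|]; [left=> q Qq | by right].
  by have : (mred_pi B i @` Q) (mred_pi B i q) by [exists q]; rewrite Q0.
have [phi qphi phiE] : exists2 phi, quasi_reflection_product beta V phi
    & forall q, Q q -> phi q = psi q.
  apply: (extend_isometry cmp_ sV h2b h2c (ltnSn (size L)) sQ psiL _ _ h1b _ dbQ nnQ pQ dL).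
  - exact: null_on_hform psiN.
  - by case: psiN.
  - by move=> v _; apply: (transport_dual sQ psiL psiB h1S).
exists phi; split=> //.
  by apply: isometric_quad; [exact: qrp_isometric qphi | exact: qrp_bij qphi].
by move=> x; apply: qrp_displace qphi.
Qed.
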